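(* Let $f_i$, $i\in\mathcal I$, be uniformly bounded, and suppose that for every $i\in\mathcal I$: (1) $h_i(t,\xi)$ is uniformly bounded, measurable in $t$, continuous in $\xi$ uniformly in $t$, and precompact; (2) $f_i=\hat f_i+\Delta f_i$, where (a) $\hat f_i(t,\xi)$ is uniformly bounded, measurable in $t$, continuous in $\xi$ uniformly in $t$, and precompact, and (b) $(h_i,\Delta f_i)$ is a zeroing pair. Let $\mathcal T$ be a family of trajectories of the switched system $\dot x=f(t,x,\sigma)$ which is invariant with respect to a closed covering $\chi=\{\chi_i\}_{i\in\mathcal I}$ of $\mathbb R^n$. Then the pair $(h,f)$ is weakly zero-state detectable (WZSD) with respect to $\mathcal T$ if each reduced limiting control system $\Sigma_\gamma$ ($\gamma\in\Lambda$) for $\mathcal T$ is WZSD.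
   Context: **Switched system.** $\mathcal I=\{1,\dots,N\}$; $\mathcal X\subset\mathbb R^n$ is an open neighborhood of the origin. A switching signal is a function $\sigma:\mathbb R\to\mathcal I$ that is piecewise constant (finitely many jumps in each compact interval) and right-continuous; $\mathcal S$ is the set of all of them. Given $f:\mathbb R_{\ge0}\times\mathcal X\times\mathcal I\to\mathbb R^n$ and $h:\mathbb R_{\ge0}\times\mathcal X\times\mathcal I\to\mathbb R^p$, write $f_i(t,\xi)=f(t,\xi,i)$, $h_i(t,\xi)=h(t,\xi,i)$. The switched system with output is $\dot x(t)=f(t,x(t),\sigma(t))$, $y(t)=h(t,x(t),\sigma(t))$. Standing assumption: each $f_i,h_i$ is measurable in $t$ and continuous in $\xi$, and each $f_i$ satisfies the Carathéodory conditions (in addition, on each compact subset of $\mathbb R_{\ge0}\times\mathcal X$, $|f_i(t,\xi)|\le m(t)$ for some integrable $m$). A solution corresponding to $\sigma$ is a locally absolutely continuous $x:[t_0(x),t_f(x))\to\mathcal X$, $0\le t_0(x)<t_f(x)\le\infty$, with $\dot x(t)=f(t,x(t),\sigma(t))$ a.e.; it is maximal if it cannot be extended to a solution (for the same $\sigma$) on $[t_0(x),t')$ with $t'>t_f(x)$. A trajectory is a pair $(x,\sigma)$ with $\sigma\in\mathcal S$ and $x$ a maximal solution corresponding to $\sigma$. **Invariance.** $\chi=\{\chi_i\}_{i\in\mathcal I}$ is a closed covering of $\mathbb R^n$ if each $\chi_i$ is closed and $\bigcup_i\chi_i=\mathbb R^n$. $\mathcal T$ is invariant w.r.t. $\chi$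 if $x(t)\in\chi_{\sigma(t)}$ for all $(x,\sigma)\in\mathcal T$ and $t\in[t_0(x),t_f(x))$. Put $\mathcal I_\xi=\{i\in\mathcal I:\xi\in\chi_i\}$ and $U_\xi=\mathrm{co}\{e_i:i\in\mathcal I_\xi\}$, where $e_i$ is the $i$-th canonical vector of $\mathbb R^N$ and $\mathrm{co}$ is convex hull. **WZSD of a pair.** A sequence $\{(t_k,x_k,\sigma_k)\}_{k\in\mathbb N}$ is a $\mathcal T$-zeroing-output sequence if $t_k\to\infty$, $(x_k,\sigma_k)\in\mathcal T$ for all $k$, and: (1) $t_0(x_k)\le t_k+t<t_f(x_k)$ for all $t\in[-k,k]$ and all $k$; (2) there are a compact $K\subset\mathcal X$ and $\varepsilon>0$ with $x_k(t_k+t)\in K$ and $|x_k(t_k+t)|\ge\varepsilon$ for all $t\in[-k,k]$ and all $k$; (3) $\lim_{k\to\infty}h(t_k+t,x_k(t_k+t),\sigma_k(t_k+t))=0$ for almost all $t\in\mathbb R$. The pair $(h,f)$ is WZSD w.r.t. $\mathcal T$ if there are no $\mathcal T$-zeroing-output sequences. **Regularity notions.** For $g:J\times\mathcal X\to\mathbb R^m$, $J$ an interval: $g$ is uniformly bounded if there is $J'\subset J$ with $|J\setminus J'|=0$ such that $g$ is bounded on $J'\times K$ for each compact $K\subset\mathcal X$; measurable in $t$ if $g(\cdot,\xi)$ is Lebesgue measurable for all $\xi$; continuous in $\xi$ if $g(t,\cdot)$ is continuous for almost all $t$; continuous in $\xi$ uniformly in $t$ if there is $J'\subset J$ with $|J\setminus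 J'|=0$ such that for every compact $K\subset\mathcal X$ there is a continuous strictly increasing $\omega_K:\mathbb R_{\ge0}\to\mathbb R_{\ge0}$, $\omega_K(0)=0$, with $|g(t,\xi)-g(t,\zeta)|\le\omega_K(|\xi-\zeta|)$ for all $t\in J'$, $\xi,\zeta\in K$. For $g:\mathbb R_{\ge0}\times\mathcal X\to\mathbb R^m$, a sequence $\gamma=\{t_k\}$ of nonnegative times is admissible for $g$ if $t_k\to\infty$ and there are $g_\gamma:\mathbb R\times\mathcal X\to\mathbb R^m$ and a null set $E_\gamma\subset\mathbb R$ with $\lim_k g(t_k+s,\xi)=g_\gamma(s,\xi)$ for all $\xi\in\mathcal X$, $s\in\mathbb R\setminus E_\gamma$; $g_\gamma$ is the limiting function and $\Lambda(g)$ the set of admissible sequences. $g$ is precompact if every sequence $t_k\to\infty$ in $\mathbb R_{\ge0}$ has a subsequence in $\Lambda(g)$. A pair $(g,\hat g)$ of functions on $\mathbb R_{\ge0}\times\mathcal X$ is a zeroing pair if for every sequence $t_k\to\infty$ in $\mathbb R_{\ge0}$, compact $K\subset\mathcal X$, $\varepsilon>0$ and sequence $\{v_k\}$ in $K$ with $|v_k|\ge\varepsilon$ for all $k$: $g(t_k,v_k)\to0$ implies $\hat g(t_k,v_k)\to0$. **Reduced limiting control systems.** $U=\{\mu\in\mathbb R_{\ge0}^N:\sum_i\mu_i=1\}$; $\mathcal U$ is the set of Lebesgue measurable $u:\mathbb R\to U$. A switching signal $\sigma$ is identified with the control $t\mapsto e_{\sigma(t)}$ in $\mathcal U$. For $u_k,u\in\mathcal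 U$, $u_k\rightharpoonup u$ means $\int_{\mathbb R}\varphi(t)'u_k(t)\,dt\to\int_{\mathbb R}\varphi(t)'u(t)\,dt$ for all $\varphi\in L^1(\mathbb R;\mathbb R^N)$. $\mathcal S_{\mathcal T}=\{\sigma\in\mathcal S:\exists x,\ (x,\sigma)\in\mathcal T\}$; $\mathcal S^*_{\mathcal T}$ is the set of $u\in\mathcal U$ for which there are $t_k\to\infty$ and $\sigma_k\in\mathcal S_{\mathcal T}$ with $\sigma_k(t_k+\cdot)\rightharpoonup u$. With the decomposition $f_i=\hat f_i+\Delta f_i$ fixed, $\Lambda=\bigcap_{i\in\mathcal I}[\Lambda(\hat f_i)\cap\Lambda(h_i)]$. For $\gamma\in\Lambda$ let $\hat F_\gamma=[\hat f_{1,\gamma}\cdots\hat f_{N,\gamma}]$ and $\hat H_\gamma=[|h_{1,\gamma}|\cdots|h_{N,\gamma}|]$. The reduced limiting control system is $$\Sigma_\gamma:\ \dot x=\hat F_\gamma(t,x)u,\quad y=\hat H_\gamma(t,x)u=0,\quad u(t)\in U_{x(t)},\ u\in\mathcal S^*_{\mathcal T}.$$ A complete trajectory of $\Sigma_\gamma$ is a pair $(x,u)$ with $x:\mathbb R\to\mathcal X$ locally absolutely continuous, $u\in\mathcal S^*_{\mathcal T}$ and, for almost all $t\in\mathbb R$, $u(t)\in U_{x(t)}$, $\dot x(t)=\hat F_\gamma(t,x(t))u(t)$, $\hat H_\gamma(t,x(t))u(t)=0$; it is bounded if $x(\mathbb R)$ is contained in a compact subset of $\mathcal X$. $\Sigma_\gamma$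 is WZSD if $\inf_{t\in\mathbb R}|x(t)|=0$ for every bounded complete trajectory $(x,u)$ of $\Sigma_\gamma$. *)

(* Defs.v *)
From HB Require Import structures.
From mathcomp Require Import all_boot all_order all_algebra.
From mathcomp Require Import all_classical all_reals all_analysis.

Set Implicit Arguments.
Unset Strict Implicit.
Unset Printing Implicit Defensive.

Import Order.TTheory GRing.Theory Num.Theory.
Import numFieldNormedType.Exports.

Local Open Scope classical_set_scope.
Local Open Scope ring_scope.

(* The reals with the sigma-algebra of Lebesgue measurable sets, i.e. the
   domain of [completed_lebesgue_measure]. The carrier is [R] itself, whose
   default sigma-algebra in the library is the Borel one. *)
Notation lebR R := (caratheodory_type (wlength (R := R) idfun)^*%mu).
Notation leb := completed_lebesgue_measure.

(* The library's norm on matrices is the max norm. *)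
Definition enorm (R : realType) (m : nat) (v : 'cV[R]_m) : R :=
  Num.sqrt (\sum_(i < m) v i 0 ^+ 2).

Definition nneg (R : realType) : set R := `[0, +oo[.

(* Functions on J * X are total functions whose values off J * X play no role:
   every condition below is restricted to times in J and points of X. *)

Definition uniformly_bounded (R : realType) (n m : nat) (J : set R)
    (X : set 'cV[R]_n) (g : R -> 'cV[R]_n -> 'cV[R]_m) : Prop :=
  exists J' : set R, [/\ J' `<=` J, leb.-negligible (J `\` J') &
    forall K : set 'cV[R]_n, compact K -> K `<=` X ->
      exists M : R, forall t xi, J' t -> K xi -> enorm (g t xi) <= M].

Definition measurable_in_time (R : realType) (n m : nat) (J : set R)
    (X : set 'cV[R]_n) (g : R -> 'cV[R]_n -> 'cV[R]_m) : Prop :=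
  forall xi, X xi -> forall j : 'I_m,
    measurable_fun (J : set (lebR R)) (fun t : lebR R => g t xi j 0).

Definition continuous_in_state (R : realType) (n m : nat) (J : set R)
    (X : set 'cV[R]_n) (g : R -> 'cV[R]_n -> 'cV[R]_m) : Prop :=
  {ae leb, forall t : R, J t -> {within X, continuous (g t)}}.

Definition modulus (R : realType) (w : R -> R) : Prop :=
  [/\ w 0 = 0, {within @nneg R, continuous w} &
      forall a b, 0 <= a -> a < b -> w a < w b].

Definition continuous_in_state_uniformly (R : realType) (n m : nat)
    (J : set R) (X : set 'cV[R]_n) (g : R -> 'cV[R]_n -> 'cV[R]_m) : Prop :=
  exists J' : set R, [/\ J' `<=` J, leb.-negligible (J `\` J') &
    forall K : set 'cV[R]_n, compact K -> K `<=` X ->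
      exists2 w : R -> R, modulus w &
        forall t xi zeta, J' t -> K xi -> K zeta ->
          enorm (g t xi - g t zeta) <= w (enorm (xi - zeta))].

Definition caratheodory_conditions (R : realType) (n m : nat)
    (X : set 'cV[R]_n) (g : R -> 'cV[R]_n -> 'cV[R]_m) : Prop :=
  [/\ measurable_in_time (@nneg R) X g,
      continuous_in_state (@nneg R) X g &
      forall C : set (R * 'cV[R]_n), compact C -> C `<=` @nneg R `*` X ->
        exists2 b : lebR R -> R,
          leb.-integrable (@nneg R : set (lebR R)) (EFin \o b) &
          forall t xi, C (t, xi) -> enorm (g t xi) <= b t].

(* For each s, the argument gamma k + s is nonnegative for k large enough. *)
Definition limiting_function (R : realType) (n m : nat) (X : set 'cV[R]_n)
    (g : R -> 'cV[R]_n -> 'cV[R]_m) (gamma : nat -> R)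
    (glim : R -> 'cV[R]_n -> 'cV[R]_m) : Prop :=
  exists2 E : set R, leb.-negligible E &
    forall s xi, ~ E s -> X xi ->
      g (gamma k + s) xi @[k --> \oo] --> glim s xi.

Definition admissible (R : realType) (n m : nat) (X : set 'cV[R]_n)
    (g : R -> 'cV[R]_n -> 'cV[R]_m) (gamma : nat -> R) : Prop :=
  [/\ forall k, 0 <= gamma k, gamma @ \oo --> +oo &
      exists glim, limiting_function X g gamma glim].

Definition precompact_in_time (R : realType) (n m : nat) (X : set 'cV[R]_n)
    (g : R -> 'cV[R]_n -> 'cV[R]_m) : Prop :=
  forall t_ : nat -> R, (forall k, 0 <= t_ k) -> t_ @ \oo --> +oo ->
    exists2 s : nat -> nat, {homo s : i j / (i < j)%N} &
      admissible X g (t_ \o s).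

Definition zeroing_pair (R : realType) (n m m' : nat) (X : set 'cV[R]_n)
    (g : R -> 'cV[R]_n -> 'cV[R]_m) (g' : R -> 'cV[R]_n -> 'cV[R]_m') : Prop :=
  forall (t_ : nat -> R) (K : set 'cV[R]_n) (eps : R) (v : nat -> 'cV[R]_n),
    (forall k, 0 <= t_ k) -> t_ @ \oo --> +oo ->
    compact K -> K `<=` X -> 0 < eps ->
    (forall k, K (v k)) -> (forall k, eps <= enorm (v k)) ->
    g (t_ k) (v k) @[k --> \oo] --> (0 : 'cV[R]_m) ->
    g' (t_ k) (v k) @[k --> \oo] --> (0 : 'cV[R]_m').

Definition abs_continuous (R : realType) (n : nat) (a b : R)
    (x : R -> 'cV[R]_n) : Prop :=
  forall eps : R, 0 < eps -> exists2 delta : R, 0 < delta &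
    forall (m : nat) (lo hi : 'I_m -> R),
      (forall i, [/\ a <= lo i, lo i <= hi i & hi i <= b]) ->
      trivIset setT (fun i => `]lo i, hi i[%classic) ->
      \sum_(i < m) (hi i - lo i) < delta ->
      \sum_(i < m) enorm (x (hi i) - x (lo i)) < eps.

(* "t is not a jump" is local constancy at t. *)
Definition switching_signal (R : realType) (N : nat) (sigma : R -> 'I_N)
    : Prop :=
  (forall t : R, \forall s \near t^'+, sigma s = sigma t) /\
  (forall a b : R, finite_set
     [set t | a <= t <= b /\ ~ (\forall s \near t, sigma s = sigma t)]).

(* A curve on [t0, tf[; the values of [state] off this interval are junk. *)
Record curve (R : realType) (n : nat) := Curve {
  t0 : R;
  tf : \bar R;
  state :> R -> 'cV[R]_n
}.

Definition cdom (R : realType) (n : nat) (x : curve R n) : set R :=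
  [set t | t0 x <= t /\ (t%:E < tf x)%E].

Definition is_solution (R : realType) (n N : nat) (X : set 'cV[R]_n)
    (f : R -> 'cV[R]_n -> 'I_N -> 'cV[R]_n) (sigma : R -> 'I_N)
    (x : curve R n) : Prop :=
  [/\ 0 <= t0 x, ((t0 x)%:E < tf x)%E,
      forall t, cdom x t -> X (x t),
      forall a b, cdom x a -> cdom x b -> a <= b -> abs_continuous a b x &
      {ae leb, forall t : R, cdom x t ->
         is_derive t (1 : R) x (f t (x t) (sigma t))}].

Definition is_maximal_solution (R : realType) (n N : nat) (X : set 'cV[R]_n)
    (f : R -> 'cV[R]_n -> 'I_N -> 'cV[R]_n) (sigma : R -> 'I_N)
    (x : curve R n) : Prop :=
  is_solution X f sigma x /\
  ~ (exists x' : curve R n,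
       [/\ is_solution X f sigma x', t0 x' = t0 x, (tf x < tf x')%E &
           forall t, cdom x t -> x' t = x t]).

Definition is_trajectory (R : realType) (n N : nat) (X : set 'cV[R]_n)
    (f : R -> 'cV[R]_n -> 'I_N -> 'cV[R]_n)
    (z : curve R n * (R -> 'I_N)) : Prop :=
  switching_signal z.2 /\ is_maximal_solution X f z.2 z.1.

Definition closed_covering (R : realType) (n N : nat)
    (chi : 'I_N -> set 'cV[R]_n) : Prop :=
  (forall i, closed (chi i)) /\ \bigcup_i chi i = setT.

Definition invariant_wrt (R : realType) (n N : nat)
    (T : set (curve R n * (R -> 'I_N))) (chi : 'I_N -> set 'cV[R]_n) : Prop :=
  forall x sigma, T (x, sigma) -> forall t, cdom x t -> chi (sigma t) (x t).

Definition zeroing_output_sequence (R : realType) (n N p : nat)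
    (X : set 'cV[R]_n) (h : R -> 'cV[R]_n -> 'I_N -> 'cV[R]_p)
    (T : set (curve R n * (R -> 'I_N))) (t_ : nat -> R)
    (x_ : nat -> curve R n) (sigma_ : nat -> R -> 'I_N) : Prop :=
  [/\ t_ @ \oo --> +oo,
      forall k, T (x_ k, sigma_ k),
      forall k (t : R), - k%:R <= t <= k%:R -> cdom (x_ k) (t_ k + t),
      exists (K : set 'cV[R]_n) (eps : R),
        [/\ compact K, K `<=` X, 0 < eps &
          forall k (t : R), - k%:R <= t <= k%:R ->
            K (x_ k (t_ k + t)) /\ eps <= enorm (x_ k (t_ k + t))] &
      {ae leb, forall t : R,
         h (t_ k + t) (x_ k (t_ k + t)) (sigma_ k (t_ k + t)) @[k --> \oo]
           --> (0 : 'cV[R]_p)}].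

(* The vector field f of the pair (h, f) enters through T, a family of
   trajectories of the system defined by f. *)
Definition wzsd_pair (R : realType) (n N p : nat) (X : set 'cV[R]_n)
    (h : R -> 'cV[R]_n -> 'I_N -> 'cV[R]_p)
    (T : set (curve R n * (R -> 'I_N))) : Prop :=
  ~ (exists t_ x_ sigma_, zeroing_output_sequence X h T t_ x_ sigma_).

Definition convex_hull (R : realType) (N : nat) (A : set 'cV[R]_N)
    : set 'cV[R]_N :=
  [set v | exists (m : nat) (w : 'I_m -> R) (a : 'I_m -> 'cV[R]_N),
     [/\ forall i, 0 <= w i, \sum_(i < m) w i = 1, forall i, A (a i) &
         v = \sum_(i < m) w i *: a i]].

Definition canonical_vector (R : realType) (N : nat) (i : 'I_N) : 'cV[R]_N :=
  delta_mx i 0.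

Definition state_controls (R : realType) (n N : nat)
    (chi : 'I_N -> set 'cV[R]_n) (xi : 'cV[R]_n) : set 'cV[R]_N :=
  convex_hull (@canonical_vector R N @` [set i | chi i xi]).

Definition simplex (R : realType) (N : nat) : set 'cV[R]_N :=
  [set mu | (forall i, 0 <= mu i 0) /\ \sum_(i < N) mu i 0 = 1].

Definition controls (R : realType) (N : nat) : set (R -> 'cV[R]_N) :=
  [set u : R -> 'cV[R]_N |
     (forall i, measurable_fun setT (fun t : lebR R => u t i 0)) /\
     forall t, @simplex R N (u t)].

Definition signal_control (R : realType) (N : nat) (sigma : R -> 'I_N)
    : R -> 'cV[R]_N :=
  fun t => canonical_vector R (sigma t).

Definition weakly_converges (R : realType) (N : nat)
    (u_ : nat -> R -> 'cV[R]_N) (u : R -> 'cV[R]_N) : Prop :=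
  forall phi : R -> 'cV[R]_N,
    (forall i, leb.-integrable [set: lebR R]
                 (fun t : lebR R => (phi t i 0)%:E)) ->
    \int[leb]_t ((phi t)^T *m u_ k t) 0 0 @[k --> \oo]
      --> (\int[leb]_t ((phi t)^T *m u t) 0 0 : R).

Definition family_signals (R : realType) (n N : nat)
    (T : set (curve R n * (R -> 'I_N))) : set (R -> 'I_N) :=
  [set sigma | exists x, T (x, sigma)].

Definition limiting_controls (R : realType) (n N : nat)
    (T : set (curve R n * (R -> 'I_N))) : set (R -> 'cV[R]_N) :=
  [set u | @controls R N u /\
     exists (t_ : nat -> R) (sigma_ : nat -> R -> 'I_N),
       [/\ t_ @ \oo --> +oo, forall k, family_signals T (sigma_ k) &
           weakly_converges
             (fun k t => signal_control (sigma_ k) (t_ k + t)) u]].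

Definition common_admissible (R : realType) (n N p : nat) (X : set 'cV[R]_n)
    (fhat : R -> 'cV[R]_n -> 'I_N -> 'cV[R]_n)
    (h : R -> 'cV[R]_n -> 'I_N -> 'cV[R]_p) : set (nat -> R) :=
  [set gamma | forall i,
     admissible X (fun t xi => fhat t xi i) gamma /\
     admissible X (fun t xi => h t xi i) gamma].

Definition Fhat_mx (R : realType) (n N : nat)
    (flim : R -> 'cV[R]_n -> 'I_N -> 'cV[R]_n) (t : R) (xi : 'cV[R]_n)
    : 'M[R]_(n, N) := \matrix_(j, i) flim t xi i j 0.

Definition Hhat_mx (R : realType) (n N p : nat)
    (hlim : R -> 'cV[R]_n -> 'I_N -> 'cV[R]_p) (t : R) (xi : 'cV[R]_n)
    : 'rV[R]_N := \row_i enorm (hlim t xi i).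

Definition complete_trajectory (R : realType) (n N p : nat) (X : set 'cV[R]_n)
    (chi : 'I_N -> set 'cV[R]_n) (T : set (curve R n * (R -> 'I_N)))
    (flim : R -> 'cV[R]_n -> 'I_N -> 'cV[R]_n)
    (hlim : R -> 'cV[R]_n -> 'I_N -> 'cV[R]_p)
    (x : R -> 'cV[R]_n) (u : R -> 'cV[R]_N) : Prop :=
  [/\ forall t, X (x t),
      forall a b, a <= b -> abs_continuous a b x,
      limiting_controls T u &
      {ae leb, forall t : R,
         [/\ state_controls chi (x t) (u t),
             is_derive t (1 : R) x (Fhat_mx flim t (x t) *m u t) &
             Hhat_mx hlim t (x t) *m u t = 0]}].

Definition wzsd_limiting_system (R : realType) (n N p : nat)
    (X : set 'cV[R]_n) (chi : 'I_N -> set 'cV[R]_n)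
    (T : set (curve R n * (R -> 'I_N)))
    (flim : R -> 'cV[R]_n -> 'I_N -> 'cV[R]_n)
    (hlim : R -> 'cV[R]_n -> 'I_N -> 'cV[R]_p) : Prop :=
  forall x u, complete_trajectory X chi T flim hlim x u ->
    (exists K : set 'cV[R]_n, [/\ compact K, K `<=` X & range x `<=` K]) ->
    inf (range (fun t => enorm (x t))) = 0.

(* Limiting functions are determined up to a null set of times, independent of
   the state, so the system attached to gamma does not depend on their choice
   as far as its complete trajectories are concerned. *)
Definition reduced_limiting_system_wzsd (R : realType) (n N p : nat)
    (X : set 'cV[R]_n) (chi : 'I_N -> set 'cV[R]_n)
    (T : set (curve R n * (R -> 'I_N)))
    (fhat : R -> 'cV[R]_n -> 'I_N -> 'cV[R]_n)
    (h : R -> 'cV[R]_n -> 'I_N -> 'cV[R]_p) (gamma : nat -> R) : Prop :=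
  forall (flim : R -> 'cV[R]_n -> 'I_N -> 'cV[R]_n)
         (hlim : R -> 'cV[R]_n -> 'I_N -> 'cV[R]_p),
    (forall i, limiting_function X (fun t xi => fhat t xi i) gamma
                 (fun t xi => flim t xi i)) ->
    (forall i, limiting_function X (fun t xi => h t xi i) gamma
                 (fun t xi => hlim t xi i)) ->
    wzsd_limiting_system X chi T flim hlim.

(* Main.v *)
Require Import Defs.
From HB Require Import structures.
From mathcomp Require Import all_boot all_order all_algebra.
From mathcomp Require Import all_classical all_reals all_analysis.
From mathcomp Require Import measurable_realfun.
From mathcomp Require Import ring lra.

(** Along a zeroing-output sequence the shifted states [z_k] are uniformly
    Lipschitz with values in a compact set and the shifted signals [v_k] are
    indicator-valued, so a subsequence has [z_k -> z] pointwise and [v_k -> u]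
    weakly, while the shifting times become admissible for all the [fhat_i] and
    [h_i].  Since the outputs vanish, the zeroing-pair condition removes the
    perturbations [Df_i]; dominated convergence then passes to the limit in the
    integrated equation, in the weighted integrals of the outputs and in the
    weighted integrals over [z @^-1` (~` chi_i)].  This makes [(z, u)] a
    bounded complete trajectory of the reduced limiting system with [enorm z]
    bounded away from 0. *)

Import Order.TTheory GRing.Theory Num.Theory.
Import numFieldNormedType.Exports.

Set Implicit Arguments.
Unset Strict Implicit.
Unset Printing Implicit Defensive.

Local Open Scope classical_set_scope.
Local Open Scope ring_scope.

(** * The completed Lebesgue measure versus the Borel one *)

Section completed_lebesgue.
Variable R : realType.
Local Notation mu := (@lebesgue_measure R).
Local Notation lam := (@completed_lebesgue_measure R).

(** The obstacle is a product in which both factors move: the vector field is evaluated at moving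
    states while the active index oscillates and converges only weakly. At almost every time the
    field differs by a vanishing amount from [flim t (z t)] taken at the same active index. That
    expression depends on [k] through the index alone, and linearly in its indicators, so weak
    convergence against fixed integrable functions suffices. Boundedness of the fields makes the
    constants uniform: an absolutely continuous curve whose derivative is bounded almost everywhere
    is Lipschitz with that bound. Pointwise constraints on the limit control are read off
    nonnegative functions with zero integral, and closedness of [chi i] enters as openness of its
    complement. All almost-everywhere statements concern the completed Lebesgue measure, whereas
    outer regularity and the differentiation theorem are applied to the Borel one on the same
    carrier. Hence the transfer between the two sigma-algebras that comes first. *)

Lemma borel_measurable_leb (A : set R) :
  measurable (A : set (measurableTypeR R)) -> measurable (A : set (lebR R)).
Proof. exact: sub_caratheodory. Qed.

Lemma borel_negligible_leb (A : set R) : mu.-negligible A -> lam.-negligible A.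
Proof.
by case=> B [mB B0 AB]; exists B; split => //; exact: borel_measurable_leb.
Qed.

(** The Carathéodory sigma-algebra is the completion of the Borel one. Transfers from the completed
    to the Borel side rest on this decomposition. *)
Lemma leb_measurable_decomp (A : set R) : measurable (A : set (lebR R)) ->
  exists B C : set R, [/\ measurable (B : set (measurableTypeR R)),
    measurable (C : set (measurableTypeR R)), mu C = 0, B `<=` A & A `<=` B `|` C].
Proof.
rewrite -[measurable _]/(((wlength idfun)^*%mu).-cara.-measurable A).
rewrite -completed_caratheodory_measurable g_sigma_completed_algebra_genE.
move=> [B mB [N [C [mC C0 NC]] <-]]; exists B, C; split => //.
by move=> x [Bx|Nx]; [left|right; exact: NC].
Qed.

Lemma leb_negligible_borel (A : set R) : lam.-negligible A -> mu.-negligible A.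
Proof.
case=> B [mB B0 AB]; have [D [C [mD mC C0 DB BDC]]] := leb_measurable_decomp mB.
exists (D `|` C); split; first exact: measurableU.
  apply/eqP; rewrite measureU0 // eq_le measure_ge0 andbT -[leRHS]B0.
  (* On Borel sets the two measures are the same function, so monotonicity of [lam] applies. *)
  change (lam D <= lam B)%E.
  by apply: le_measure => //; rewrite inE //; exact: borel_measurable_leb.
exact: subset_trans AB BDC.
Qed.

Lemma negligible_leb_measurable (A : set R) :
  lam.-negligible A -> measurable (A : set (lebR R)).
Proof. exact: negligible_sub_caratheodory. Qed.

Lemma measurable_fun_leb d (Y : measurableType d) (D : set R) (f : R -> Y) :
  measurable (D : set (measurableTypeR R)) ->
  measurable_fun (D : set (measurableTypeR R)) f ->
  measurable_fun (D : set (lebR R)) (f : lebR R -> Y).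
Proof.
by move=> mD mf _ B mB; apply: borel_measurable_leb; exact: mf.
Qed.

Lemma measurable_id_leb :
  measurable_fun setT (idfun : lebR R -> measurableTypeR R).
Proof. by move=> _ B mB; rewrite setTI; exact: borel_measurable_leb. Qed.

(** By completeness: within the exceptional null set a preimage under [g] is a subset of a null set,
    hence measurable whatever [g] does there. *)
Lemma ae_measurable_leb d (Y : measurableType d) (D : set R) (f g : lebR R -> Y) :
  measurable (D : set (lebR R)) ->
  measurable_fun (D : set (lebR R)) f ->
  {ae lam, forall t, D t -> f t = g t} ->
  measurable_fun (D : set (lebR R)) g.
Proof.
move=> mD mf fg _ B mB.
have [N [mN N0 fgN]] := fg.
have -> : D `&` g @^-1` B = ((D `&` f @^-1` B) `\` N) `|` (D `&` g @^-1` B `&` N).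
  apply/seteqP; split=> [t [Dt gB]|t [[[Dt fB] Nt]|[]//]].
    have [Nt|Nt] := pselect (N t); first by right.
    left; split=> //; split=> //=; rewrite (_ : f t = g t)//.
    by apply: contrapT => fgt; apply: Nt; apply: fgN => /(_ Dt).
  split=> //=; rewrite -(_ : f t = g t)//.
  by apply: contrapT => fgt; apply: Nt; apply: fgN => /(_ Dt).
apply: measurableU; first by apply: measurableD => //; exact: mf.
by apply: negligible_leb_measurable; exists N; split=> // t [].
Qed.

(** Each superlevel set of [g] at a rational is Borel up to a Borel null set. Setting [g] to zero on
    the countable union of these null sets makes every superlevel set Borel. The last conjunct
    carries bounds on the absolute value of [g] over to [g']. *)
Lemma borel_modification (g : lebR R -> R) : measurable_fun setT g ->
  exists2 g' : R -> R, measurable_fun (setT : set (measurableTypeR R)) g' &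
    {ae lam, forall t, g t = g' t} /\ forall t, g' t = g t \/ g' t = 0.
Proof.
move=> mg.
have mB (q : rat) := leb_measurable_decomp (mg measurableT _ (measurable_itv `]ratr q, +oo[)).
have [B] := choice mB; move=> {mB} /choice[C BC].
(* The union over the rationals is indexed by naturals through [unpickle], with the empty set for
   naturals that encode no rational. *)
pose N := \bigcup_n (oapp C set0 (unpickle n)).
have mN : measurable (N : set (measurableTypeR R)).
  apply: bigcupT_measurable => n; case: unpickle => [q|] //=.
  by have [] := BC q.
have N0 : mu.-negligible N.
  apply: negligible_bigcup => n; case: unpickle => [q|] /=.
    by have [_ mC C0 _ _] := BC q; exists (C q); split.
  exact: negligible_set0.
have CN q : C q `<=` N by move=> t Ct; exists (pickle q); [exact: I|rewrite pickleK].
exists (fun t => if t \in N then 0 else g t); last split.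
- apply: (measurability _ (RGenOInfty.measurableE R)).
  move=> _ [_ [r ->] <-].
  rewrite setTI.
  (* Points of [N] now have value 0, so they belong to the superlevel set exactly when [r < 0]. *)
  have -> : (fun t => if t \in N then 0 else g t) @^-1` `]r, +oo[ =
     ((\bigcup_n (oapp (fun q => if (r <= ratr q) then B q else set0) set0 (unpickle n))) `\` N)
       `|` (if r < 0 then N else set0).
    apply/seteqP; split => t /=.
      case: ifPn => [tN|/negP tN].
        by rewrite in_itv/= andbT => ->; right; exact/set_mem.
      rewrite in_itv/= andbT => rg; left; split; last by move=> /mem_set.
      have [q] := rat_in_itvoo rg; rewrite in_itv/= => /andP[rq qg].
      exists (pickle q); first exact: I.
      rewrite pickleK /= (ltW rq).
      have [_ _ _ _] := BC q.
      move=> /(_ t) []//; first by split => //=; rewrite in_itv/= qg.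
      by move=> /CN/mem_set.
    case=> [[[n _]]|].
      case: unpickle => //= q; case: ifPn => // rq Bt Nt.
      rewrite memNset// in_itv/= andbT.
      have [_ _ _ BCq _] := BC q.
      have [_ /=] := BCq t Bt.
      by rewrite in_itv/= andbT; exact: le_lt_trans.
    case: ifPn => // r0 Nt; rewrite mem_set// in_itv/= andbT//.
  apply: measurableU; last by case: ifP.
  apply: measurableD => //; apply: bigcupT_measurable => n.
  case: unpickle => [q|] //=; case: ifPn => // _.
  by have [] := BC q.
- apply: (negligibleS _ (borel_negligible_leb N0)) => t /=.
  by case: ifPn => [/set_mem //|_ /(_ erefl)].
- by move=> t; case: ifPn; [right|left].
Qed.

(** [mu] is the pushforward of [lam] under the identity from the completed to the Borel
    sigma-algebra, so the change of variables formula applies; likewise for [integral_leb]. *)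
Lemma integrable_leb (f : R -> \bar R) (D : set R) :
  measurable (D : set (measurableTypeR R)) ->
  mu.-integrable D f -> lam.-integrable (D : set (lebR R)) f.
Proof.
move=> mD /integrableP[mf fi]; apply/integrableP; split.
  exact: measurable_fun_leb.
have := @ge0_integral_pushforward _ _ (lebR R) (measurableTypeR R) R idfun
  measurable_id_leb lam D (fun x => `|f x|)%E mD.
rewrite preimage_id => <- //; last exact: measurableT_comp.
Qed.

Lemma integral_leb (f : R -> \bar R) (D : set R) :
  measurable (D : set (measurableTypeR R)) ->
  measurable_fun (setT : set (measurableTypeR R)) f ->
  lam.-integrable (D : set (lebR R)) f ->
  (\int[lam]_(x in D) f x = \int[mu]_(x in D) f x)%E.
Proof.
move=> mD mf fi.
have := @integral_pushforward _ _ (lebR R) (measurableTypeR R) R idfun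
  measurable_id_leb lam D f mf.
by rewrite preimage_id => <-.
Qed.

End completed_lebesgue.

(** * Translations, almost-everywhere reasoning and differentiation of integrals *)

Section lebesgue_tools.
Variable R : realType.
Local Notation mu := (@lebesgue_measure R).
Local Notation lam := (@completed_lebesgue_measure R).

Lemma measurable_shift (c : R) :
  measurable_fun setT (fun t : measurableTypeR R => (c + t)%R : measurableTypeR R).
Proof.
by apply: measurable_funD => //; exact: measurable_cst.
Qed.

(** By uniqueness of Lebesgue measure: the pushforward under the translation has the right value on
    half-open intervals. *)
Lemma lebesgue_measure_shift (c : R) (A : set R) :
  measurable (A : set (measurableTypeR R)) ->
  mu ((fun t => c + t) @^-1` A) = mu A.
Proof.
move=> mA; apply/esym.
have ms := measurable_shift c.
pose nu := pushforward mu (fun t : measurableTypeR R => c + t : measurableTypeR R).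
rewrite -[RHS]/(nu A); apply: lebesgue_measure_unique => // X [[a b] _ <-] /=.
rewrite /nu /= /pushforward.
have -> : (fun t => c + t) @^-1` `]a, b] = `]a - c, b - c]%classic.
  by apply/seteqP; split => t /=; rewrite !in_itv/= ltrBlDl lerBrDl.
rewrite !lebesgue_measure_itv/= !lte_fin ltrD2r.
by case: ifP => // _; rewrite -!EFinB opprB addrA subrK.
Qed.

Lemma negligible_shift (c : R) (A : set R) : lam.-negligible A ->
  lam.-negligible ((fun t => c + t) @^-1` A).
Proof.
move=> /leb_negligible_borel[B [mB B0 AB]]; apply: borel_negligible_leb.
exists ((fun t => c + t) @^-1` B); split.
- by rewrite -[X in measurable X]setTI; exact: measurable_shift.
- by rewrite lebesgue_measure_shift.
- by move=> t /AB.
Qed.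

Lemma ae_leb_sub (P Q : R -> Prop) : {ae lam, forall t, P t} ->
  (forall t, P t -> Q t) -> {ae lam, forall t, Q t}.
Proof. by move=> h PQ; apply: negligibleS h => t; apply: contra_not; exact: PQ. Qed.

Lemma ae_leb_and (P Q : R -> Prop) : {ae lam, forall t, P t} ->
  {ae lam, forall t, Q t} -> {ae lam, forall t, P t /\ Q t}.
Proof.
move=> hP hQ; apply: negligibleS (negligibleU hP hQ) => t /= /not_andP[h|h].
  by left.
by right.
Qed.

Lemma ae_leb_all (P : nat -> R -> Prop) :
  (forall k, {ae lam, forall t, P k t}) -> {ae lam, forall t, forall k, P k t}.
Proof.
move=> hP; apply: negligibleS (negligible_bigcup hP) => t /= /existsNP[k nPk].
by exists k.
Qed.

Lemma ae_leb_fin (I : finType) (P : I -> R -> Prop) :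
  (forall i, {ae lam, forall t, P i t}) -> {ae lam, forall t, forall i, P i t}.
Proof.
move=> hP.
have := @ae_leb_all (fun k t => if insub k is Some j then P (enum_val (j : 'I_#|I|)) t else True).
case=> [k|N [mN N0 PN]].
  case: insubP => [j _ _|_]; first exact: hP.
  by exists set0; split => // t /=; apply.
exists N; split => // t /= /existsNP[i nPi]; apply: PN => /(_ (enum_rank i)).
by rewrite valK enum_rankK.
Qed.

Lemma ae_shift (c : R) (P : R -> Prop) :
  {ae lam, forall t, P t} -> {ae lam, forall t, P (c + t)}.
Proof. exact: negligible_shift. Qed.

(** The Borel part of a set is translated as a Borel set; the remainder is null, stays null under
    translation, and is then measurable by completeness. *)
Lemma measurable_shift_leb (c : R) :
  measurable_fun setT (fun t : lebR R => (c + t)%R : lebR R).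
Proof.
move=> _ A mA; rewrite setTI.
have [B [C [mB mC C0 BA AC]]] := leb_measurable_decomp mA.
have -> : (fun t => c + t) @^-1` A = (fun t => c + t) @^-1` B `|`
    (fun t => c + t) @^-1` (A `\` B).
  apply/seteqP; split => t /=; last by case=> [/BA//|[]].
  by have [|] := pselect (B (c + t)); [left|right].
apply: measurableU.
  apply: borel_measurable_leb; rewrite -[X in measurable X]setTI.
  exact: measurable_shift.
apply/negligible_leb_measurable/negligible_shift/borel_negligible_leb.
by exists C; split => // t [/AC[]].
Qed.

(** [FTC1] is applied to a Borel modification of [g], which has the same indefinite integral and the
    same value at almost every time. The bound [M] provides local integrability. *)
Lemma lebesgue_differentiation_leb (g : lebR R -> R) (M a : R) :
  measurable_fun setT g -> (forall t, `|g t| <= M) ->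
  {ae lam, forall t : R, a < t ->
    is_derive t (1 : R) (fun y : R => \int[lam]_(s in `[a, y]) g s) (g t)}.
Proof.
move=> mg gM.
have [g' mg' [gg' g'g]] := borel_modification mg.
have M0 : 0 <= M by exact: le_trans (normr_ge0 _) (gM 0).
have g'M t : `|g' t| <= M by case: (g'g t) => ->//; rewrite normr0.
have ci (K : set R) : measurable (K : set (measurableTypeR R)) ->
    (mu K < +oo)%E -> mu.-integrable K (EFin \o g').
  move=> mK Koo; apply: measurable_bounded_integrable => //.
    exact: measurable_funTS.
  by exists M; split; [rewrite num_real|move=> x /ltW xM t _; exact: le_trans xM].
have iyoo (x y : R) : (mu `[x, y] < +oo)%E.
  by rewrite lebesgue_measure_itv; case: ifP => // _; rewrite -EFinB ltry.
have li : locally_integrable setT g'.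
  split => //; first exact: openT.
  move=> K _ cK; have := ci K (compact_measurable cK) (compact_finite_measure cK).
  by move=> /integrableP[].
have := @FTC1 R g' (BLeft a) (fun y => ci _ (measurable_itv _) (iyoo _ _)) li.
move=> /borel_negligible_leb h.
have intE (y : R) : \int[lam]_(s in `[a, y]) g s = \int[mu]_(s in `[a, y]) g' s.
  have ig' := ci _ (measurable_itv `[a, y]) (iyoo _ _).
  rewrite /Rintegral.
  congr (fine _); rewrite -integral_leb //; last 2 first.
  - exact/measurable_EFinP.
  - exact: integrable_leb.
  have mD : measurable (`[a, y]%classic : set (lebR R)).
    by apply: borel_measurable_leb; exact: measurable_itv.
  apply: (@ae_eq_integral _ _ _ lam `[a, y]%classic (EFin \o g') (EFin \o g) mD).
  - exact/measurable_funTS/measurable_EFinP.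
  - apply: measurable_funTS; apply: (@measurable_fun_leb R _ _ setT).
      exact: measurableT.
    exact/measurable_EFinP.
  - by apply: filterS gg' => t gt _; rewrite /= gt.
have -> : (fun y : R => \int[lam]_(s in `[a, y]) g s) =
  (fun y : R => \int[mu]_(s in `[a, y]) g' s) by apply/funext.
apply: (filterS2 _ _ gg' h) => t gt ht ta.
have [dt dE] := ht ta.
by apply: DeriveDef => //; rewrite gt -dE derive1E.
Qed.

End lebesgue_tools.

(** * Dominated convergence for real-valued integrals *)

Section dominated.
Context d (T : measurableType d) (R : realType)
  (m : {measure set T -> \bar R}).

Lemma Rintegral_dominated_cvg (D : set T) (f_ : nat -> T -> R) (f g : T -> R) :
  measurable D -> (forall k, measurable_fun D (f_ k)) -> measurable_fun D f ->
  {ae m, forall t, D t -> f_ k t @[k --> \oo] --> f t} ->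
  m.-integrable D (EFin \o g) ->
  {ae m, forall t, forall k, D t -> `|f_ k t| <= g t} ->
  m.-integrable D (EFin \o f) /\
  \int[m]_(t in D) f_ k t @[k --> \oo] --> \int[m]_(t in D) f t.
Proof.
move=> mD mf_ mf ff ig fg.
have [|||//||i1 _ i3] := @dominated_convergence _ _ _ m _ mD
  (fun k => EFin \o f_ k) (EFin \o f) (EFin \o g).
- by move=> k; exact/measurable_EFinP.
- exact/measurable_EFinP.
- by apply: filterS ff => t ft Dt; apply: cvg_EFin; [exact: nearW|exact: ft].
- by apply: filterS fg => t ft k Dt; rewrite /= lee_fin; exact: ft.
split => //; apply: fine_cvg; rewrite fineK//.
exact: integrable_fin_num.
Qed.

(** Dominated convergence for the constant sequence [f]. *)
Lemma integrable_ae_le (D : set T) (f g : T -> R) :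
  measurable D -> measurable_fun D f -> m.-integrable D (EFin \o g) ->
  {ae m, forall t, D t -> `|f t| <= g t} -> m.-integrable D (EFin \o f).
Proof.
move=> mD mf ig fg.
have [] // := @Rintegral_dominated_cvg D (fun=> f) f g mD _ mf _ ig.
- by apply: filterE => t _; exact: cvg_cst.
- by apply: filterS fg => t ft _ /ft.
Qed.

End dominated.

(** * Absolutely continuous functions *)

Section absolute_continuity.
Variable R : realType.
Local Notation mu := (@lebesgue_measure R).
Local Notation lam := (@completed_lebesgue_measure R).

(** Intervals come as lists ordered from left to right, unlike the indexed families of
    [abs_continuous]: such lists concatenate, as the partition argument of [abs_cont_derive_bound]
    requires. *)
Definition abs_cont (a b : R) (x : R -> R) : Prop :=
  forall e : R, 0 < e -> exists2 delta : R, 0 < delta &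
    forall l : seq (R * R),
      (forall I, I \in l -> [/\ a <= I.1, I.1 <= I.2 & I.2 <= b]) ->
      pairwise (fun I J => I.2 <= J.1) l ->
      \sum_(I <- l) (I.2 - I.1) < delta ->
      \sum_(I <- l) `|x I.2 - x I.1| < e.

Lemma abs_cont_shift_coord n (a b c : R) (x : R -> 'cV[R]_n) (j : 'I_n) :
  abs_continuous (c + a) (c + b) x -> abs_cont a b (fun t => x (c + t) j 0).
Proof.
move=> xac e e0; have [delta d0 h] := xac e e0; exists delta => // l lab lp ls.
pose lo (i : 'I_(size l)) := c + (nth (0, 0) l i).1.
pose hi (i : 'I_(size l)) := c + (nth (0, 0) l i).2.
apply: le_lt_trans (h (size l) lo hi _ _ _).
- rewrite (big_nth (0, 0)) big_mkord; apply: ler_sum => i _.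
  rewrite /lo /hi /enorm.
  set y := x _ - x _.
  have -> : x (c + (nth (0, 0) l i).2) j 0 - x (c + (nth (0, 0) l i).1) j 0 = y j 0.
    by rewrite !mxE.
  rewrite -sqrtr_sqr ler_sqrt ?sumr_ge0 //; last by move=> k _; rewrite sqr_ge0.
  by rewrite (bigD1 j) //= lerDl sumr_ge0 // => k _; rewrite sqr_ge0.
- move=> i; have [] := lab (nth (0, 0) l i) (mem_nth _ (ltn_ord i)).
  by rewrite /lo /hi !lerD2l.
- have key (i j' : 'I_(size l)) : (i < j')%N ->
      `]lo i, hi i[%classic `&` `]lo j', hi j'[%classic = set0.
    move=> ij; rewrite -subset0 => t /= []; rewrite !in_itv/= => /andP[_ tl] /andP[tr _].
    have /(pairwiseP (0, 0)) /(_ i j' (ltn_ord i) (ltn_ord j') ij) := lp.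
    rewrite -(lerD2l c) => hl.
    by have := lt_trans tl (le_lt_trans hl tr); rewrite ltxx.
  apply/trivIsetP => i j' _ _ /eqP ij.
  have [/key//|ji|/val_inj //] := ltngtP i j'.
  by rewrite setIC key.
- rewrite (big_nth (0, 0)) big_mkord in ls.
  by apply: le_lt_trans ls; apply: ler_sum => i _; rewrite /lo /hi opprD addrACA subrr add0r.
Qed.

Lemma lipschitz_abs_cont (a b M : R) (x : R -> R) :
  (forall s t, a <= s -> s <= t -> t <= b -> `|x t - x s| <= M * (t - s)) ->
  abs_cont a b x.
Proof.
move=> xM e e0.
have M1 : 0 < `|M| + 1 by rewrite ltr_wpDl.
(* Adding 1 keeps the denominator positive when [M] is 0. *)
exists (e / (`|M| + 1)); first by rewrite divr_gt0.
move=> l lab _; rewrite ltr_pdivlMr // => ls.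
apply: le_lt_trans ls; rewrite mulr_suml big_seq [leRHS]big_seq; apply: ler_sum => I Il.
have [aI II Ib] := lab _ Il; apply: (le_trans (xM _ _ aI II Ib)).
rewrite mulrC; apply: ler_wpM2l; first by rewrite subr_ge0.
by rewrite (le_trans (ler_norm _))// lerDl.
Qed.

Lemma abs_contB (a b : R) (x y : R -> R) :
  abs_cont a b x -> abs_cont a b y -> abs_cont a b (fun t => x t - y t).
Proof.
move=> xac yac e e0; have e2 : 0 < e / 2 by rewrite divr_gt0.
have [d1 d10 h1] := xac _ e2; have [d2 d20 h2] := yac _ e2.
exists (Num.min d1 d2); first by rewrite lt_min d10.
move=> l lab lp; rewrite lt_min => /andP[l1 l2].
rewrite (splitr e); apply: le_lt_trans (ltrD (h1 l lab lp l1) (h2 l lab lp l2)).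
rewrite -big_split; apply: ler_sum => I _ /=.
by rewrite opprD addrACA -opprD; exact: ler_normB.
Qed.

(** Cousin's lemma as an induction principle on intervals. The supremum of the points reachable from
    [a] is reachable by the local hypothesis around it, and the same hypothesis reaches further
    unless this supremum is [b]. *)
Lemma cousin (Q : R -> R -> Prop) (a b : R) : a <= b ->
  (forall u v w, u <= v -> v <= w -> Q u v -> Q v w -> Q u w) ->
  (forall c, a <= c <= b -> exists2 r, 0 < r &
     forall u v, a <= u -> c - r < u -> u <= c -> c <= v -> v < c + r -> v <= b ->
       Q u v) ->
  Q a b.
Proof.
move=> ab Qt Ql.
pose S := [set c | a <= c <= b /\ Q a c].
have Sa : S a.
  split; first by rewrite lexx.
  have [r r0] := Ql a (introT andP (conj (lexx a) ab)).
  by apply => //; rewrite ?ltrBlDr ?ltrDl.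
have Sb c : S c -> c <= b by case=> /andP[].
have hS : has_sup S by split; [exists a|exists b => c /Sb].
pose s := sup S.
have as_ : a <= s by apply: ub_le_sup => //; case: hS.
have sb : s <= b by apply: ge_sup; [exists a|move=> c /Sb].
have [r r0 h] := Ql s (introT andP (conj as_ sb)).
have [c [/andP[ac cb] Qc] cs] := sup_adherent r0 hS.
have cs' : c <= s by apply: ub_le_sup; [case: hS|split => //; rewrite ac].
(* A point beyond [s], within the local radius and capped at [b]: it is reachable, so it cannot
   exceed [s], which forces [s = b]. *)
pose v := Num.min b (s + r / 2).
have sv : s <= v by rewrite le_min sb lerDl divr_ge0// ltW.
have vb : v <= b by rewrite ge_min lexx.
have r2 : r / 2 < r by rewrite ltr_pdivrMr// ltr_pMr// ltr1n.
have vr : v < s + r by rewrite gt_min ltrD2l r2 orbT.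
have Sv : S v.
  split; first by rewrite (le_trans as_)// sv.
  exact: Qt ac (le_trans cs' sv) Qc (h _ _ ac cs cs' sv vr vb).
have vs : v <= s by apply: ub_le_sup => //; case: hS.
move: vs; rewrite /v ge_min gerDl (leNgt _ 0) (divr_gt0 r0)//= orbF => bs.
suff -> : b = v by case: Sv.
by apply/eqP; rewrite eq_le (le_trans bs sv) vb.
Qed.

Lemma derive_local_bound (x : R -> R) (c d M e : R) :
  is_derive c (1 : R) x d -> `|d| <= M -> 0 < e ->
  exists2 r, 0 < r & forall s, `|s - c| < r -> `|x s - x c| <= (M + e) * `|s - c|.
Proof.
move=> [xd <-] dM e0; move: xd dM; rewrite /derivable /derive.
set D := lim _ => /cvgrPdist_lt /(_ e e0) [r /= r0 h] dM.
exists r => // s sr.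
have [->|sc] := eqVneq s c; first by rewrite !subrr normr0 mulr0.
have := h (s - c); rewrite /= sub0r normrN => /(_ sr).
rewrite subr_eq0 => /(_ sc); rewrite [_ *: 1]mulr1 subrK.
set q := _ *: _ => qe.
have -> : x s - x c = q * (s - c).
  by rewrite /q mulrC /GRing.scale/= mulrA mulfV ?mul1r// subr_eq0.
rewrite normrM ler_wpM2r//.
rewrite -[q](subKr D) (le_trans (ler_normB _ _))// lerD// ltW//.
Qed.

Lemma negligible_open_cover (E : set R) (e : R) : lam.-negligible E -> 0 < e ->
  exists2 G : set R, open G & E `<=` G /\ (mu G < e%:E)%E.
Proof.
move=> /leb_negligible_borel[B [mB B0 EB]] e0.
have Boo : (mu B < +oo)%E by rewrite B0 ltry.
have [G [oG BG Ge]] := lebesgue_regularity_outer mB Boo e0.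
exists G => //; split; first exact: subset_trans BG.
rewrite -(setDKU BG) measureU0//; first by apply: measurableD => //; exact: open_measurable.
Qed.

(* The open set [G] collects the times at which the derivative bound fails; the
   intervals of a Cousin partition tagged in [G] have small total length, so
   absolute continuity controls them. *)
Lemma abs_cont_derive_bound (a b M : R) (x : R -> R) : a <= b -> 0 <= M ->
  abs_cont a b x ->
  {ae lam, forall t : R, a <= t <= b ->
     exists2 d, is_derive t (1 : R) x d & `|d| <= M} ->
  `|x b - x a| <= M * (b - a).
Proof.
move=> ab M0 xac xM.
suff key (e : R) : 0 < e -> `|x b - x a| <= (M + e) * (b - a) + e.
  apply/ler_addgt0Pr => e e0.
  have b1 : 0 < b - a + 1 by rewrite ltr_wpDl// subr_ge0.
  (* [key] loses its parameter once per unit of length and once more, that is [b - a + 1] times; the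
     quotient makes the total loss exactly [e]. *)
  apply: (le_trans (key (e / (b - a + 1)) _)); first exact: divr_gt0.
  rewrite le_eqVlt; apply/orP; left; apply/eqP.
  by field; rewrite gt_eqF.
move=> e0; have [delta d0 hac] := xac e e0.
have [G oG [EG Gd]] := negligible_open_cover xM d0.
have mG : measurable (G : set (measurableTypeR R)) by exact: open_measurable.
(* The list [l] collects the intervals tagged in [G]; their total length is charged to the measure
   of [G] between [u] and [v]. The intervals of the charge are half-open so that adjacent ones are
   disjoint and their measures add up. *)
pose Q (u v : R) := exists l : seq (R * R), [/\ forall I, I \in l -> [/\ u <= I.1, I.1 <= I.2 & I.2 <= v],
  pairwise (fun I J => I.2 <= J.1) l,
  ((\sum_(I <- l) (I.2 - I.1))%:E <= mu (G `&` `]u, v]))%E &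
  `|x v - x u| <= (M + e) * (v - u) + \sum_(I <- l) `|x I.2 - x I.1|].
have [l [lab lp ls xab]] : Q a b.
  apply: cousin => //.
  - move=> u v w uv vw [l1 [l1ab l1p l1s l1x]] [l2 [l2ab l2p l2s l2x]].
    exists (l1 ++ l2); split.
    + move=> I; rewrite mem_cat => /orP[/l1ab|/l2ab] [h1 h2 h3]; split => //.
        exact: le_trans vw.
      exact: le_trans h1.
    + rewrite pairwise_cat l1p l2p !andbT; apply/allrelP => I J /l1ab[_ _ Iv] /l2ab[vJ _ _].
      exact: le_trans vJ.
    + rewrite big_cat /= EFinD.
      apply: (le_trans (leeD l1s l2s)).
      rewrite -measureU //=.
      * apply: le_measure; rewrite ?inE.
        - by apply: measurableU; apply: measurableI.
        - by apply: measurableI.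
        - move=> t [] [Gt] /=; rewrite in_itv/= => /andP[h1 h2]; split => //=; rewrite in_itv/=.
            by rewrite h1 (le_trans h2).
          by rewrite h2 (le_lt_trans uv).
      * by apply: measurableI.
      * by apply: measurableI.
      * rewrite -subset0 => t /= [] [_ +] [_]; rewrite !in_itv/= => /andP[_ tv] /andP[vt _].
        by have := lt_le_trans vt tv; rewrite ltxx.
    + rewrite big_cat /=; apply: (@le_trans _ _ (`|x w - x v| + `|x v - x u|)).
        by rewrite -[X in `|X|](subrKA (x v)) ler_normD.
      by apply: (le_trans (lerD l2x l1x)); lra.
  (* Near a point of [G] the whole interval is recorded in the list; elsewhere the derivative bounds
     the increment and the list is empty. *)
  - move=> c cab; have [Gc|Gc] := pselect (G c).
      have /nbhs_ballP[r /= r0 rG] := open_nbhs_nbhs (conj oG Gc).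
      exists r => // u v au cu uc cv vc vb; exists [:: (u, v)]; split => //=.
      + move=> I; rewrite inE => /eqP -> /=.
        by split => //; exact: le_trans cv.
      + rewrite big_seq1 /= (_ : G `&` _ = `]u, v]%classic).
          rewrite lebesgue_measure_itv/= lte_fin; case: ifPn => // uv.
          by rewrite lee_fin subr_le0 leNgt.
        apply/seteqP; split => [t []//|t] /=; rewrite in_itv/= => /andP[ut tv].
        split; last by rewrite ut.
        by apply: rG; rewrite /ball/= ltr_norml; lra.
      + rewrite big_seq1 /= lerDr mulr_ge0//; last by lra.
        by rewrite addr_ge0 // ltW.
    have [d xd dM] : exists2 d, is_derive c (1 : R) x d & `|d| <= M.
      by apply: contrapT => h; apply/Gc/EG => /(_ cab).
    have [r r0 xr] := derive_local_bound xd dM e0.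
    exists r => // u v au cu uc cv vc vb; exists [::]; split => //=.
      by rewrite big_nil.
    rewrite big_nil addr0.
    have h1 : `|x v - x c| <= (M + e) * (v - c).
      have := xr v; rewrite ger0_norm ?subr_ge0//; apply; lra.
    have h2 : `|x c - x u| <= (M + e) * (c - u).
      by have := xr u; rewrite distrC (distrC _ (x c)) ger0_norm ?subr_ge0//; apply; lra.
    rewrite -[X in `|X|](subrKA (x c)) (le_trans (ler_normD _ _))//; lra.
rewrite (le_trans xab)// lerD2l ltW//; apply: hac => //.
rewrite -lte_fin; apply: (le_lt_trans ls); apply: le_lt_trans Gd.
by apply: le_measure; rewrite ?inE//; apply: measurableI.
Qed.

End absolute_continuity.

(** * The fundamental theorem of calculus for absolutely continuous functions *)

Section fundamental_theorem.
Variable R : realType.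
Local Notation lam := (@completed_lebesgue_measure R).

Lemma leb_itv (i : interval R) : measurable ([set` i] : set (lebR R)).
Proof. by apply: borel_measurable_leb; exact: measurable_itv. Qed.

Lemma leb_measure_itv (i : interval R) : lam [set` i] =
  if (i.1 < i.2)%E then ((i.2 : \bar R) - i.1)%E else 0.
Proof. by rewrite -lebesgue_measure_itv. Qed.

Lemma leb_itv_lty (a b : R) (x y : bool) :
  (lam [set` Interval (BSide x a) (BSide y b)] < +oo)%E.
Proof. by rewrite leb_measure_itv /=; case: ifP => // _; rewrite -EFinB ltry. Qed.

Lemma leb_set1 (a : R) : lam [set a] = 0.
Proof. by rewrite -set_itv1 leb_measure_itv /= lte_fin ltxx. Qed.

Lemma ae_neq (a : R) : {ae lam, forall t : R, t != a}.
Proof.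
exists [set a]; split; first by rewrite -set_itv1; exact: leb_itv.
  exact: leb_set1.
by move=> t /= /negP; rewrite negbK => /eqP.
Qed.

(** Off the null set this is a pointwise limit of measurable functions; inside it completeness makes
    every preimage measurable. *)
Lemma measurable_ae_cvg (D : set R) (f_ : nat -> lebR R -> R) (f : lebR R -> R) :
  measurable (D : set (lebR R)) ->
  (forall k, measurable_fun (D : set (lebR R)) (f_ k)) ->
  {ae lam, forall t, D t -> f_ k t @[k --> \oo] --> f t} ->
  measurable_fun (D : set (lebR R)) f.
Proof.
move=> mD mf_ [N [mN N0 fN]].
have mDN : measurable (D `\` N : set (lebR R)) by exact: measurableD.
have mfN : measurable_fun (D `\` N : set (lebR R)) f.
  apply: (@measurable_fun_cvg _ _ _ (D `\` N : set (lebR R)) f_).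
    by move=> k; apply: measurable_funS (mf_ k) => // t [].
  move=> t [Dt Nt]; apply: contrapT => h; apply/Nt/fN => /(_ Dt); exact: h.
rewrite -(setUIDK D N) setUC; apply/measurable_funU => //.
  exact: measurableI.
split => //; move=> mDN' B mB; apply: negligible_leb_measurable.
by exists N; split => // t [[]].
Qed.

Lemma lipschitz_continuous (x : R -> R) (M : R) :
  (forall s t, s <= t -> `|x t - x s| <= M * (t - s)) -> continuous x.
Proof.
move=> xM t; apply/cvgrPdist_lt => e e0.
have M1 : 0 < `|M| + 1 by rewrite ltr_wpDl.
have key s : `|x t - x s| <= `|M| * `|t - s|.
  have [st|/ltW ts] := leP s t.
    rewrite (le_trans (xM _ _ st))// [`|t - s|]ger0_norm ?subr_ge0//.
    by rewrite ler_wpM2r ?subr_ge0// ler_norm.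
  rewrite distrC (distrC t) (le_trans (xM _ _ ts))// [`|s - t|]ger0_norm ?subr_ge0//.
  by rewrite ler_wpM2r ?subr_ge0// ler_norm.
apply/nbhs_ballP; exists (e / (`|M| + 1)); first by rewrite /= divr_gt0.
move=> s; rewrite /ball/= ltr_pdivlMr// mulrC => ts.
apply: (le_lt_trans (key s)); apply: le_lt_trans ts.
by rewrite ler_wpM2r// lerDl.
Qed.

Lemma Rintegral_itv_lipschitz (g : lebR R -> R) (M a s t : R) :
  measurable_fun setT g -> (forall u, `|g u| <= M) -> a <= s -> s <= t ->
  `|\int[lam]_(u in `[a, t]) g u - \int[lam]_(u in `[a, s]) g u| <= M * (t - s).
Proof.
move=> mg gM as_ st.
have ig (i : interval R) : (lam [set` i] < +oo)%E ->
    lam.-integrable ([set` i] : set (lebR R)) (EFin \o g).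
  move=> ioo; apply: measurable_bounded_integrable => //.
  - exact: leb_itv.
  - exact: measurable_funTS.
  - by exists M; split; [rewrite num_real|move=> x /ltW xM u _; exact: le_trans xM].
have -> : `[a, t]%classic = `[a, s]%classic `|` `]s, t]%classic.
  by rewrite -itv_bndbnd_setU//= bnd_simp.
rewrite Rintegral_setU /=; last 4 first.
- exact: leb_itv.
- exact: leb_itv.
- by rewrite -itv_bndbnd_setU//=; apply: ig; exact: leb_itv_lty.
- apply/disj_set2P; rewrite -subset0 => u /= []; rewrite !in_itv/= => /andP[_ us] /andP[su _].
  by have := lt_le_trans su us; rewrite ltxx.
rewrite addrC addKr.
have ist := ig `]s, t] (leb_itv_lty _ _ _ _).
apply: (le_trans (le_normr_Rintegral _ ist)); first exact: leb_itv.
have -> : M * (t - s) = \int[lam]_(u in `]s, t]) M.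
  rewrite Rintegral_cst; last exact: leb_itv.
  congr (_ * _); transitivity (fine (lam `]s, t]%classic)) => //.
  rewrite leb_measure_itv /= lte_fin; case: ifPn => [//|]; rewrite -leNgt => ts.
  have -> : s = t by apply/eqP; rewrite eq_le st.
  by rewrite subrr.
apply: le_Rintegral => //.
- exact: leb_itv.
- exact: integrable_norm ist.
- apply: measurable_bounded_integrable => //.
  + exact: leb_itv.
  + exact: leb_itv_lty.
  + by exists `|M|; split; [rewrite num_real|move=> x /ltW xM u _; exact: xM].
Qed.

(* [d] is measurable as an a.e. limit of difference quotients, and [x] minus the
   indefinite integral of [d] has zero derivative a.e. *)
Lemma abs_cont_FTC (a b M : R) (x d : R -> R) : a <= b -> 0 <= M ->
  abs_cont a b x ->
  {ae lam, forall t : R, a <= t <= b -> is_derive t (1 : R) x (d t) /\ `|d t| <= M} ->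
  measurable_fun (`[a, b]%classic : set (lebR R)) (d : lebR R -> R) /\
  x b - x a = \int[lam]_(t in `[a, b]) d t.
Proof.
move=> ab M0 xac xd.
(* Nothing is known about [x] outside the interval. Composing with the projection onto it gives a
   Lipschitz function on the whole line, whose difference quotients are Borel. *)
pose clamp t := Num.max a (Num.min b t).
have clab t : a <= clamp t <= b by rewrite /clamp le_max lexx ge_max ab ge_min lexx.
have cl s t : s <= t -> clamp s <= clamp t /\ clamp t - clamp s <= t - s.
  move=> st; split.
    rewrite /clamp ge_max le_max lexx /= le_max; apply/orP; right.
    by rewrite le_min ge_min lexx /= ge_min st orbT.
  rewrite lerBlDl /clamp ge_max; apply/andP; split.
    have /andP[h _] := clab s.
    by rewrite (le_trans h)// lerDl subr_ge0.
  apply: (@le_trans _ _ (Num.min b s + (t - s))); last first.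
    by rewrite lerD2r le_max lexx orbT.
  have [bs|sb] := leP b s; last by rewrite subrKC ge_min lexx orbT.
  by rewrite ge_min lerDl subr_ge0 st.
have clE t : a <= t <= b -> clamp t = t.
  by rewrite /clamp => /andP[h1 h2]; rewrite min_r// max_r.
have xlip s t : a <= s -> s <= t -> t <= b -> `|x t - x s| <= M * (t - s).
  move=> as_ st tb; apply: abs_cont_derive_bound => //.
    move=> e /xac[delta d0 h]; exists delta => // l lab; apply: h => I /lab[h1 h2 h3].
    by split => //; [exact: le_trans h1|exact: le_trans tb].
  apply: (ae_leb_sub xd) => u h /andP[su ut].
  by exists (d u); apply h; rewrite (le_trans as_ su) (le_trans ut tb).
pose xx t := x (clamp t).
have xxc : continuous xx.
  apply: (@lipschitz_continuous _ M) => s t /cl[c1 c2].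
  have /andP[cs _] := clab s; have /andP[_ ct] := clab t.
  by rewrite /xx (le_trans (xlip _ _ cs c1 ct))// ler_wpM2l.
pose q (k : nat) (t : R) := k.+1%:R * (xx (k.+1%:R^-1 + t) - xx t).
have qm k : measurable_fun (setT : set (lebR R)) (q k : lebR R -> R).
  apply: measurable_fun_leb => //.
  apply: measurable_funM => //; apply: measurable_funB.
    apply: (@measurableT_comp _ _ _ _ _ _ xx) => //; last exact: measurable_shift.
    exact: continuous_measurable_fun.
  exact: continuous_measurable_fun.
have mdab : measurable_fun (`[a, b]%classic : set (lebR R)) (d : lebR R -> R).
  apply: (@measurable_ae_cvg _ q); first exact: leb_itv.
    by move=> k; exact: measurable_funTS.
  (* The endpoint [b] is discarded because the quotients [q] look to the right, where [xx] and [x]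
     may differ. *)
  apply: (ae_leb_sub (ae_leb_and xd (ae_neq b))) => t [h tb]; rewrite /= in_itv/= => tab.
  have [[xt <-] _] := h tab; move: xt; rewrite /derivable /derive.
  set D := lim _ => /cvgrPdist_lt xt; apply/cvgrPdist_lt => e e0.
  have [r /= r0 hr] := xt e e0.
  have /andP[at_ tb'] := tab.
  have bt : 0 < b - t by rewrite subr_gt0 lt_neqAle tb.
  near=> k.
  have k0 : 0 < k.+1%:R^-1 :> R by rewrite invr_gt0.
  have kr : k.+1%:R^-1 < r by near: k; exact: near_infty_natSinv_lt (PosNum r0).
  have kb : k.+1%:R^-1 < b - t by near: k; exact: near_infty_natSinv_lt (PosNum bt).
  have := hr k.+1%:R^-1; rewrite /= sub0r normrN gtr0_norm// => /(_ kr).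
  rewrite gt_eqF// => /(_ isT).
  rewrite invrK [_ *: 1]mulr1 /q /xx !clE //.
  by rewrite (le_trans at_) ?lerDr ?(ltW k0)//= -lerBrDr ltW.
split => //.
(* The differentiation theorem wants a function measurable and bounded on the whole line, so [d] is
   cut off where its bound fails and extended by zero. *)
pose d' := (fun t => if `|d t| <= M then d t else 0) \_ `[a, b].
have md' : measurable_fun (setT : set (lebR R)) d'.
  apply/(measurable_restrictT _ (leb_itv _)).1.
  apply: (ae_measurable_leb _ mdab); first exact: leb_itv.
  by apply: (ae_leb_sub xd) => t h; rewrite /= in_itv/= => /h[_ ->].
have d'M t : `|d' t| <= M.
  rewrite /d' patchE; case: ifPn => _; last by rewrite normr0.
  by case: ifPn => //; rewrite normr0.
pose G y := \int[lam]_(s in `[a, y]) d' s.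
have dG := lebesgue_differentiation_leb a md' d'M.
have Ga : G a = 0.
  rewrite /G /Rintegral null_set_integral; first by [].
  - exact: leb_itv.
  - exact/measurable_funTS/measurable_EFinP.
  - by rewrite set_itv1; exact: leb_set1.
have yb : abs_cont a b (fun t => x t - G t).
  apply: abs_contB xac _; apply: (@lipschitz_abs_cont _ _ _ M) => s t as_ st tb.
  exact: Rintegral_itv_lipschitz.
have : `|(x b - G b) - (x a - G a)| <= 0 * (b - a).
  apply: (@abs_cont_derive_bound R a b 0 (fun t => x t - G t) ab (lexx 0) yb).
  (* The endpoint [a] is discarded because the derivative of [G] is known only strictly to the right
     of its base point. *)
  apply: (ae_leb_sub (ae_leb_and xd (ae_leb_and dG (ae_neq a)))) => t [h [dGt ta]] tab; exists 0; last by rewrite normr0.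
  have [xt dt] := h tab; have /andP[at_ tb] := tab.
  have Gt := dGt; rewrite lt_neqAle eq_sym ta at_ /= in Gt.
  have {}Gt := Gt erefl.
  have d't : d' t = d t by rewrite /d' patchE mem_set ?dt//= in_itv/= tab.
  rewrite d't in Gt.
  by have := is_deriveB xt Gt; rewrite subrr.
rewrite mul0r normr_le0 Ga subr0 addrAC subr_eq0 => /eqP ->.
rewrite /G /Rintegral; congr (fine _).
have mab : measurable (`[a, b]%classic : set (lebR R)) by exact: leb_itv.
apply: (@ae_eq_integral _ _ _ lam `[a, b]%classic (EFin \o d) (EFin \o d') mab).
- exact/measurable_funTS/measurable_EFinP.
- exact/measurable_EFinP.
- apply: (ae_leb_sub xd) => t h tab /=; rewrite /d' patchE mem_set//.
  by move: tab; rewrite /= in_itv/= => /h[_ ->].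
Unshelve. all: by end_near. Qed.

End fundamental_theorem.

(** * Ultrafilter limits and weak compactness *)

Section ultrafilter_limits.
Variable R : realType.

Lemma ultra_map (S T : Type) (f : S -> T) (U : set_system S) :
  UltraFilter U -> UltraFilter (f @ U).
Proof.
move=> UU; apply: Build_UltraFilter => G GG UG; apply/seteqP; split => // A GA.
rewrite /fmap/=; have [//|h] := in_ultra_setVsetC (f @^-1` A) UU.
exfalso; have /filter_not_empty := GG; apply.
by rewrite -(setICr A); apply: filterI => //; exact: UG.
Qed.

Lemma ultra_bounded_cvg (U : set_system nat) (a : nat -> R) (B : R) :
  UltraFilter U -> (forall k, `|a k| <= B) -> exists l : R, a @ U --> l.
Proof.
move=> UU aB; have := @segment_compact R (- B) B; rewrite compact_ultra.
move=> /(_ (a @ U)) []; first exact: ultra_map.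
  rewrite /fmap /=; apply: filterS filterT => k _ /=.
  by rewrite in_itv/= -ler_norml.
by move=> l [_ h]; exists l.
Qed.

(* A sequence extracted from a single ultrafilter limit converges along every
   index of a countable family at once, so no diagonal argument is needed. *)
Lemma ultra_extraction (U : set_system nat) (C : countType)
    (a : C -> nat -> R) (l : C -> R) :
  UltraFilter U -> \oo `<=` U -> (forall c, a c @ U --> l c) ->
  exists2 s : nat -> nat, {homo s : i j / (i < j)%N} &
    forall c, (a c \o s) @ \oo --> l c.
Proof.
move=> UU Uoo al.
(* The precision and the set of controlled coordinates grow together: each [c] is controlled from
   stage [pickle c] on. *)
pose good (n m : nat) := forall c : C, (pickle c <= n)%N -> `|l c - a c m| < n.+1%:R^-1.
have step (n N : nat) : exists m, (N < m)%N /\ good n m.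
  have Ugood : U (good n).
    have : forall j, U [set m | forall c : C, (pickle c < j)%N -> `|l c - a c m| < n.+1%:R^-1].
      elim=> [|j IHj]; first by apply: filterE => m c.
      have [[c cj]|nc] := pselect (exists c : C, pickle c = j); last first.
        apply: filterS IHj => m h c; rewrite ltnS leq_eqVlt => /orP[/eqP cj|/h//].
        by exfalso; apply: nc; exists c.
      have := al c => /cvgrPdist_lt /(_ n.+1%:R^-1); rewrite invr_gt0 => /(_ (ltr0Sn _ _)) h.
      apply: filterS2 IHj h => m h1 h2 c'; rewrite ltnS leq_eqVlt => /orP[/eqP|/h1//].
      by rewrite -cj => /(pcan_inj pickleK) ->.
    by move=> /(_ n.+1); apply: filterS => m h c cn; apply: h.
  (* Since [U] contains the tails, a good index can be found beyond any given one, which makes the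
     extraction strictly increasing. *)
  have UN : U [set m | (N < m)%N] by apply: Uoo; exists N.+1.
  have [m [h1 h2]] := @filter_ex _ _ ultra_proper _ (filterI UN Ugood).
  by exists m.
have [g hg] := choice (fun nN : nat * nat => step nN.1 nN.2).
pose s := fix s (n : nat) := if n is k.+1 then g (k.+1, s k) else g (0%N, 0%N).
have sS n : (s n < s n.+1)%N by have [] := hg (n.+1, s n).
have sg n : good n (s n) by case: n => [|n]; [have [_] := hg (0%N, 0%N)|have [_] := hg (n.+1, s n)].
exists s; first exact: homo_ltn ltn_trans sS.
move=> c; apply/cvgrPdist_lt => e e0; near=> n.
apply: (@lt_trans _ _ n.+1%:R^-1).
  by apply: (sg n); near: n; exists (pickle c).
by near: n; exact: near_infty_natSinv_lt (PosNum e0).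
Unshelve. all: by end_near. Qed.

End ultrafilter_limits.

(** * Weak limits of functions with values in the unit interval *)

Section weak_compactness.
Context d (T : measurableType d) (R : realType)
  (m : {sigma_finite_measure set T -> \bar R}).
Local Notation integrable phi := (m.-integrable setT (EFin \o phi)).
Implicit Types (phi w u : T -> R) (v : nat -> T -> R).

Lemma integrable_subr phi psi : integrable phi -> integrable psi ->
  integrable (fun t => phi t - psi t).
Proof.
move=> i1 i2; rewrite (_ : EFin \o _ = ((EFin \o phi) \- (EFin \o psi))%E)//.
exact: integrableB.
Qed.

Lemma integrable_addr phi psi : integrable phi -> integrable psi ->
  integrable (fun t => phi t + psi t).
Proof.
move=> i1 i2; rewrite (_ : EFin \o _ = ((EFin \o phi) \+ (EFin \o psi))%E)//.
exact: integrableD.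
Qed.

Lemma integrable_measurable phi : integrable phi -> measurable_fun setT phi.
Proof. by move=> iphi; exact/measurable_EFinP/(measurable_int _ iphi). Qed.

Lemma Rintegral_indicr phi (A : set T) :
  \int[m]_(t in A) phi t = \int[m]_t (phi t * \1_A t).
Proof.
rewrite Rintegral_mkcond; apply: eq_Rintegral => t _; rewrite patchE indicE.
by case: (_ \in _); rewrite ?mulr1 ?mulr0.
Qed.

Lemma ae_eq_Rintegral phi psi : measurable_fun setT phi -> measurable_fun setT psi ->
  {ae m, forall t, phi t = psi t} -> \int[m]_t phi t = \int[m]_t psi t.
Proof.
move=> m1 m2 h; rewrite /Rintegral; congr (fine _); apply: ae_eq_integral => //.
- exact/measurable_EFinP.
- exact/measurable_EFinP.
- by apply: filterS h => t ht _; rewrite /= ht.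
Qed.

Definition unit_valued u := measurable_fun setT u /\ forall t, 0 <= u t <= 1.

Lemma integrableM_unit phi u : integrable phi -> unit_valued u ->
  integrable (fun t => phi t * u t).
Proof.
move=> iphi [mu u01]; apply: integrable_ae_le => //.
- apply: measurable_funM => //; exact/measurable_EFinP/(measurable_int _ iphi).
- exact: (integrable_norm iphi).
- apply: filterE => t _; rewrite normrM ler_piMr//.
  by have /andP[u0 u1] := u01 t; rewrite ger0_norm.
Qed.

Lemma RintegralM_unit_le phi u : integrable phi -> unit_valued u ->
  `|\int[m]_t (phi t * u t)| <= \int[m]_t `|phi t|.
Proof.
move=> iphi uu; have iu := integrableM_unit iphi uu.
apply: (le_trans (le_normr_Rintegral _ iu)) => //.
apply: le_Rintegral => //.
- exact: integrable_norm iu.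
- exact: integrable_norm iphi.
- move=> t _; rewrite normrM ler_piMr//.
  by case: uu => _ /(_ t) /andP[u0 u1]; rewrite ger0_norm.
Qed.

(** Tested on the set where [phi] is negative: there the integral of its absolute value is minus
    that of [phi], hence zero, so the set is null. *)
Lemma ae_ge0_of_integral phi : integrable phi ->
  (forall A, measurable A -> 0 <= \int[m]_(t in A) phi t) ->
  {ae m, forall t, 0 <= phi t}.
Proof.
move=> iphi phi0.
have mphi : measurable_fun setT phi by exact/measurable_EFinP/(measurable_int _ iphi).
pose A := [set t | phi t < 0].
have mA : measurable A.
  rewrite (_ : A = setT `&` phi @^-1` `]-oo, 0[); first exact: mphi.
  by rewrite setTI; apply/seteqP; split => t; rewrite /A /= in_itv.
have iA : m.-integrable A (EFin \o phi) by exact: integrableS iphi.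
have z : (\int[m]_(t in A) `|(EFin \o phi) t| = 0)%E.
  apply/eqP; rewrite eq_le integral_ge0 ?andbT; last by [].
  have -> : (\int[m]_(t in A) `|(EFin \o phi) t| = - \int[m]_(t in A) (EFin \o phi) t)%E.
    rewrite -integralN; last exact: integrable_add_def iA.
    apply: eq_integral => t /set_mem; rewrite /A/= => t0.
    by rewrite ltr0_norm.
  have := phi0 A mA; rewrite /Rintegral.
  by rewrite oppe_le0 -lee_fin fineK//; exact: integrable_fin_num iA.
have mA' : measurable_fun A (EFin \o phi) by exact/measurable_EFinP/measurable_funTS.
have /(ae_eq_integral_abs _ mA mA') := z.
apply: filterS => t h; rewrite leNgt; apply/negP => t0.
by have := h t0; move=> [] t00; move: t0; rewrite t00 ltxx.
Qed.

Section density.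
(** The weight turns the indicator of any measurable set, even one of infinite measure, into an
    integrable test function. *)
Variable w : T -> R.
Hypotheses (mwV : measurable_fun setT (fun t => (w t)^-1))
  (w0 : forall t, 0 < w t) (iw : integrable w).

Lemma integrable_weight_indic (A : set T) : measurable A ->
  integrable (fun t => w t * \1_A t).
Proof.
move=> mA; apply: integrableM_unit iw _; split; first exact: measurable_indic.
by move=> t; rewrite indicE; case: (_ \in _); rewrite ?lexx ?ler01.
Qed.

Lemma unit_valued_of_integral u : measurable_fun setT u ->
  integrable (fun t => w t * u t) ->
  (forall A, measurable A ->
     0 <= \int[m]_(t in A) (w t * u t) <= \int[m]_(t in A) w t) ->
  {ae m, forall t, 0 <= u t <= 1}.
Proof.
move=> mu iwu h.
have h0 : {ae m, forall t, 0 <= w t * u t}.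
  by apply: ae_ge0_of_integral => // A /h/andP[].
have h1 : {ae m, forall t, 0 <= w t - w t * u t}.
  apply: ae_ge0_of_integral => //; first exact: integrable_subr.
  move=> A mA; rewrite RintegralB//.
  - by rewrite subr_ge0; have /andP[] := h A mA.
  - exact: integrableS iw.
  - exact: integrableS iwu.
apply: filterS2 h0 h1 => t; rewrite pmulr_rge0// => -> /=.
by rewrite subr_ge0 ger_pMr.
Qed.

(* The ultrafilter limits of the integrals define a charge dominated by [m];
   [u] is its Radon-Nikodym density divided by [w]. *)
Lemma weak_density (U : set_system nat) v : UltraFilter U ->
  (forall k, unit_valued (v k)) ->
  exists2 u, unit_valued u & forall A, measurable A ->
    \int[m]_t (w t * \1_A t * v k t) @[k --> U] --> \int[m]_t (w t * \1_A t * u t).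
Proof.
move=> UU vu.
(* [choice] then yields a functional [L] on all functions, meaningful on the integrable ones; the
   value 0 elsewhere is a default. *)
have Lex phi : exists l : R, integrable phi -> \int[m]_t (phi t * v k t) @[k --> U] --> l.
  have [iphi|niphi] := pselect (integrable phi); last by exists 0.
  have [l hl] := @ultra_bounded_cvg R U (fun k => \int[m]_t (phi t * v k t))
    (\int[m]_t `|phi t|) UU (fun k => RintegralM_unit_le iphi (vu k)).
  by exists l.
have [L hL] := choice Lex.
have UP : ProperFilter U by exact: ultra_proper.
have LB phi psi : integrable phi -> integrable psi ->
    L (fun t => phi t - psi t) = L phi - L psi.
  move=> iphi ipsi; have iB : integrable (fun t => phi t - psi t) by exact: integrable_subr.
  apply: (cvg_unique _ (hL _ iB)) => //.
  have E : (fun k => \int[m]_t ((phi t - psi t) * v k t)) =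
      (fun k => \int[m]_t (phi t * v k t) - \int[m]_t (psi t * v k t)).
    apply/funext => k; rewrite -RintegralB//; [|exact: integrableM_unit..].
    by apply: eq_Rintegral => t _; rewrite mulrBl.
  by rewrite /= E; exact: cvgB (hL _ iphi) (hL _ ipsi).
have Lle phi : integrable phi -> `|L phi| <= \int[m]_t `|phi t|.
  move=> iphi.
  have := hL _ iphi => /cvg_norm h.
  apply: (ler_cvg_to h (cvg_cst _)).
  by apply: nearW => k; exact: RintegralM_unit_le.
have LD phi psi : integrable phi -> integrable psi ->
    L (fun t => phi t + psi t) = L phi + L psi.
  move=> iphi ipsi; have iD := integrable_addr iphi ipsi.
  apply: (cvg_unique _ (hL _ iD)) => //.
  have E : (fun k => \int[m]_t ((phi t + psi t) * v k t)) =
      (fun k => \int[m]_t (phi t * v k t) + \int[m]_t (psi t * v k t)).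
    apply/funext => k; rewrite -RintegralD//; [|exact: integrableM_unit..].
    by apply: eq_Rintegral => t _; rewrite mulrDl.
  by rewrite /= E; exact: cvgD (hL _ iphi) (hL _ ipsi).
have Lge0 phi : integrable phi -> (forall t, 0 <= phi t) -> 0 <= L phi.
  move=> iphi phi0; apply: (ler_cvg_to (cvg_cst _) (hL _ iphi)).
  apply: nearW => k; apply: Rintegral_ge0 => t _; apply: mulr_ge0 => //.
  by have [_ /(_ t)/andP[]] := vu k.
have Rint0 : \int[m]_t (cst 0 t : R) = 0 by rewrite /Rintegral integral0.
have Lz phi : integrable phi -> {ae m, forall t, phi t = 0} -> L phi = 0.
  move=> iphi h; apply/eqP; rewrite -normr_le0 (le_trans (Lle _ iphi))//.
  rewrite (@ae_eq_Rintegral _ (cst 0)).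
  - by rewrite Rint0.
  - by apply: measurableT_comp => //; exact: integrable_measurable.
  - exact: measurable_cst.
  - by apply: filterS h => t ->; rewrite normr0.
pose nu (A : set T) : \bar R := (L (fun t => w t * \1_A t))%:E.
have nu0 : nu set0 = 0.
  rewrite /nu Lz//; first exact: integrable_weight_indic.
  by apply: filterE => t; rewrite indic0 mulr0.
have nufin A : measurable A -> nu A \is a fin_num by [].
(* The weighted partial sums [Phi n] of indicators tend to [PhiU] in the L1 norm, by dominated
   convergence under [w], and [Lle] makes [L] continuous for this norm. *)
have nusigma : semi_sigma_additive nu.
  move=> F mF tF mUF.
  pose Phi n t := w t * \sum_(0 <= i < n) \1_(F i) t.
  have PhiE n : integrable (Phi n) /\ (\sum_(0 <= i < n) nu (F i) = (L (Phi n))%:E)%E.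
    elim: n => [|n [iPhi IH]].
      have -> : Phi 0%N = (fun t => w t * \1_set0 t).
        by apply/funext => t; rewrite /Phi big_geq// indic0 mulr0.
      by split; [exact: integrable_weight_indic|rewrite big_geq// -nu0].
    have -> : Phi n.+1 = (fun t => Phi n t + w t * \1_(F n) t).
      by apply/funext => t; rewrite /Phi big_nat_recr//= mulrDr.
    split; first by apply: integrable_addr => //; exact: integrable_weight_indic.
    by rewrite big_nat_recr//= IH -EFinD LD//; exact: integrable_weight_indic.
  (* By disjointness the partial sums at [t] jump once from 0 to 1, just after the index of the set
     containing [t], or stay 0. *)
  have sumE t : (exists j : nat, \1_(\bigcup_i F i) t = 1 :> R /\
        forall n, \sum_(0 <= i < n) \1_(F i) t = (j < n)%N%:R :> R) \/
      (\1_(\bigcup_i F i) t = 0 :> R /\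
        forall n, \sum_(0 <= i < n) \1_(F i) t = 0 :> R).
    have [[j _ Fj]|nF] := pselect ((\bigcup_i F i) t); [left; exists j|right]; split.
    - by rewrite indicE mem_set//; exists j.
    - have FE i : \1_(F i) t = (i == j)%:R :> R.
        rewrite indicE; have [->|ij] := eqVneq i j; first by rewrite mem_set.
        rewrite memNset// => Fi; move/eqP: ij; apply; apply: tF => //.
        by exists t.
      elim=> [|n IHn]; first by rewrite big_geq.
      rewrite big_nat_recr//= IHn FE ltnS.
      by case: (ltngtP n j) => _ //=; rewrite ?addr0 ?add0r.
    - by rewrite indicE memNset.
    - move=> n; rewrite big1// => i _; rewrite indicE memNset// => Fi.
      by apply: nF; exists i.
  under eq_fun do rewrite (PhiE _).2.
  apply: cvg_EFin; first exact: nearW.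
  pose PhiU t := w t * \1_(\bigcup_i F i) t.
  have iU : integrable PhiU by exact: integrable_weight_indic.
  have PhiU1 n t : `|PhiU t - Phi n t| <= w t.
    rewrite /PhiU /Phi -mulrBr normrM (ger0_norm (ltW (w0 t))) ger_pMr//.
    have [[j [-> ->]]|[-> ->]] := sumE t; last by rewrite subrr normr0.
    by case: ltnP; rewrite ?subrr ?subr0 ?normr0 ?normr1.
  have h : \int[m]_t `|PhiU t - Phi n t| @[n --> \oo] --> \int[m]_t (cst 0 t : R).
    have [] // := @Rintegral_dominated_cvg _ T R m setT
      (fun n t => `|PhiU t - Phi n t|) (cst 0) w measurableT _ (measurable_cst _) _ iw _.
    - move=> n; apply: measurableT_comp => //.
      by apply: integrable_measurable; apply: integrable_subr => //; have [] := PhiE n.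
    - apply: filterE => t _; apply: cvg_near_cst.
      have [[j [u1 un]]|[u1 un]] := sumE t; last first.
        by apply: nearW => n; rewrite /PhiU /Phi u1 un subrr normr0.
      exists j.+1 => // n /= jn.
      by rewrite /PhiU /Phi u1 un jn subrr normr0.
    - by apply: filterE => t n _; rewrite normr_id.
  apply/cvgrPdist_lt => e e0; rewrite Rint0 in h.
  move/cvgrPdist_lt : h => /(_ e e0); apply: filterS => n.
  rewrite sub0r normrN => hn; apply: (le_lt_trans _ hn); rewrite [leRHS]ger0_norm; last first.
    by apply: Rintegral_ge0 => t _.
  rewrite -LB//; last by have [] := PhiE n.
  by apply: Lle; apply: integrable_subr => //; have [] := PhiE n.
pose nuC := isCharge.Build _ _ _ nu nu0 nufin nusigma.
pose nu' : {charge set T -> \bar R} := HB.pack nu nuC.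
have nuac : nu' `<< m.
  move=> A mA B mB BA.
  rewrite /= /nu Lz//; first exact: integrable_weight_indic.
  exists B; split => //; first exact: mA.
  move=> t /= h; apply: contrapT => Bt; apply: h.
  by rewrite indicE memNset// mulr0.
pose g t := fine (Radon_Nikodym nu' m t).
have gE t : Radon_Nikodym nu' m t = (g t)%:E.
  by rewrite /g fineK//; exact: Radon_Nikodym_fin_num.
have ig : integrable g.
  rewrite (_ : EFin \o g = Radon_Nikodym nu' m); last by apply/funext => t; rewrite /= gE.
  exact: Radon_Nikodym_integrable.
have gA A : measurable A -> \int[m]_(t in A) g t = L (fun t => w t * \1_A t).
  move=> mA; rewrite /Rintegral -[RHS]/(fine (nu' A)) (Radon_Nikodym_integral nuac mA).
  by congr fine; apply: eq_integral => t _; rewrite gE.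
pose u0 t := g t * (w t)^-1.
have mu0 : measurable_fun setT u0.
  by apply: measurable_funM => //; exact: integrable_measurable.
have wu0 : (fun t => w t * u0 t) = g.
  by apply/funext => t; rewrite /u0 mulrCA mulfV ?mulr1// gt_eqF.
have u01 : {ae m, forall t, 0 <= u0 t <= 1}.
  apply: unit_valued_of_integral => //; first by rewrite wu0.
  move=> A mA; rewrite wu0 gA// Rintegral_indicr.
  have iwA := integrable_weight_indic mA.
  have wA0 t : 0 <= w t * \1_A t by rewrite mulr_ge0// ltW.
  rewrite Lge0//= (le_trans (ler_norm _))// (le_trans (Lle _ iwA))//.
  rewrite le_eqVlt; apply/orP; left; apply/eqP; apply: eq_Rintegral => t _.
  by rewrite ger0_norm.
(* The bounds on [u0] hold almost everywhere while [unit_valued] asks for them everywhere;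
   truncation changes [u0] on a null set. *)
pose u t := Num.max 0 (Num.min (u0 t) 1).
have uu : unit_valued u.
  split; last by move=> t; rewrite /u le_max lexx /= ge_max ler01 ge_min lexx orbT.
  apply: measurable_maxr; first exact: measurable_cst.
  by apply: measurable_minr => //; exact: measurable_cst.
exists u => // A mA.
have iwA := integrable_weight_indic mA.
suff -> : \int[m]_t (w t * \1_A t * u t) = L (fun t => w t * \1_A t) by exact: hL.
rewrite -gA// [RHS]Rintegral_indicr; apply: ae_eq_Rintegral.
- by apply: integrable_measurable; exact: integrableM_unit.
- apply: measurable_funM; first exact: integrable_measurable.
  exact: measurable_indic.
- apply: filterS u01 => t /andP[h1 h2]; rewrite -wu0 mulrAC; congr (_ * _ * _).
  by rewrite /u min_l// max_r.
Qed.

End density.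

End weak_compactness.

(** * Weak convergence against integrable functions *)

Import HBNNSimple.

Section weak_convergence.
Context d (T : measurableType d) (R : realType)
  (m : {sigma_finite_measure set T -> \bar R}).
Local Notation integrable phi := (m.-integrable setT (EFin \o phi)).
Variables (v : nat -> T -> R) (u : T -> R).
Hypotheses (vu : forall k, unit_valued (v k)) (uu : unit_valued u).

(** Integrability is bundled with convergence so that the closure properties of the class of test
    functions chain without side conditions. *)
Definition weak_test (phi : T -> R) := integrable phi /\
  \int[m]_t (phi t * v k t) @[k --> \oo] --> \int[m]_t (phi t * u t).

Lemma weak_testB phi psi : weak_test phi -> weak_test psi ->
  weak_test (fun t => phi t - psi t).
Proof.
move=> [i1 h1] [i2 h2]; split; first exact: integrable_subr.
have E f : unit_valued f -> \int[m]_t ((phi t - psi t) * f t) =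
    \int[m]_t (phi t * f t) - \int[m]_t (psi t * f t).
  move=> uf; rewrite -RintegralB//; [|exact: integrableM_unit..].
  by apply: eq_Rintegral => t _; rewrite mulrBl.
by rewrite E//; under eq_fun do rewrite E//; exact: cvgB.
Qed.

Lemma weak_testD phi psi : weak_test phi -> weak_test psi ->
  weak_test (fun t => phi t + psi t).
Proof.
move=> [i1 h1] [i2 h2]; split; first exact: integrable_addr.
have E f : unit_valued f -> \int[m]_t ((phi t + psi t) * f t) =
    \int[m]_t (phi t * f t) + \int[m]_t (psi t * f t).
  move=> uf; rewrite -RintegralD//; [|exact: integrableM_unit..].
  by apply: eq_Rintegral => t _; rewrite mulrDl.
by rewrite E//; under eq_fun do rewrite E//; exact: cvgD.
Qed.

Lemma weak_testZ phi (c : R) : weak_test phi -> weak_test (fun t => c * phi t).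
Proof.
move=> [i1 h1]; split.
  rewrite (_ : EFin \o _ = (fun t => c%:E * (EFin \o phi) t)%E)//.
  exact: integrableZl.
have E f : unit_valued f -> \int[m]_t (c * phi t * f t) = c * \int[m]_t (phi t * f t).
  move=> uf; rewrite -RintegralZl//; last exact: integrableM_unit.
  by apply: eq_Rintegral => t _; rewrite mulrA.
rewrite E//; under eq_fun do rewrite E//.
by apply: cvgM => //; exact: cvg_cst.
Qed.

Lemma weak_test_ae (phi psi : T -> R) : measurable_fun setT psi ->
  {ae m, forall t, phi t = psi t} -> weak_test phi -> weak_test psi.
Proof.
move=> mpsi h [i1 h1].
have i2 : integrable psi.
  apply: integrable_ae_le mpsi (integrable_norm i1) _ => //.
  by apply: filterS h => t /= -> _.
split => //.
have E f : unit_valued f -> \int[m]_t (psi t * f t) = \int[m]_t (phi t * f t).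
  move=> uf; apply: ae_eq_Rintegral.
  - exact: integrable_measurable (integrableM_unit i2 uf).
  - exact: integrable_measurable (integrableM_unit i1 uf).
  - by apply: filterS h => t ->.
by rewrite E//; under eq_fun do rewrite E//.
Qed.

(** Pairing with a function valued in the unit interval is bounded by the L1 norm, uniformly in [k],
    so one fixed [n] serves in an [e / 3] argument. *)
Lemma weak_test_closed (phi_ : nat -> T -> R) phi : integrable phi ->
  (forall n, weak_test (phi_ n)) ->
  \int[m]_t `|phi_ n t - phi t| @[n --> \oo] --> (0 : R) -> weak_test phi.
Proof.
move=> iphi hphi h; split=> //.
apply/cvgrPdist_lt => e e0.
have e3 : 0 < e / 3 by rewrite divr_gt0.
move/cvgrPdist_lt : h => /(_ (e / 3) e3)[n _ /(_ n (leqnn n))].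
rewrite sub0r normrN => h.
have [in_ hn] := hphi n.
have D f : unit_valued f ->
    `|\int[m]_t (phi_ n t * f t) - \int[m]_t (phi t * f t)| < e / 3.
  move=> uf; rewrite -RintegralB//; [|exact: integrableM_unit..].
  have -> : \int[m]_t (phi_ n t * f t - phi t * f t) =
      \int[m]_t ((phi_ n t - phi t) * f t).
    by apply: eq_Rintegral => t _; rewrite mulrBl.
  apply: (le_lt_trans (RintegralM_unit_le _ uf)); first exact: integrable_subr.
  exact: le_lt_trans (ler_norm _) h.
move/cvgrPdist_lt : hn => /(_ (e / 3) e3); apply: filterS => k hk.
have := D _ (vu k); have := D _ uu; move: hk.
set a := \int[m]_t _; set b := \int[m]_t _; set c := \int[m]_t _; set c' := \int[m]_t _.
rewrite !ltr_norml => /andP[? ?] /andP[? ?] /andP[? ?]; apply/andP; split; lra.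
Qed.

Lemma weak_test_dominated (phi_ : nat -> T -> R) (phi psi : T -> R) :
  integrable psi -> measurable_fun setT phi ->
  (forall n, weak_test (phi_ n)) ->
  (forall n t, `|phi_ n t| <= psi t) ->
  (forall t, phi_ n t @[n --> \oo] --> phi t) -> weak_test phi.
Proof.
move=> ipsi mphi hphi dom cvg.
have iphi : integrable phi.
  have [] // := @Rintegral_dominated_cvg _ T R m setT phi_ phi psi.
  - by move=> n; exact: integrable_measurable (hphi n).1.
  - by apply: filterE => t _; exact: cvg.
  - by apply: filterE => t n _; exact: dom.
apply: (weak_test_closed iphi hphi).
have Rint0 : \int[m]_t (cst 0 t : R) = 0 by rewrite /Rintegral integral0.
rewrite -Rint0.
have mP n : measurable_fun setT (fun t => `|phi_ n t - phi t|).
  apply: measurableT_comp => //; apply: measurable_funB => //.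
  exact: integrable_measurable (hphi n).1.
have [] // := @Rintegral_dominated_cvg _ T R m setT
    (fun n t => `|phi_ n t - phi t|) (cst 0) (fun t => psi t + `|phi t|).
- apply: filterE => t _; have /cvgrPdist_lt h := cvg t; apply/cvgrPdist_lt => e /h.
  by apply: filterS => n; rewrite sub0r normrN normr_id distrC.
- apply: integrable_addr ipsi _; exact: (integrable_norm iphi).
- apply: filterE => t n _; rewrite normr_id (le_trans (ler_normB _ _))//.
  by rewrite lerD2r.
Qed.

Section simple.
Variable w : T -> R.
Hypotheses (mwV : measurable_fun setT (fun t => (w t)^-1)) (w0 : forall t, 0 < w t).

(** A nonnegative [phi] equals [w] times [phi / w]. Simple functions increasing to the quotient,
    multiplied by [w], are linear combinations of the given tests and are dominated by [phi]. The
    general case splits into positive and negative parts. *)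
Lemma weak_test_integrable :
  (forall A, measurable A -> weak_test (fun t => w t * \1_A t)) ->
  forall phi, integrable phi -> weak_test phi.
Proof.
move=> hA.
have pos phi : integrable phi -> (forall t, 0 <= phi t) -> weak_test phi.
  move=> iphi phi0.
  have mphi := integrable_measurable iphi.
  pose q t := phi t * (w t)^-1.
  have q0 t : 0 <= q t by rewrite mulr_ge0// invr_ge0 ltW.
  have mq : measurable_fun setT q by exact: measurable_funM.
  have mqE : measurable_fun setT (EFin \o q) by exact/measurable_EFinP.
  have wq t : w t * q t = phi t by rewrite /q mulrCA mulfV ?mulr1// gt_eqF.
  pose s := nnsfun_approx measurableT mqE.
  have sq t : s n t @[n --> \oo] --> q t.
    have := @cvg_nnsfun_approx _ T R _ measurableT _ mqE (fun t _ => q0 t) t I.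
    by move=> /fine_cvg.
  have sle n t : s n t <= q t.
    apply: (ler_cvg_to (cvg_cst _) (sq t)); exists n => // k /= nk.
    by have /lefP := nd_nnsfun_approx measurableT mqE nk; exact.
  apply: (@weak_test_dominated (fun n t => w t * s n t) phi phi) => //.
  - move=> n.
    have -> : (fun t => w t * s n t) = (fun t => \sum_(y <- finmap.enum_fset (fset_set (range (s n))))
        y * (w t * \1_(s n @^-1` [set y]) t)).
      apply/funext => t; rewrite fimfunE fsbig_finite//= mulr_sumr.
      by apply: eq_bigr => y _; rewrite mulrCA.
    elim: (finmap.enum_fset _) => [|y l IHl].
      rewrite (_ : (fun t => _) = (fun t => w t * \1_set0 t)); first exact: hA.
      by apply/funext => t; rewrite big_nil indic0 mulr0.
    rewrite (_ : (fun t => _) = (fun t => y * (w t * \1_(s n @^-1` [set y]) t) +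
        \sum_(z <- l) z * (w t * \1_(s n @^-1` [set z]) t))); last first.
      by apply/funext => t; rewrite big_cons.
    by apply: weak_testD => //; apply: weak_testZ; exact: hA.
  - move=> n t; rewrite ger0_norm ?mulr_ge0 ?(ltW (w0 t))//.
    by rewrite -wq ler_wpM2l// ltW.
  - by move=> t; rewrite -wq; apply: cvgM (sq t); exact: cvg_cst.
move=> phi iphi.
have mphi := integrable_measurable iphi.
have -> : phi = (fun t => Num.max (phi t) 0 - Num.max (- phi t) 0).
  apply/funext => t; have [h|h] := leP (phi t) 0.
    by rewrite max_l ?oppr_ge0// opprK add0r.
  by rewrite max_r ?oppr_le0 ?(ltW h)// subr0.
have imax (f : T -> R) : measurable_fun setT f -> (forall t, `|f t| <= `|phi t|) ->
    integrable (fun t => Num.max (f t) 0).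
  move=> mf fle; apply: integrable_ae_le (integrable_norm iphi) _ => //.
    by apply: measurable_maxr => //; exact: measurable_cst.
  apply: filterE => t _; apply: le_trans (fle t); rewrite ger0_norm ?le_max ?lexx ?orbT//.
  by rewrite ge_max ler_norm normr_ge0.
apply: weak_testB; apply: pos.
- exact: imax.
- by move=> t; rewrite le_max lexx orbT.
- apply: imax; first exact: measurableT_comp.
  by move=> t; rewrite normrN.
- by move=> t; rewrite le_max lexx orbT.
Qed.

End simple.
End weak_convergence.

(** * Reduction of weak convergence on the line to countably many tests *)

Section weak_convergence_lebesgue.
Variable R : realType.
Local Notation lam := (@completed_lebesgue_measure R).

(** The standard Gaussian density has all three properties. *)
Lemma integrable_weight_exists : exists w : R -> R, [/\ continuous w,
  forall t, 0 < w t & lam.-integrable [set: lebR R] (EFin \o w)].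
Proof.
exists (normal_pdf 0 1); split.
- exact: continuous_normal_pdf (oner_neq0 _).
- move=> t; rewrite normal_pdfE ?oner_neq0//.
  by rewrite mulr_gt0 ?normal_peak_gt0 ?oner_neq0// expR_gt0.
- by apply: integrable_leb => //; exact: integrable_normal_pdf.
Qed.

(** One extraction controls countably many tests, hence rational endpoints: an open ray is the union
    of the closed rays at rationals below its endpoint. *)
Lemma borel_smallest_rat (G : set (set R)) : sigma_algebra setT G ->
  (forall q : rat, G `]-oo, ratr q]%classic) ->
  forall A : set R, measurable (A : set (measurableTypeR R)) -> G A.
Proof.
move=> sG Gq A mA; have : (@ocitv R).-sigma.-measurable A by exact: mA.
rewrite RGenInftyO.measurableE; apply: smallest_sub => // _ [x ->].
have -> : `]-oo, x[%classic = \bigcup_n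
    (oapp (fun q : rat => if ratr q < x then `]-oo, ratr q]%classic else set0) set0 (unpickle n)).
  apply/seteqP; split => t /=; rewrite in_itv/=.
    move=> tx; have [q] := rat_in_itvoo tx; rewrite in_itv/= => /andP[tq qx].
    exists (pickle q); first exact: I.
    by rewrite pickleK /= qx /= in_itv/= ltW.
  case=> n _; case: unpickle => //= q; case: ifPn => //= qx.
  by rewrite in_itv/= => /le_lt_trans; apply.
case: sG => G0 _; apply => n; case: unpickle => //= q.
by case: ifP.
Qed.

Variable w : R -> R.
Hypotheses (wc : continuous w) (w0 : forall t, 0 < w t)
  (iw : lam.-integrable [set: lebR R] (EFin \o w)).

Lemma weight_measurable : measurable_fun setT (w : lebR R -> R).
Proof. by apply: measurable_fun_leb => //; exact: continuous_measurable_fun. Qed.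

Lemma weight_inv_measurable : measurable_fun setT ((fun t => (w t)^-1) : lebR R -> R).
Proof.
apply: measurable_fun_leb => //; apply: continuous_measurable_fun => t.
by apply: cvgV; [rewrite gt_eqF|exact: wc].
Qed.

(** Dynkin's argument. The sets whose weighted indicator is a test form a lambda-system, where
    increasing unions are handled by domination by [w], and the rational rays are stable under
    intersection. This covers Borel sets; completed ones differ by null sets. The whole line is a
    test of its own because a lambda-system must contain it. *)
Lemma weak_test_leb (v : nat -> lebR R -> R) (u : lebR R -> R) :
  (forall k, unit_valued (v k)) -> unit_valued u ->
  weak_test lam v u (fun t => w t * \1_(setT : set (lebR R)) t) ->
  (forall q : rat, weak_test lam v u
     (fun t => w t * \1_(`]-oo, ratr q]%classic : set (lebR R)) t)) ->
  forall phi : lebR R -> R, lam.-integrable [set: lebR R] (EFin \o phi) ->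
    weak_test lam v u phi.
Proof.
move=> vu uu hT hq.
apply: (@weak_test_integrable _ (lebR R) R lam v u vu uu w weight_inv_measurable w0).
pose G : set (set R) := [set A | measurable (A : set (lebR R)) /\
  weak_test lam v u (fun t => w t * \1_(A : set (lebR R)) t)].
have lG : lambda_system setT G.
  split.
  - by [].
  - by split; [exact: measurableT|].
  - move=> A B BA [mA gA] [mB gB]; split; first exact: measurableD.
    rewrite (_ : (fun t => _) = (fun t => w t * \1_(A : set (lebR R)) t -
      w t * \1_(B : set (lebR R)) t)).
      exact: weak_testB.
    apply/funext => t; rewrite -mulrBr; congr (_ * _); rewrite !indicE.
    have [Bt|Bt] := pselect (B t).
      by rewrite memNset ?(mem_set Bt) ?(mem_set (BA _ Bt)) ?subrr// => -[].
    rewrite (memNset Bt) subr0; have [At|At] := pselect (A t).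
      by rewrite !mem_set.
    by rewrite !memNset// => -[].
  - move=> F ndF hF.
    have mUF : measurable (\bigcup_i F i : set (lebR R)).
      by apply: bigcupT_measurable => i; have [] := hF i.
    split => //.
    apply: (@weak_test_dominated _ _ _ lam v u vu uu
      (fun n t => w t * \1_(F n : set (lebR R)) t) _ w iw).
    + by apply: measurable_funM; [exact: weight_measurable|exact: measurable_indic].
    + by move=> n; have [] := hF n.
    + move=> n t; rewrite normrM gtr0_norm// ger_pMr// indicE.
      by case: (_ \in _); rewrite ?normr1 ?normr0.
    + move=> t; apply: cvgM; first exact: cvg_cst.
      rewrite !indicE; have [[j _ Fj]|nF] := pselect ((\bigcup_i F i) t).
        apply: cvg_near_cst; exists j => // n /= jn.
        rewrite indicE !mem_set//; first by exists j.
        by have /subsetPset := ndF _ _ jn; exact.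
      apply: cvg_near_cst; apply: nearW => n.
      by rewrite indicE !memNset// => Fn; apply: nF; exists n.
have Gborel (A : set R) : measurable (A : set (measurableTypeR R)) -> G A.
  pose H : set (set R) := [set A | exists q : rat, A = `]-oo, ratr q]%classic].
  have HG : <<s H >> `<=` G.
    apply: (@lambda_system_subset _ H _ setT G lG) => //.
    - move=> _ _ [p ->] [q ->]; have [pq|qp] := leP (ratr p : R) (ratr q).
        exists p; apply/setIidl => t /=; rewrite !in_itv/= => /le_trans; exact.
      exists q; apply/setIidr => t /=; rewrite !in_itv/= => /le_trans; apply; exact: ltW.
    - by move=> _ [q ->]; split; [exact: leb_itv|exact: hq].
  move=> mA; apply: HG; apply: borel_smallest_rat mA; first exact: smallest_sigma_algebra.
  by move=> q; apply: sub_gen_smallest; exists q.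
move=> A mA; have [B [C [mB mC C0 BA ABC]]] := leb_measurable_decomp mA.
have [mB' gB] := Gborel B mB.
apply: (weak_test_ae vu uu _ _ gB).
  by apply: measurable_funM; [exact: weight_measurable|exact: measurable_indic].
apply: negligibleS (borel_negligible_leb (A := C) _); last by exists C; split.
move=> t /= h; apply: contrapT => Ct; apply: h; congr (_ * _); rewrite !indicE.
have [Bt|Bt] := pselect (B t); first by rewrite !mem_set//; exact: BA.
by rewrite !memNset// => /ABC[].
Qed.

End weak_convergence_lebesgue.

(** * Measurability by right sampling *)

Section right_sampling.
Variable R : realType.
Local Notation lam := (@completed_lebesgue_measure R).

Lemma measurable_fun_countable_index d d' (T : measurableType d) (Y : measurableType d')
    (C : countType) (idx : T -> C) (F : C -> T -> Y) :
  (forall c, measurable (idx @^-1` [set c])) ->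
  (forall c, measurable_fun setT (F c)) ->
  measurable_fun setT (fun t => F (idx t) t).
Proof.
move=> midx mF _ B mB; rewrite setTI.
have -> : (fun t => F (idx t) t) @^-1` B = \bigcup_n
    (oapp (fun c => idx @^-1` [set c] `&` F c @^-1` B) set0 (unpickle n)).
  apply/seteqP; split => t /=.
    by move=> FB; exists (pickle (idx t)); [exact: I|rewrite pickleK].
  by case=> n _; case: unpickle => //= c [/= ->].
apply: bigcupT_measurable => n; case: unpickle => //= c.
by apply: measurableI => //; rewrite -[X in measurable X]setTI; exact: mF.
Qed.

Let idx (n : nat) (t : R) : int := Num.floor (t * n.+1%:R).
(** The [+ 1] puts the sample strictly to the right of [t] even when [t] is a grid point, as
    convergence to [t^'+] demands. *)
Let sample (n : nat) (z : int) : R := (z + 1)%:~R * n.+1%:R^-1.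

Let sample_gt n t : t < sample n (idx n t).
Proof.
by rewrite /sample -ltr_pdivrMr ?invr_gt0 ?ltr0n// invrK /idx -Num.Theory.floor_lt_int ltzD1.
Qed.

Let sample_le n t : sample n (idx n t) <= t + n.+1%:R^-1.
Proof.
have n0 : (0 : R) < n.+1%:R by rewrite ltr0n.
rewrite /sample ler_pdivrMr// mulrDl mulVf ?gt_eqF// intrD lerD2r.
exact: ge_floor.
Qed.

Let sample_cvg t : sample n (idx n t) @[n --> \oo] --> t^'+.
Proof.
move=> A [e /= e0 eA].
suff : \forall n \near \oo, A (sample n (idx n t)) by [].
near=> n; apply: eA; last exact: sample_gt.
rewrite /ball_ /=.
rewrite ltr0_norm ?subr_lt0 ?sample_gt// opprB ltrBlDl.
apply: (le_lt_trans (sample_le n t)); rewrite ltrD2l.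
by near: n; exact: near_infty_natSinv_lt (PosNum e0).
Unshelve. all: by end_near. Qed.

(* [s] is sampled at grid points lying just to the right of [t]. *)
Lemma measurable_right_limit (f : R -> lebR R -> R) (g : lebR R -> R) :
  (forall s, measurable_fun setT (f s)) ->
  {ae lam, forall t : R, f s t @[s --> t^'+] --> g t} ->
  measurable_fun setT g.
Proof.
move=> mf fg.
apply: (@measurable_ae_cvg R setT (fun n t => f (sample n (idx n t)) t) g).
- exact: measurableT.
- move=> n; apply: (@measurable_fun_countable_index _ _ (lebR R) (measurableTypeR R) int (idx n) (fun z => f (sample n z))).
    move=> z; have -> : idx n @^-1` [set z] = `[z%:~R / n.+1%:R, (z + 1)%:~R / n.+1%:R[%classic.
      have n0 : (0 : R) < n.+1%:R by rewrite ltr0n.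
      apply/seteqP; split => t /=; rewrite in_itv/= /idx ler_pdivrMr// ltr_pdivlMr//.
        by move=> <-; rewrite floor_le floorD1_gt.
      by move=> h; apply: floor_def.
    exact: leb_itv.
  by move=> z; exact: mf.
- apply: (ae_leb_sub fg) => t h _.
  exact: (cvg_comp (fun n => sample n (idx n t)) (fun s => f s t) (@sample_cvg t) h).
Qed.

(** Right-continuity makes the indicator at [t] the limit of its values at sampled times [s], which
    are constants as functions of [t]. *)
Lemma switching_signal_measurable N (sigma : R -> 'I_N) (i : 'I_N) :
  switching_signal sigma ->
  measurable_fun setT ((fun t => (sigma t == i)%:R) : lebR R -> R).
Proof.
move=> [sr _]; apply: (@measurable_right_limit (fun s _ => (sigma s == i)%:R)).
  by move=> s; exact: measurable_cst.
exists set0; split => // t /= []; apply: cvg_near_cst.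
by apply: filterS (sr t) => s ->.
Qed.

End right_sampling.

(** * Comparison of the Euclidean and the maximum norm *)

Section euclidean_norm.
Variable R : realType.

Lemma normr_le_enorm n (v : 'cV[R]_n) : `|v| <= enorm v.
Proof.
rewrite /Num.Def.normr/= mx_normrE; apply: bigmax_le; first by rewrite sqrtr_ge0.
move=> [i j] _ /=; rewrite ord1 /enorm -sqrtr_sqr ler_sqrt ?sumr_ge0//; last first.
  by move=> k _; rewrite sqr_ge0.
by rewrite (bigD1 i)//= lerDl sumr_ge0// => k _; rewrite sqr_ge0.
Qed.

Lemma coord_le_normr n (v : 'cV[R]_n) (j : 'I_n) : `|v j 0| <= `|v|.
Proof.
by rewrite [leRHS]/Num.Def.normr/= mx_normrE; apply: (le_bigmax _ _ (j, 0)).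
Qed.

Lemma coord_le_enorm n (v : 'cV[R]_n) (j : 'I_n) : `|v j 0| <= enorm v.
Proof. exact: le_trans (coord_le_normr v j) (normr_le_enorm v). Qed.

Lemma enorm_continuous n : continuous (@enorm R n).
Proof.
have h : continuous (fun v : 'cV[R]_n => \sum_(i < n) v i 0 ^+ 2).
  apply: continuous_big => [|i _ v]; first exact: add_continuous.
  apply: (@continuous_comp _ _ _ (fun x : 'cV[R]_n => x i 0) (fun y : R => y ^+ 2)).
    exact: coord_continuous.
  exact: exprn_continuous.
by move=> v; apply: (continuous_comp (h v)); exact: sqrt_continuous.
Qed.

Lemma enorm_ge0 n (v : 'cV[R]_n) : 0 <= enorm v.
Proof. exact: sqrtr_ge0. Qed.

Lemma enorm0 n : enorm (0 : 'cV[R]_n) = 0.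
Proof. by rewrite /enorm big1 ?sqrtr0// => i _; rewrite mxE expr0n. Qed.

Lemma cvg_coord (I : Type) (F : set_system I) n (x_ : I -> 'cV[R]_n) (x : 'cV[R]_n) :
  Filter F -> (forall j, x_ k j 0 @[k --> F] --> x j 0) -> x_ @ F --> x.
Proof.
move=> FF h; apply/cvgrPdist_lt => e e0.
have : \forall k \near F, forall j, `|x j 0 - x_ k j 0| < e.
  by apply: filter_forall => j; move/cvgrPdist_lt : (h j) => /(_ e e0).
apply: filterS => k hk; rewrite /Num.Def.normr/= mx_normrE.
by apply: bigmax_lt => // -[i j] _ /=; rewrite ord1 !mxE.
Qed.

End euclidean_norm.

(** * Limiting functions *)

Section limiting_functions.
Variable R : realType.
Local Notation lam := (@completed_lebesgue_measure R).

Lemma modulus_small (w : R -> R) (e : R) : modulus w -> 0 < e ->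
  exists2 d : R, 0 < d & forall r, 0 <= r -> r < d -> w r < e.
Proof.
move=> [w0 wc winc] e0.
have /continuous_within_itvcyP[_ w0r] := wc.
have := w0r; rewrite w0 => /cvgrPdist_lt /(_ e e0) [d /= d0 hd].
exists d => // r; rewrite le_eqVlt => /orP[/eqP <- _|r0 rd]; first by rewrite w0.
have := hd r; rewrite /= sub0r normrN gtr0_norm// => /(_ rd r0).
by rewrite sub0r normrN; exact/le_lt_trans/ler_norm.
Qed.

Lemma near_nonneg (gamma : nat -> R) (t : R) : gamma @ \oo --> +oo ->
  \forall k \near \oo, 0 <= gamma k + t.
Proof.
by move=> /cvgryPge/(_ (- t)); apply: filterS => k; rewrite -lerBlDr sub0r.
Qed.

Section regular_time.
Context (n m : nat).
Variables (g glim : R -> 'cV[R]_n -> 'cV[R]_m) (gamma : nat -> R)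
  (K : set 'cV[R]_n) (M : R) (w : R -> R).
Hypothesis gammaoo : gamma @ \oo --> +oo.
Hypothesis wm : modulus w.

(** The conditions at [t] are imposed for all [k] at once: the bad times then form a countable union
    of null sets, and the rest of the argument at [t] is pointwise. Negative times are excluded
    because [g] is controlled from time 0 on. *)
Definition regular_time (t : R) : Prop :=
  [/\ forall k xi, 0 <= gamma k + t -> K xi -> enorm (g (gamma k + t) xi) <= M,
      forall k xi zeta, 0 <= gamma k + t -> K xi -> K zeta ->
        enorm (g (gamma k + t) xi - g (gamma k + t) zeta) <= w (enorm (xi - zeta)) &
      forall xi, K xi -> g (gamma k + t) xi @[k --> \oo] --> glim t xi].

Lemma regular_time_bound t xi : regular_time t -> K xi -> enorm (glim t xi) <= M.
Proof.
move=> [gM _ gl] Kxi.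
have h := cvg_comp _ _ (gl xi Kxi) (@enorm_continuous R m (glim t xi)).
apply: (ler_cvg_to h (cvg_cst _)).
by have := near_nonneg t gammaoo; apply: filterS => k k0; exact: gM.
Qed.

(** The modulus [w] is the same at all sampled times, so replacing [x_ k] by [x] costs a vanishing
    amount, after which the limit at a fixed state applies. *)
Lemma regular_time_cvg t (x_ : nat -> 'cV[R]_n) (x : 'cV[R]_n) : regular_time t ->
  (\forall k \near \oo, K (x_ k)) -> K x -> x_ @ \oo --> x ->
  g (gamma k + t) (x_ k) @[k --> \oo] --> glim t x.
Proof.
move=> [_ gw gl] Kx_ Kx xcvg; apply/cvgrPdist_lt => e e0.
have e2 : 0 < e / 2 by rewrite divr_gt0.
have [d d0 hd] := modulus_small wm e2.
have h0 : enorm (x_ k - x) @[k --> \oo] --> (0 : R).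
  rewrite -(enorm0 R n) -[X in enorm X](subrr x).
  have h : (x_ k - x) @[k --> \oo] --> x - x by apply: cvgB => //; exact: cvg_cst.
  exact: cvg_comp _ _ h (@enorm_continuous R n (x - x)).
move/cvgrPdist_lt : h0 => /(_ d d0) h0.
have /cvgrPdist_lt /(_ (e / 2) e2) h1 := gl x Kx.
near=> k.
have k0 : 0 <= gamma k + t by near: k; exact: near_nonneg.
have Kk : K (x_ k) by near: k.
have hk0 : `|0 - enorm (x_ k - x)| < d by near: k.
have hk1 : `|glim t x - g (gamma k + t) x| < e / 2 by near: k.
rewrite -(subrKA (g (gamma k + t) x)) (splitr e) (le_lt_trans (ler_normD _ _))// ltrD//.
rewrite distrC; apply: le_lt_trans (normr_le_enorm _) _.
apply: le_lt_trans (gw k _ _ k0 Kk Kx) _; apply: hd; first exact: enorm_ge0.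
by move: hk0; rewrite sub0r normrN ger0_norm// enorm_ge0.
Unshelve. all: by end_near. Qed.

(** The modulus [w] survives the limit in [k], so [glim t] is uniformly continuous on [K]. *)
Lemma regular_time_continuous t (x : 'cV[R]_n) (z : R -> 'cV[R]_n) (s0 : R) :
  regular_time t -> (forall s, K (z s)) -> {for s0, continuous z} ->
  glim t (z s) @[s --> s0] --> glim t (z s0).
Proof.
move=> [_ gw gl] Kz zc.
have lw xi zeta : K xi -> K zeta -> enorm (glim t xi - glim t zeta) <= w (enorm (xi - zeta)).
  move=> Kxi Kzeta.
  have h : (g (gamma k + t) xi - g (gamma k + t) zeta) @[k --> \oo] --> glim t xi - glim t zeta.
    by apply: cvgB; exact: gl.
  have h' := cvg_comp _ _ h (@enorm_continuous R m (glim t xi - glim t zeta)).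
  apply: (ler_cvg_to h' (cvg_cst _)).
  by have := near_nonneg t gammaoo; apply: filterS => k k0; exact: gw.
apply/cvgrPdist_lt => e e0; have [d d0 hd] := modulus_small wm e0.
have h0 : enorm (z s0 - z s) @[s --> s0] --> (0 : R).
  rewrite -(enorm0 R n) -[X in enorm X](subrr (z s0)).
  have h : (z s0 - z s) @[s --> s0] --> z s0 - z s0 by apply: cvgB => //; exact: cvg_cst.
  exact: cvg_comp _ _ h (@enorm_continuous R n (z s0 - z s0)).
move/cvgrPdist_lt : h0 => /(_ d d0); apply: filterS => s hs.
apply: le_lt_trans (normr_le_enorm _) _; apply: le_lt_trans (lw _ _ (Kz _) (Kz _)) _.
by apply: hd; [exact: enorm_ge0|move: hs; rewrite sub0r normrN ger0_norm// enorm_ge0].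
Qed.

End regular_time.

Lemma ae_sampled_times (J' : set R) (gamma : nat -> R) : lam.-negligible (@nneg R `\` J') ->
  {ae lam, forall t : R, forall k, 0 <= gamma k + t -> J' (gamma k + t)}.
Proof.
move=> nJ; apply: ae_leb_all => k; apply: (@ae_shift R (gamma k) (fun t => 0 <= t -> J' t)).
apply: negligibleS nJ => t /= h; split.
  by rewrite /nneg /= in_itv/= andbT; apply: contrapT => t0; apply: h => /t0.
by move=> Jt; apply: h.
Qed.

Lemma regular_time_ae n m (X K : set 'cV[R]_n) (g glim : R -> 'cV[R]_n -> 'cV[R]_m)
    (gamma : nat -> R) :
  uniformly_bounded (@nneg R) X g -> continuous_in_state_uniformly (@nneg R) X g ->
  limiting_function X g gamma glim -> compact K -> K `<=` X ->
  exists M w, modulus w /\ {ae lam, forall t : R, regular_time g glim gamma K M w t}.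
Proof.
move=> [J1 [_ nJ1 b1]] [J2 [_ nJ2 b2]] [E nE hE] cK KX.
have [M hM] := b1 K cK KX; have [w wm hw] := b2 K cK KX.
exists M, w; split => //.
have nE' : {ae lam, forall t : R, ~ E t} by apply: negligibleS nE => t /= /contrapT.
apply: (ae_leb_sub (ae_leb_and (ae_sampled_times gamma nJ1)
  (ae_leb_and (ae_sampled_times gamma nJ2) nE'))) => t [h1 [h2 Et]]; split.
- by move=> k xi /h1 J1t; exact: hM.
- by move=> k xi zeta /h2 J2t; exact: hw.
- by move=> xi /KX; exact: hE.
Qed.

Lemma limiting_function_measurable n m (X : set 'cV[R]_n)
    (g glim : R -> 'cV[R]_n -> 'cV[R]_m) (gamma : nat -> R) xi (j : 'I_m) :
  gamma @ \oo --> +oo ->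
  measurable_in_time (@nneg R) X g -> limiting_function X g gamma glim -> X xi ->
  measurable_fun setT ((fun t => glim t xi j 0) : lebR R -> R).
Proof.
move=> gammaoo mg [E nE hE] Xxi.
(* For small [k] the time [gamma k + t] may be negative, where [g] need not be measurable; the
   extension by zero is, and the two agree for large [k]. *)
pose g0 := (fun t : lebR R => g t xi j 0) \_ (@nneg R).
have mg0 : measurable_fun (setT : set (lebR R)) g0.
  apply/(measurable_restrictT _ _).1; last exact: mg.
  exact: leb_itv.
apply: (@measurable_ae_cvg R setT (fun k t => g0 (gamma k + t))).
- exact: measurableT.
- move=> k; exact: measurableT_comp mg0 (measurable_shift_leb (gamma k)).
- apply: negligibleS nE => t /= /not_implyP[_]; apply: contra_notP => Et.
  have h := hE t xi Et Xxi.
  have h' := cvg_comp _ _ h (@coord_continuous R m 1 j 0 (glim t xi)).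
  apply: cvg_trans h'; apply: near_eq_cvg.
  have := near_nonneg t gammaoo; apply: filterS => k k0.
  by rewrite /g0 patchE mem_set//= /nneg /= in_itv/= k0.
Qed.

(** With the state frozen at [z s] the function is measurable in [t]; continuity in the state makes
    the diagonal value the limit as [s] decreases to [t], which is the setting of
    [measurable_right_limit]. *)
Lemma limiting_function_comp_measurable n m (X K : set 'cV[R]_n)
    (g glim : R -> 'cV[R]_n -> 'cV[R]_m) (gamma : nat -> R) (M : R) (w : R -> R)
    (z : R -> 'cV[R]_n) (phi : 'cV[R]_m -> R) :
  gamma @ \oo --> +oo -> modulus w -> K `<=` X -> {ae lam, forall t : R, regular_time g glim gamma K M w t} ->
  (forall s, K (z s)) -> continuous z -> continuous phi ->
  (forall xi, X xi -> measurable_fun setT ((fun t => phi (glim t xi)) : lebR R -> R)) ->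
  measurable_fun setT ((fun t => phi (glim t (z t))) : lebR R -> R).
Proof.
move=> gammaoo wm KX reg Kz zc phic mphi.
apply: (@measurable_right_limit R (fun s t => phi (glim t (z s)))).
  by move=> s; apply: mphi; exact: KX.
apply: (ae_leb_sub reg) => t rt.
apply: cvg_at_right_filter.
have h := @regular_time_continuous n m g glim gamma K M w gammaoo wm t (z t) z t rt Kz (zc t).
exact: (cvg_comp _ _ h (phic _)).
Qed.

End limiting_functions.

(** * Subsequences, zeroing pairs and solutions *)

Section derivatives.
Variable R : realType.

Lemma is_derive_shift_coord n (x : R -> 'cV[R]_n) (s t : R) (v : 'cV[R]_n) (j : 'I_n) :
  is_derive (s + t) (1 : R) x v -> is_derive t (1 : R) (fun r => x (s + r) j 0) (v j 0).
Proof.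
move=> [dx <-].
have E (h : R) : x (s + (h *: (1 : R) + t)) = x (h *: (1 : R) + (s + t)).
  by rewrite addrCA.
have h : h^-1 *: ((fun r => x (s + r) j 0) (h *: (1 : R) + t) - x (s + t) j 0)
    @[h --> 0^'] --> ('D_1 x (s + t)) j 0.
  have := cvg_comp _ _ dx (@coord_continuous R n 1 j 0 ('D_1 x (s + t))).
  apply: cvg_trans; apply: near_eq_cvg; apply: nearW => h /=.
  by rewrite E !mxE.
apply: DeriveDef; first by apply/cvg_ex; exists (('D_1 x (s + t)) j 0).
exact: (cvg_lim (@Rhausdorff R) h).
Qed.

Lemma is_derive_of_coord n (x : R -> 'cV[R]_n) (t : R) (v : 'cV[R]_n) :
  (forall j, is_derive t (1 : R) (fun r => x r j 0) (v j 0)) ->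
  is_derive t (1 : R) x v.
Proof.
move=> h; have dx : derivable x t 1.
  by apply/derivable_mxP => i j; rewrite ord1; have [] := h i.
apply: DeriveDef => //; rewrite derive_mx//; apply/matrixP => i j; rewrite mxE ord1.
by have [_ ->] := h i.
Qed.

End derivatives.

Section extraction.
Variable R : realType.

Lemma increasing_geq (s : nat -> nat) : {homo s : i j / (i < j)%N} -> forall k, (k <= s k)%N.
Proof. by move=> hs; elim=> // k IH; exact: leq_ltn_trans IH (hs _ _ (ltnSn k)). Qed.

Lemma increasing_cvg (s : nat -> nat) : {homo s : i j / (i < j)%N} -> s @ \oo --> \oo.
Proof.
move=> hs A [N _ NA]; exists N => // k /= Nk; apply: NA => /=.
exact: leq_trans Nk (increasing_geq hs k).
Qed.

(** Properties inherited by subsequences are secured one index at a time; [Q] is the invariant that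
    keeps further extraction possible. *)
Lemma finite_extraction (A : Type) (I : eqType) (Q : (nat -> A) -> Prop)
    (P : I -> (nat -> A) -> Prop) :
  (forall t (s : nat -> nat), {homo s : i j / (i < j)%N} -> Q t -> Q (t \o s)) ->
  (forall i t (s : nat -> nat), {homo s : i j / (i < j)%N} -> P i t -> P i (t \o s)) ->
  (forall i t, Q t -> exists2 s : nat -> nat, {homo s : i j / (i < j)%N} & P i (t \o s)) ->
  forall (l : seq I) t, Q t -> exists2 s : nat -> nat, {homo s : i j / (i < j)%N} &
    forall i, i \in l -> P i (t \o s).
Proof.
move=> Qs Ps QP; elim=> [|i l IHl] t Qt; first by exists id.
have [s1 hs1 h1] := QP i t Qt.
have [s2 hs2 h2] := IHl (t \o s1) (Qs _ _ hs1 Qt).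
exists (s1 \o s2); first by move=> a b /hs2/hs1.
move=> i'; rewrite inE => /orP[/eqP ->|/h2//].
exact: Ps hs2 h1.
Qed.

Lemma limiting_function_sub n m (X : set 'cV[R]_n) (g glim : R -> 'cV[R]_n -> 'cV[R]_m)
    (gamma : nat -> R) (s : nat -> nat) : {homo s : i j / (i < j)%N} ->
  limiting_function X g gamma glim -> limiting_function X g (gamma \o s) glim.
Proof.
move=> hs [E nE hE]; exists E => // t xi Et Xxi.
exact: cvg_comp _ _ (increasing_cvg hs) (hE t xi Et Xxi).
Qed.

Lemma admissible_sub n m (X : set 'cV[R]_n) (g : R -> 'cV[R]_n -> 'cV[R]_m)
    (gamma : nat -> R) (s : nat -> nat) : {homo s : i j / (i < j)%N} ->
  admissible X g gamma -> admissible X g (gamma \o s).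
Proof.
move=> hs [g0 goo [glim gl]]; split; first by move=> k; exact: g0.
  exact: cvg_comp _ _ (increasing_cvg hs) goo.
by exists glim; exact: limiting_function_sub.
Qed.

Lemma common_admissible_extraction n N p (X : set 'cV[R]_n)
    (fhat : R -> 'cV[R]_n -> 'I_N -> 'cV[R]_n) (h : R -> 'cV[R]_n -> 'I_N -> 'cV[R]_p)
    (t_ : nat -> R) :
  (forall i, precompact_in_time X (fun t xi => fhat t xi i)) ->
  (forall i, precompact_in_time X (fun t xi => h t xi i)) ->
  (forall k, 0 <= t_ k) -> t_ @ \oo --> +oo ->
  exists2 s : nat -> nat, {homo s : i j / (i < j)%N} &
    common_admissible X fhat h (t_ \o s).
Proof.
move=> pf ph t0 too.
pose Q (t : nat -> R) := (forall k, 0 <= t k) /\ t @ \oo --> +oo.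
have Qs t (s : nat -> nat) : {homo s : i j / (i < j)%N} -> Q t -> Q (t \o s).
  move=> hs [h0 hoo]; split; first by move=> k; exact: h0.
  exact: cvg_comp _ _ (increasing_cvg hs) hoo.
have [|||s hs hP] := @finite_extraction R 'I_N Q (fun i gamma =>
    admissible X (fun t xi => fhat t xi i) gamma /\
    admissible X (fun t xi => h t xi i) gamma) Qs _ _ (enum 'I_N) t_.
- by move=> i t s hs [a1 a2]; split; exact: admissible_sub.
- move=> i t Qt; have [s1 hs1 a1] := pf i t Qt.1 Qt.2.
  have Q1 := Qs _ _ hs1 Qt.
  have [s2 hs2 a2] := ph i (t \o s1) Q1.1 Q1.2.
  exists (s1 \o s2); first by move=> a b /hs2/hs1.
  by split; [exact: admissible_sub hs2 a1|exact: a2].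
- by split.
by exists s => // i; apply: hP; rewrite mem_enum.
Qed.

(** The time windows are indexed by [k], and [k <= s k] makes the window required at stage [k] part
    of the one available at stage [s k]. *)
Lemma zeroing_output_sequence_sub n N p (X : set 'cV[R]_n)
    (h : R -> 'cV[R]_n -> 'I_N -> 'cV[R]_p) (T : set (curve R n * (R -> 'I_N)))
    (t_ : nat -> R) (x_ : nat -> curve R n) (sigma_ : nat -> R -> 'I_N) (s : nat -> nat) :
  {homo s : i j / (i < j)%N} -> zeroing_output_sequence X h T t_ x_ sigma_ ->
  zeroing_output_sequence X h T (t_ \o s) (x_ \o s) (sigma_ \o s).
Proof.
move=> hs [too hT hdom [K [eps [cK KX eps0 hK]]] hz].
have sub k (t : R) : - k%:R <= t <= k%:R -> - (s k)%:R <= t <= (s k)%:R.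
  have ks : (k%:R : R) <= (s k)%:R by rewrite ler_nat increasing_geq.
  move=> /andP[h1 h2]; rewrite (le_trans h2 ks) andbT (le_trans _ h1)//.
  by rewrite lerN2.
split.
- exact: cvg_comp _ _ (increasing_cvg hs) too.
- by move=> k; exact: hT.
- by move=> k t /sub; exact: hdom.
- by exists K, eps; split => // k t /sub; exact: hK.
- apply: (ae_leb_sub hz) => t ht.
  exact: cvg_comp _ _ (increasing_cvg hs) ht.
Qed.

(** If no pair of thresholds worked, the failures at time threshold [k] and output threshold
    [1 / (k + 1)] would form a sequence contradicting the zeroing property. Unlike the sequential
    form, this one can be applied at single times, as is needed when the active index changes with
    [k]. *)
Lemma zeroing_pair_uniform n m m' (X K : set 'cV[R]_n) (g : R -> 'cV[R]_n -> 'cV[R]_m)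
    (g' : R -> 'cV[R]_n -> 'cV[R]_m') (eps e : R) :
  zeroing_pair X g g' -> compact K -> K `<=` X -> 0 < eps -> 0 < e ->
  exists2 T : R, 0 <= T & exists2 delta : R, 0 < delta &
    forall t v, T <= t -> K v -> eps <= enorm v -> `|g t v| < delta -> `|g' t v| < e.
Proof.
move=> zp cK KX eps0 e0; apply: contrapT => nh.
have step (k : nat) : exists tv : R * 'cV[R]_n, [/\ k%:R <= tv.1, K tv.2,
    eps <= enorm tv.2, `|g tv.1 tv.2| < k.+1%:R^-1 & e <= `|g' tv.1 tv.2|].
  apply: contrapT => nk; apply: nh; exists k%:R; first exact: ler0n.
  exists k.+1%:R^-1; first by rewrite invr_gt0.
  move=> t v kt Kv ev gv; rewrite ltNge; apply/negP => eg.
  by apply: nk; exists (t, v); split.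
have [tv htv] := choice step.
have t0 k : 0 <= (fst \o tv) k by have [h _ _ _ _] := htv k; exact: le_trans h.
have too : (fst \o tv) @ \oo --> +oo.
  apply/cvgryPge => A; near=> k.
  have [h _ _ _ _] := htv k; apply: le_trans h.
  by near: k; exact: nbhs_infty_ger.
have Kv k : K ((snd \o tv) k) by have [] := htv k.
have ev k : eps <= enorm ((snd \o tv) k) by have [] := htv k.
have gcvg : g ((fst \o tv) k) ((snd \o tv) k) @[k --> \oo] --> (0 : 'cV[R]_m).
  apply/cvgrPdist_lt => d d0; near=> k; rewrite sub0r normrN.
  have [_ _ _ h _] := htv k; apply: (lt_trans h).
  by near: k; exact: near_infty_natSinv_lt (PosNum d0).
have := zp (fst \o tv) K eps (snd \o tv) t0 too cK KX eps0 Kv ev gcvg.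
move=> /cvgrPdist_lt /(_ e e0) [k _ /(_ k (leqnn k))].
rewrite sub0r normrN ltNge => /negP; apply.
by have [] := htv k.
Unshelve. all: by end_near. Qed.

(* The zeroing property with a different index [i_ k] at each step: it survives
   because there are finitely many indices. *)
Lemma zeroing_pair_along n m m' N (X K : set 'cV[R]_n)
    (g : R -> 'cV[R]_n -> 'I_N -> 'cV[R]_m) (g' : R -> 'cV[R]_n -> 'I_N -> 'cV[R]_m')
    (eps : R) (t_ : nat -> R) (v_ : nat -> 'cV[R]_n) (i_ : nat -> 'I_N) :
  (forall i, zeroing_pair X (fun t xi => g t xi i) (fun t xi => g' t xi i)) ->
  compact K -> K `<=` X -> 0 < eps -> t_ @ \oo --> +oo ->
  (\forall k \near \oo, K (v_ k) /\ eps <= enorm (v_ k)) ->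
  g (t_ k) (v_ k) (i_ k) @[k --> \oo] --> (0 : 'cV[R]_m) ->
  g' (t_ k) (v_ k) (i_ k) @[k --> \oo] --> (0 : 'cV[R]_m').
Proof.
move=> zp cK KX eps0 too hv g0; apply/cvgrPdist_lt => e e0.
have h : \forall k \near \oo, forall i : 'I_N, i = i_ k -> `|g' (t_ k) (v_ k) i| < e.
  apply: filter_forall => i.
  have [T0 _ [delta d0 hd]] := zeroing_pair_uniform (zp i) cK KX eps0 e0.
  move/cvgryPge : too => /(_ T0) hT.
  move/cvgrPdist_lt : g0 => /(_ delta d0) hg.
  near=> k => ik; apply: hd.
  - by near: k.
  - by have [] : K (v_ k) /\ eps <= enorm (v_ k) by near: k.
  - by have [] : K (v_ k) /\ eps <= enorm (v_ k) by near: k.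
  - have : `|0 - g (t_ k) (v_ k) (i_ k)| < delta by near: k.
    by rewrite sub0r normrN ik.
by apply: filterS h => k hk; rewrite sub0r normrN; exact: hk.
Unshelve. all: by end_near. Qed.

Lemma state_controls_of_support n N (chi : 'I_N -> set 'cV[R]_n) (xi : 'cV[R]_n)
    (u : 'cV[R]_N) :
  @simplex R N u -> (forall i, ~ chi i xi -> u i 0 = 0) -> state_controls chi xi u.
Proof.
move=> [u0 u1] hu.
have [i0 hi0] : exists i0, chi i0 xi.
  apply: contrapT => nchi; have : \sum_(i < N) u i 0 = 0.
    by apply: big1 => i _; apply: hu => ci; apply: nchi; exists i.
  by rewrite u1 => /eqP; rewrite oner_eq0.
(* All vectors of a convex combination must come from active indices, so the canonical vector of an
   inactive index, whose weight is zero, is replaced by that of [i0]. Such an [i0] exists because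
   the weights sum to 1. *)
exists N, (fun i => u i 0),
  (fun i => canonical_vector R (if pselect (chi i xi) then i else i0)).
split => //.
  by move=> i; case: pselect => [ci|nci]; [exists i|exists i0].
apply/matrixP => j k; rewrite ord1 summxE (bigD1 j)//= big1.
  rewrite addr0 !mxE; case: pselect => [cj|ncj]; last by rewrite (hu _ ncj) mul0r.
  by rewrite !eqxx mulr1.
move=> i ij; rewrite !mxE; case: pselect => [ci|nci]; last by rewrite (hu _ nci) mul0r.
by rewrite (eq_sym j) (negbTE ij) mulr0.
Qed.

End extraction.

Section solutions.
Variable R : realType.
Local Notation lam := (@completed_lebesgue_measure R).

Lemma solution_shift n N (X K : set 'cV[R]_n) (f : R -> 'cV[R]_n -> 'I_N -> 'cV[R]_n)
    (sigma : R -> 'I_N) (x : curve R n) (s a b M : R) (j : 'I_n) (J : 'I_N -> set R) :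
  is_solution X f sigma x -> a <= b ->
  (forall t, a <= t <= b -> cdom x (s + t) /\ K (x (s + t))) ->
  (forall i, lam.-negligible (@nneg R `\` J i)) ->
  (forall i t xi, J i t -> K xi -> enorm (f t xi i) <= M) ->
  abs_cont a b (fun t => x (s + t) j 0) /\
  {ae lam, forall t : R, a <= t <= b ->
    is_derive t (1 : R) (fun r => x (s + r) j 0)
      (f (s + t) (x (s + t)) (sigma (s + t)) j 0) /\
    `|f (s + t) (x (s + t)) (sigma (s + t)) j 0| <= M}.
Proof.
move=> [x0 _ _ xac xd] ab hK nJ fM; split.
  apply: abs_cont_shift_coord; apply: xac.
  - by have [] := hK a; rewrite ?lexx.
  - by have [] := hK b; rewrite ?lexx ?andbT.
  - by rewrite lerD2l.
have hJ : {ae lam, forall t : R, forall i, 0 <= t -> J i t}.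
  apply: ae_leb_fin => i; apply: negligibleS (nJ i) => t /= h; split.
    by rewrite /nneg /= in_itv/= andbT; apply: contrapT => t0; apply: h => /t0.
  by move=> Jt; apply: h.
apply: (ae_leb_sub (ae_shift s (ae_leb_and xd hJ))) => t [h1 h2] tab.
have [ct Kt] := hK t tab.
split; first exact: is_derive_shift_coord (h1 ct).
apply: le_trans (coord_le_enorm _ _) _; apply: fM => //; apply: h2.
by have [h _] := ct; exact: le_trans h.
Qed.

End solutions.

(** * Passage to the limit *)

Section sums.
Context d (T : measurableType d) (R : realType)
  (m : {sigma_finite_measure set T -> \bar R}).
Local Notation integrable phi := (m.-integrable setT (EFin \o phi)).

Lemma Rintegral_fin_sum (I : finType) (F : I -> T -> R) : (forall i, integrable (F i)) ->
  integrable (fun t => \sum_i F i t) /\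
  \int[m]_t (\sum_i F i t) = \sum_i \int[m]_t F i t.
Proof.
move=> iF.
suff key (l : seq I) : integrable (fun t => \sum_(i <- l) F i t) /\
    \int[m]_t (\sum_(i <- l) F i t) = \sum_(i <- l) \int[m]_t F i t.
  by have := key (index_enum I).
elim: l => [|i l [il IHl]].
  have -> : (fun t => \sum_(i <- [::]) F i t) = cst 0 by apply/funext => t; rewrite big_nil.
  by split; [exact: integrable0|rewrite big_nil /Rintegral integral0].
have -> : (fun t => \sum_(i <- i :: l) F i t) = (fun t => F i t + \sum_(i <- l) F i t).
  by apply/funext => t; rewrite big_cons.
split; first exact: integrable_addr.
by rewrite RintegralD// big_cons IHl.
Qed.

Lemma integrable_weight_mul (w psi : T -> R) (B : R) : integrable w -> (forall t, 0 <= w t) ->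
  measurable_fun setT psi -> {ae m, forall t, `|psi t| <= B} ->
  integrable (fun t => w t * psi t).
Proof.
move=> iw w0 mpsi hB.
have iwB : integrable (fun t => B * w t).
  rewrite (_ : EFin \o _ = (fun t => B%:E * (EFin \o w) t)%E)//.
  exact: integrableZl.
apply: (integrable_ae_le _ _ iwB) => //.
  by apply: measurable_funM => //; exact: integrable_measurable iw.
apply: filterS hB => t hB _; rewrite normrM ger0_norm// mulrC.
by rewrite ler_wpM2r.
Qed.

Lemma ae_eq0_of_integral (phi : T -> R) : integrable phi ->
  {ae m, forall t, 0 <= phi t} -> \int[m]_t phi t = 0 -> {ae m, forall t, phi t = 0}.
Proof.
move=> iphi phi0 z.
have mphi : measurable_fun setT (EFin \o phi) := measurable_int _ iphi.
have z' : (\int[m]_t `|(EFin \o phi) t| = 0)%E.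
  rewrite -[LHS]fineK; last first.
    by apply: integrable_fin_num => //; exact: integrable_abse iphi.
  congr (_%:E); rewrite -z /Rintegral; congr fine.
  apply: ae_eq_integral => //.
  - exact: measurableT_comp.
  - by apply: filterS phi0 => t h _; rewrite /= ger0_norm.
have /(ae_eq_integral_abs m measurableT mphi) := z'.
by apply: filterS => t /(_ I) [].
Qed.

End sums.

Section weak_limits.
Variables (R : realType) (N : nat).
Local Notation lam := (@completed_lebesgue_measure R).
Local Notation integrable phi := (lam.-integrable [set: lebR R] (EFin \o (phi : lebR R -> R))).
Variables (v : nat -> R -> 'I_N) (u : R -> 'cV[R]_N).
Hypotheses (mv : forall k i, measurable_fun setT ((fun t => (v k t == i)%:R) : lebR R -> R))
  (uc : @controls R N u)
  (vu : forall i (phi : lebR R -> R), integrable phi ->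
     \int[lam]_t (phi t * (v k t == i)%:R) @[k --> \oo] --> \int[lam]_t (phi t * u t i 0)).

Lemma indicator_unit_valued k i : unit_valued ((fun t => (v k t == i)%:R) : lebR R -> R).
Proof. by split; [exact: mv|move=> t; case: (_ == _); rewrite ?lexx ?ler01]. Qed.

Lemma control_unit_valued i : unit_valued ((fun t => u t i 0) : lebR R -> R).
Proof.
case: uc => mu su; split; first exact: mu.
move=> t; have [u0 u1] := su t; rewrite u0 /= -u1 (bigD1 i)//= lerDl.
by apply: sumr_ge0 => j _.
Qed.

Lemma weak_limit_sum (phi : 'I_N -> lebR R -> R) : (forall i, integrable (phi i)) ->
  \int[lam]_t (\sum_i phi i t * (v k t == i)%:R) @[k --> \oo]
    --> \int[lam]_t (\sum_i phi i t * u t i 0).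
Proof.
move=> iphi.
have [_ ->] := @Rintegral_fin_sum _ (lebR R) R lam 'I_N (fun i t => phi i t * u t i 0)
  (fun i => integrableM_unit (iphi i) (control_unit_valued i)).
have E : (fun k => \int[lam]_t (\sum_i phi i t * (v k t == i)%:R)) =
    (fun k => \sum_i \int[lam]_t (phi i t * (v k t == i)%:R)).
  apply/funext => k.
  by have [_ ->] := @Rintegral_fin_sum _ (lebR R) R lam 'I_N (fun i t => phi i t * (v k t == i)%:R)
    (fun i => integrableM_unit (iphi i) (indicator_unit_valued k i)).
rewrite E; apply: cvg_big => [|i _]; first exact: add_continuous.
exact: vu.
Qed.

Lemma sum_indicator (phi : 'I_N -> R) (i0 : 'I_N) :
  \sum_i phi i * (i0 == i)%:R = phi i0.
Proof.
rewrite (bigD1 i0)//= eqxx mulr1 big1 ?addr0// => i ij.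
by rewrite eq_sym (negbTE ij) mulr0.
Qed.

(** The weighted integrals of [psi] at the active index tend to 0 by dominated convergence, and by
    weak convergence they tend to the integral of the weighted sum against [u]. A nonnegative
    function with zero integral vanishes almost everywhere. This serves both the output equation and
    the state constraint on the control. *)
Lemma weak_limit_zero (w : R -> R) (psi : 'I_N -> lebR R -> R) (B : R) :
  integrable w -> (forall t, 0 < w t) ->
  (forall i, measurable_fun setT (psi i)) ->
  {ae lam, forall t : R, forall i, 0 <= psi i t <= B} ->
  {ae lam, forall t : R, psi (v k t) t @[k --> \oo] --> (0 : R)} ->
  {ae lam, forall t : R, \sum_i psi i t * u t i 0 = 0}.
Proof.
move=> iw w0 mpsi psiB psi0.
have iwpsi i : integrable (fun t => w t * psi i t).
  apply: (@integrable_weight_mul _ (lebR R) R lam w (psi i) B) => //.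
    by move=> t; exact: ltW.
  by apply: (ae_leb_sub psiB) => t /(_ i)/andP[h1 h2]; rewrite ger0_norm.
have h1 := weak_limit_sum iwpsi.
have iS := (@Rintegral_fin_sum _ (lebR R) R lam 'I_N (fun i t => w t * psi i t * u t i 0)
  (fun i => integrableM_unit (iwpsi i) (control_unit_valued i))).1.
have Rint0 : \int[lam]_(t in [set: lebR R]) (cst 0 t : R) = 0.
  by rewrite /Rintegral integral0.
have [] := @Rintegral_dominated_cvg _ (lebR R) R lam setT
  (fun k t => \sum_i w t * psi i t * (v k t == i)%:R) (cst 0) (fun t => B * w t)
  measurableT _ (measurable_cst _) _ _ _.
- move=> k; apply: integrable_measurable.
  exact: (@Rintegral_fin_sum _ (lebR R) R lam 'I_N (fun i t => w t * psi i t * (v k t == i)%:R)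
    (fun i => integrableM_unit (iwpsi i) (indicator_unit_valued k i))).1.
- apply: (ae_leb_sub psi0) => t h _.
  under eq_fun do rewrite (sum_indicator (fun i => w t * psi i t)).
  by rewrite -(mulr0 (w t)); apply: cvgM h; exact: cvg_cst.
- rewrite (_ : EFin \o _ = (fun t => B%:E * (EFin \o w) t)%E)//.
  exact: integrableZl.
- apply: (ae_leb_sub psiB) => t h k _.
  rewrite (sum_indicator (fun i => w t * psi i t)) normrM gtr0_norm// mulrC.
  by have /andP[p0 pB] := h (v k t); rewrite ger0_norm// ler_wpM2r// ltW.
move=> _; rewrite Rint0 => h2.
have z : \int[lam]_t (\sum_i w t * psi i t * u t i 0) = 0.
  exact: (cvg_unique _ h1 h2).
have S0 : {ae lam, forall t : R, 0 <= \sum_i w t * psi i t * u t i 0}.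
  apply: (ae_leb_sub psiB) => t h; apply: sumr_ge0 => i _.
  have /andP[p0 _] := h i; have [_ /(_ t)/andP[u0 _]] := control_unit_valued i.
  by rewrite !mulr_ge0// ltW.
apply: (ae_leb_sub (ae_eq0_of_integral iS S0 z)) => t.
under eq_bigr do rewrite -mulrA.
rewrite -mulr_sumr => /eqP; rewrite mulf_eq0 gt_eqF//= => /eqP.
exact.
Qed.

End weak_limits.

Section limit_equation.
Variables (R : realType) (N : nat).
Local Notation lam := (@completed_lebesgue_measure R).
Local Notation integrable phi := (lam.-integrable [set: lebR R] (EFin \o (phi : lebR R -> R))).

Lemma integrable_itv_cst (a b c : R) :
  lam.-integrable (`[a, b]%classic : set (lebR R)) (EFin \o (cst c : lebR R -> R)).
Proof.
apply: measurable_bounded_integrable; first exact: leb_itv.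
- exact: leb_itv_lty.
- exact: measurable_cst.
- by exists `|c|; split; [rewrite num_real|move=> x /ltW xM u _; exact: xM].
Qed.

Lemma integrable_itv_indic (a b : R) : integrable (\1_(`[a, b]%classic : set (lebR R))).
Proof.
have := integrable_itv_cst a b 1.
rewrite integrable_mkcond; last exact: leb_itv.
rewrite (_ : _ \_ _ = EFin \o \1_(`[a, b]%classic : set (lebR R)))//.
by apply/funext => t; rewrite patchE /= indicE; case: (_ \in _).
Qed.

Variables (v : nat -> R -> 'I_N) (u : R -> 'cV[R]_N).
Hypotheses (mv : forall k i, measurable_fun setT ((fun t => (v k t == i)%:R) : lebR R -> R))
  (uc : @controls R N u)
  (vu : forall i (phi : lebR R -> R), integrable phi ->
     \int[lam]_t (phi t * (v k t == i)%:R) @[k --> \oo] --> \int[lam]_t (phi t * u t i 0)).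

(** Weak convergence tests against fixed functions, so the integrands [dd k] are first replaced by
    [phi] at the active index. The error vanishes by dominated convergence, and what is left depends
    on [k] through the indicators of the index alone. *)
Lemma weak_limit_integral (a b M B c : R) (phi : 'I_N -> lebR R -> R)
    (dd : nat -> R -> R) (y : nat -> R) (k0 : nat) :
  (forall i, measurable_fun setT (phi i)) ->
  {ae lam, forall t : R, forall i, `|phi i t| <= B} ->
  (forall k, (k0 <= k)%N -> [/\ measurable_fun (`[a, b]%classic : set (lebR R)) (dd k : lebR R -> R),
     {ae lam, forall t : R, a <= t <= b -> `|dd k t| <= M} &
     y k = \int[lam]_(t in `[a, b]) dd k t]) ->
  {ae lam, forall t : R, a <= t <= b -> (dd k t - phi (v k t) t) @[k --> \oo] --> (0 : R)} ->
  y @ \oo --> c ->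
  c = \int[lam]_(t in `[a, b]) (\sum_i phi i t * u t i 0).
Proof.
move=> mphi phiB hd hcvg hy.
pose D : set (lebR R) := `[a, b]%classic.
have mD : measurable D by exact: leb_itv.
have iphi i : integrable (fun t => \1_D t * phi i t).
  apply: (@integrable_weight_mul _ (lebR R) R lam (\1_D) (phi i) B).
  - exact: integrable_itv_indic.
  - by move=> t; rewrite indicE; case: (_ \in _).
  - exact: mphi.
  - by apply: (ae_leb_sub phiB) => t.
have h1 := weak_limit_sum mv uc vu iphi.
have DE (f : 'I_N -> lebR R -> R) : \int[lam]_t (\sum_i \1_D t * phi i t * f i t) =
    \int[lam]_(t in D) (\sum_i phi i t * f i t).
  rewrite [RHS]Rintegral_indicr; apply: eq_Rintegral => t _.
  by rewrite mulr_suml; apply: eq_bigr => i _; rewrite -mulrA mulrC.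
rewrite DE in h1; apply: (cvg_unique _ hy) => //.
pose S k t := \sum_i phi i t * (v k t == i)%:R.
have SE k t : S k t = phi (v k t) t by exact: (sum_indicator (fun i => phi i t)).
have mS k : measurable_fun setT (S k : lebR R -> R).
  by apply: measurable_sum => i; apply: measurable_funM => //; exact: mv.
have SB : {ae lam, forall t : R, forall k, `|S k t| <= B}.
  by apply: (ae_leb_sub phiB) => t h k; rewrite SE.
have iS k : lam.-integrable D (EFin \o (S k : lebR R -> R)).
  apply: (@integrable_ae_le _ (lebR R) R lam D (S k) (cst B)) => //.
  - exact: measurable_funTS.
  - exact: integrable_itv_cst.
  - by apply: (ae_leb_sub SB) => t h _.
have id k : (k0 <= k)%N -> lam.-integrable D (EFin \o (dd k : lebR R -> R)).
  move=> kk; have [md dM _] := hd k kk.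
  apply: (@integrable_ae_le _ (lebR R) R lam D (dd k) (cst M) mD md).
  - exact: integrable_itv_cst.
  - by apply: (ae_leb_sub dM) => t h; rewrite /D /= in_itv/=; exact: h.
have Rint0 : \int[lam]_(t in D) (cst 0 t : R) = 0 by rewrite /Rintegral integral0.
(* The facts about [dd k] hold from [k0] on, so all sequences are shifted by [k0] before dominated
   convergence is applied. *)
have hdM : {ae lam, forall t : R, forall k, a <= t <= b -> `|dd (k + k0)%N t| <= M}.
  by apply: ae_leb_all => k; have [] := hd (k + k0)%N (leq_addl _ _).
have [] := @Rintegral_dominated_cvg _ (lebR R) R lam D
    (fun k t => dd (k + k0)%N t - S (k + k0)%N t) (cst 0) (cst (M + B)) mD _ (measurable_cst _) _ _ _.
- move=> k; apply: measurable_funB; last exact: measurable_funTS.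
  by have [] := hd (k + k0)%N (leq_addl _ _).
- apply: (ae_leb_sub hcvg) => t h; rewrite /D /= in_itv/= => /h{}h.
  under eq_fun do rewrite SE.
  by rewrite -(cvg_shiftn k0) in h; exact: h.
- exact: integrable_itv_cst.
- apply: (ae_leb_sub (ae_leb_and hdM SB)) => t [h2 h3] k; rewrite /D /= in_itv/= => tab.
  by rewrite (le_trans (ler_normB _ _))// lerD// h2.
move=> _; rewrite Rint0 => h2.
have h2' : (y (k + k0)%N - \int[lam]_(t in D) S (k + k0)%N t) @[k --> \oo] --> (0 : R).
  apply: cvg_trans h2; apply: near_eq_cvg; apply: nearW => k /=.
  rewrite RintegralB//; last by apply: id; exact: leq_addl.
  by have [_ _ ->] := hd (k + k0)%N (leq_addl _ _).
have h1' : \int[lam]_(t in D) S (k + k0)%N t @[k --> \oo] -->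
    \int[lam]_(t in D) (\sum_i phi i t * u t i 0).
  have h : \int[lam]_(t in D) S k t @[k --> \oo] -->
      \int[lam]_(t in D) (\sum_i phi i t * u t i 0).
    by apply: cvg_trans h1; apply: near_eq_cvg; apply: nearW => k; rewrite DE.
  by rewrite -(cvg_shiftn k0) in h; exact: h.
suff h : y @ \oo --> \int[lam]_(t in D) (\sum_i phi i t * u t i 0) by exact: h.
have h : [sequence y (k + k0)%N]_k @ \oo --> \int[lam]_(t in D) (\sum_i phi i t * u t i 0).
  have h3 := @cvgD _ _ _ _ _ _ _ _ _ h2' h1'; rewrite add0r in h3.
  apply: cvg_trans (h3 _); apply: near_eq_cvg; apply: nearW => k /=.
  by rewrite /= subrK.
by rewrite cvg_shiftn in h; exact: h.
Qed.

End limit_equation.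

(** * Extraction of limit controls and limit curves *)

Section compactness.
Variables (R : realType) (n N : nat).
Local Notation lam := (@completed_lebesgue_measure R).
Local Notation integrable phi := (lam.-integrable [set: lebR R] (EFin \o (phi : lebR R -> R))).

(** The densities are found coordinate by coordinate. The indicators of a signal sum to 1, so the
    sum of the densities has the same weighted integral as 1 over every measurable set, and equals 1
    almost everywhere. *)
Lemma signal_weak_compactness (U : set_system nat) (v : nat -> R -> 'I_N) (w : R -> R) :
  UltraFilter U -> continuous w -> (forall t, 0 < w t) -> integrable w ->
  (forall k i, measurable_fun setT ((fun t => (v k t == i)%:R) : lebR R -> R)) ->
  exists2 u : R -> 'cV[R]_N, @controls R N u &
    forall i (A : set R), measurable (A : set (lebR R)) ->
      \int[lam]_t (w t * \1_(A : set (lebR R)) t * (v k t == i)%:R) @[k --> U] -->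
      \int[lam]_t (w t * \1_(A : set (lebR R)) t * u t i 0).
Proof.
move=> UU wc w0 iw mv.
have UP : ProperFilter U by exact: ultra_proper.
have vU k i : unit_valued ((fun t => (v k t == i)%:R) : lebR R -> R).
  by split; [exact: mv|move=> t; case: (_ == _); rewrite ?lexx ?ler01].
have ex i := @weak_density _ (lebR R) R lam w (weight_inv_measurable wc w0) w0 iw U
  (fun k t => (v k t == i)%:R) UU (fun k => vU k i).
have ex' i : exists u0 : lebR R -> R, unit_valued u0 /\
   forall A : set (lebR R), measurable A ->
     \int[lam]_t (w t * \1_A t * (v k t == i)%:R) @[k --> U] --> \int[lam]_t (w t * \1_A t * u0 t).
  by have [u0 h1 h2] := ex i; exists u0.
have [u0 hu] := choice ex'.
have iwA A : measurable A -> integrable (fun t => w t * \1_(A : set (lebR R)) t).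
  by move=> mA; exact: integrable_weight_indic.
pose s t := \sum_i u0 i t.
have ms : measurable_fun setT (s : lebR R -> R).
  by apply: measurable_sum => i; have [[]] := hu i.
have sB t : `|s t| <= N%:R.
  rewrite ger0_norm; last by apply: sumr_ge0 => i _; have [[_ /(_ t)/andP[]]] := hu i.
  rewrite -[X in X%:R]card_ord -sumr_const; apply: ler_sum => i _.
  by have [[_ /(_ t)/andP[]]] := hu i.
have iws : integrable (fun t => w t * s t).
  apply: (@integrable_weight_mul _ (lebR R) R lam w s N%:R) => //.
    by move=> t; exact: ltW.
  by exists set0; split => // t /=; apply.
have ws A : measurable (A : set (lebR R)) ->
    \int[lam]_(t in A) (w t * s t) = \int[lam]_(t in A) w t.
  move=> mA; rewrite [LHS]Rintegral_indicr [RHS]Rintegral_indicr.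
  have -> : \int[lam]_t (w t * s t * \1_(A : set (lebR R)) t) =
      \sum_i \int[lam]_t (w t * \1_(A : set (lebR R)) t * u0 i t).
    have [_ <-] := @Rintegral_fin_sum _ (lebR R) R lam 'I_N
      (fun i t => w t * \1_(A : set (lebR R)) t * u0 i t)
      (fun i => integrableM_unit (iwA A mA) (hu i).1).
    by apply: eq_Rintegral => t _; rewrite mulrAC mulr_sumr.
  have h : \sum_i \int[lam]_t (w t * \1_(A : set (lebR R)) t * (v k t == i)%:R) @[k --> U] -->
      \sum_i \int[lam]_t (w t * \1_(A : set (lebR R)) t * u0 i t).
    by apply: cvg_big => [|i _]; [exact: add_continuous|exact: (hu i).2].
  apply: (cvg_unique _ h) => //.
  apply: cvg_near_cst; apply: nearW => k.
  have [_ <-] := @Rintegral_fin_sum _ (lebR R) R lam 'I_N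
      (fun i t => w t * \1_(A : set (lebR R)) t * (v k t == i)%:R)
      (fun i => integrableM_unit (iwA A mA) (vU k i)).
  apply: eq_Rintegral => t _.
  exact: (sum_indicator (fun _ => w t * \1_(A : set (lebR R)) t)).
have s1 : {ae lam, forall t : R, s t = 1}.
  have iB1 : integrable (fun t => w t * s t - w t) by exact: integrable_subr.
  have iB2 : integrable (fun t => w t - w t * s t) by exact: integrable_subr.
  have z A : measurable (A : set (lebR R)) -> \int[lam]_(t in A) (w t * s t - w t) = 0.
    move=> mA; rewrite RintegralB//; first by rewrite ws// subrr.
      exact: integrableS iws.
    exact: integrableS iw.
  have z' A : measurable (A : set (lebR R)) -> \int[lam]_(t in A) (w t - w t * s t) = 0.
    move=> mA; rewrite RintegralB//; first by rewrite ws// subrr.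
      exact: integrableS iw.
    exact: integrableS iws.
  have g1 := ae_ge0_of_integral iB1 (fun A mA => eq_ind_r (fun x => 0 <= x) (lexx 0) (z A mA)).
  have g2 := ae_ge0_of_integral iB2 (fun A mA => eq_ind_r (fun x => 0 <= x) (lexx 0) (z' A mA)).
  apply: (ae_leb_sub (ae_leb_and g1 g2)) => t [].
  rewrite !subr_ge0 ler_pMr// ger_pMr// => h1 h2.
  by apply/eqP; rewrite eq_le h1 h2.
(* A control must lie in the simplex at every time; on the exceptional null set it is given a vertex
   as value. *)
pose u t : 'cV[R]_N := if pselect (s t = 1) then \col_i u0 i t else
  canonical_vector R (v 0%N t).
have uE : {ae lam, forall t : R, forall i, u t i 0 = u0 i t}.
  by apply: (ae_leb_sub s1) => t st i; rewrite /u; case: pselect => // h; rewrite mxE.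
have mu i : measurable_fun setT ((fun t => u t i 0) : lebR R -> R).
  apply: (@ae_measurable_leb R _ _ setT (u0 i)) => //; first by have [[]] := hu i.
  by apply: (ae_leb_sub uE) => t ->.
exists u.
  split => // t; rewrite /u; case: pselect => st; split.
  - by move=> i; rewrite mxE; have [[_ /(_ t)/andP[]]] := hu i.
  - by rewrite -[RHS]st; apply: eq_bigr => i _; rewrite mxE.
  - by move=> i; rewrite mxE; case: (_ && _).
  - rewrite (bigD1 (v 0%N t))//= big1 ?addr0 ?mxE ?eqxx// => i iv.
    by rewrite mxE (negbTE iv).
move=> i A mA.
suff -> : \int[lam]_t (w t * \1_(A : set (lebR R)) t * u t i 0) =
    \int[lam]_t (w t * \1_(A : set (lebR R)) t * u0 i t) by exact: (hu i).2.
apply: ae_eq_Rintegral.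
- apply: measurable_funM; last exact: mu.
  exact: integrable_measurable (iwA A mA).
- exact: integrable_measurable (integrableM_unit (iwA A mA) (hu i).1).
- by apply: (ae_leb_sub uE) => t ->.
Qed.

End compactness.

Section trajectory_compactness.
Variables (R : realType) (n N : nat).
Local Notation lam := (@completed_lebesgue_measure R).
Local Notation integrable phi := (lam.-integrable [set: lebR R] (EFin \o (phi : lebR R -> R))).

Lemma trajectory_compactness (K : set 'cV[R]_n) (M : R) (z_ : nat -> R -> 'cV[R]_n)
    (v : nat -> R -> 'I_N) :
  compact K -> 0 <= M ->
  (forall k (t : R), - k%:R <= t <= k%:R -> K (z_ k t)) ->
  (forall k j (a b : R), - k%:R <= a -> a <= b -> b <= k%:R ->
     `|z_ k b j 0 - z_ k a j 0| <= M * (b - a)) ->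
  (forall k i, measurable_fun setT ((fun t => (v k t == i)%:R) : lebR R -> R)) ->
  exists (s : nat -> nat) (z : R -> 'cV[R]_n) (u : R -> 'cV[R]_N),
    [/\ {homo s : i j / (i < j)%N},
        forall t, K (z t) /\ z_ (s k) t @[k --> \oo] --> z t,
        forall j (a b : R), a <= b -> `|z b j 0 - z a j 0| <= M * (b - a),
        @controls R N u &
        forall i (phi : lebR R -> R), integrable phi ->
          \int[lam]_t (phi t * (v (s k) t == i)%:R) @[k --> \oo]
            --> \int[lam]_t (phi t * u t i 0)].
Proof.
move=> cK M0 zK zM mv.
have [U [UU Uoo]] := @ultraFilterLemma nat \oo _.
have UP : ProperFilter U by exact: ultra_proper.
have Unear (t : R) : U [set k | - k%:R <= t <= k%:R].
  apply: Uoo.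
  have : \forall k \near \oo, `|t| <= k%:R by exact: nbhs_infty_ger.
  by apply: filterS => k; rewrite ler_norml.
have zex t : exists zt, K zt /\ z_ k t @[k --> U] --> zt.
  have := cK; rewrite compact_ultra => /(_ ((fun k => z_ k t) @ U)).
  case; first exact: ultra_map.
    by rewrite /fmap /=; apply: filterS (Unear t) => k; exact: zK.
  by move=> zt [h1 h2]; exists zt.
have [z hz] := choice zex.
have zcoord t j : z_ k t j 0 @[k --> U] --> z t j 0.
  exact: cvg_comp _ _ (hz t).2 (@coord_continuous R n 1 j 0 (z t)).
have zlip j (a b : R) : a <= b -> `|z b j 0 - z a j 0| <= M * (b - a).
  move=> ab; have h : `|z_ k b j 0 - z_ k a j 0| @[k --> U] --> `|z b j 0 - z a j 0|.
    by apply: cvg_norm; apply: cvgB; exact: zcoord.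
  apply: (ler_cvg_to h (cvg_cst _)).
  by apply: filterS2 (Unear a) (Unear b) => k /andP[ka _] /andP[_ kb]; exact: zM.
have [w [wc w0 iw]] := integrable_weight_exists R.
have [u uc hu] := signal_weak_compactness UU wc w0 iw mv.
pose A (o : option rat) : set R := if o is Some q then `]-oo, ratr q]%classic else setT.
have mA o : measurable (A o : set (lebR R)).
  by case: o => [q|]; [exact: leb_itv|exact: measurableT].
(* Countably many quantities determine everything: the states at rational times, by the Lipschitz
   bound, and the weighted integrals over rational rays and the whole line ([None]), by
   [weak_test_leb]. *)
pose C := ((rat * 'I_n) + (option rat * 'I_N))%type.
pose ac (c : C) (k : nat) : R := match c with
  | inl qj => z_ k (ratr qj.1) qj.2 0
  | inr oi => \int[lam]_t (w t * \1_(A oi.1 : set (lebR R)) t * (v k t == oi.2)%:R) end.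
pose lc (c : C) : R := match c with
  | inl qj => z (ratr qj.1) qj.2 0
  | inr oi => \int[lam]_t (w t * \1_(A oi.1 : set (lebR R)) t * u t oi.2 0) end.
have acl c : ac c @ U --> lc c.
  by case: c => [[q j]|[r i]]; [exact: zcoord|exact: hu (mA r)].
have [s hs hac] := ultra_extraction UU Uoo acl.
exists s, z, u; split => //.
- move=> t; split; first exact: (hz t).1.
  apply: cvg_coord => j; apply/cvgrPdist_lt => e e0.
  have e3 : 0 < e / 3 by rewrite divr_gt0.
  have M1 : 0 < M + 1 by rewrite ltr_wpDl.
  (* A rational [q] this close to [t] makes the Lipschitz errors of [z] and of [z_ (s k)] at most
     [e / 3] each; convergence at [q] supplies the last third. *)
  have te : t < t + e / 3 / (M + 1) by rewrite ltrDl divr_gt0.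
  have [q] := rat_in_itvoo te.
  rewrite in_itv/= => /andP[tq qt].
  have Mq : M * (ratr q - t) <= e / 3.
    have h : (M + 1) * (ratr q - t) <= e / 3.
      by rewrite mulrC -ler_pdivlMr// lerBlDl ltW.
    by apply: le_trans h; rewrite ler_wpM2r// ?lerDl// subr_ge0 ltW.
  have := hac (inl (q, j)) => /cvgrPdist_lt /(_ (e / 3) e3) /= hq.
  near=> k.
  have kq : `|z (ratr q) j 0 - z_ (s k) (ratr q) j 0| < e / 3 by near: k.
  have kt : `|t| <= k%:R by near: k; exact: nbhs_infty_ger.
  have kqr : `|ratr q| <= k%:R :> R by near: k; exact: nbhs_infty_ger.
  have ks : (k%:R : R) <= (s k)%:R by rewrite ler_nat increasing_geq.
  have h1 : `|z (ratr q) j 0 - z t j 0| <= M * (ratr q - t) by apply: zlip; exact: ltW.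
  have h2 : `|z_ (s k) (ratr q) j 0 - z_ (s k) t j 0| <= M * (ratr q - t).
    apply: zM; last 2 first.
    - exact: ltW.
    - by rewrite (le_trans (ler_norm _))// (le_trans kqr).
    by move: (le_trans kt ks); rewrite ler_norml => /andP[].
  have -> : z t j 0 - z_ (s k) t j 0 = (z t j 0 - z (ratr q) j 0) +
     (z (ratr q) j 0 - z_ (s k) (ratr q) j 0) + (z_ (s k) (ratr q) j 0 - z_ (s k) t j 0).
    by rewrite !subrKA.
  apply: le_lt_trans (ler_normD _ _) _; apply: le_lt_trans (lerD (ler_normD _ _) (lexx _)) _.
  rewrite [X in X + _ + _]distrC; lra.
- move=> i phi iphi.
  have iu : unit_valued ((fun t => u t i 0) : lebR R -> R) by exact: control_unit_valued.
  have iv k : unit_valued ((fun t => (v (s k) t == i)%:R) : lebR R -> R).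
    by split; [exact: mv|move=> t; case: (_ == _); rewrite ?lexx ?ler01].
  have [] := @weak_test_leb R w wc w0 iw (fun k t => (v (s k) t == i)%:R) (fun t => u t i 0) iv iu _ _ phi iphi.
  + split; first exact: integrable_weight_indic.
    exact: hac (inr (None, i)).
  + move=> q; split; first exact: integrable_weight_indic (leb_itv _).
    exact: hac (inr (Some q, i)).
  + by [].
Unshelve. all: by end_near. Qed.

End trajectory_compactness.

(** * Vector-valued Lipschitz curves and recovery of the differential equation *)

Section main_helpers.
Variable R : realType.
Local Notation lam := (@completed_lebesgue_measure R).

(** Convergence is uniform over the finitely many indices, so the index may vary with [k] although
    neither term need converge by itself. *)
Lemma finite_index_cvg N m (a_ : nat -> 'I_N -> 'cV[R]_m) (b : 'I_N -> 'cV[R]_m)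
    (i_ : nat -> 'I_N) :
  (forall i, a_ k i @[k --> \oo] --> b i) ->
  (a_ k (i_ k) - b (i_ k)) @[k --> \oo] --> (0 : 'cV[R]_m).
Proof.
move=> h; apply/cvgrPdist_lt => e e0.
have : \forall k \near \oo, forall i, `|b i - a_ k i| < e.
  by apply: filter_forall => i; have /cvgrPdist_lt := h i; apply.
by apply: filterS => k hk; rewrite sub0r opprB hk.
Qed.

Lemma enorm_le n (v : 'cV[R]_n) (B : R) : 0 <= B -> (forall j, `|v j 0| <= B) ->
  enorm v <= n%:R * B.
Proof.
move=> B0 vB; rewrite -[leRHS]ger0_norm ?mulr_ge0// -sqrtr_sqr /enorm.
rewrite ler_sqrt ?sqr_ge0//.
apply: (@le_trans _ _ (\sum_(i < n) B ^+ 2)).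
  by apply: ler_sum => i _; rewrite -real_normK ?num_real// lerXn2r ?nnegrE.
rewrite sumr_const card_ord -[leLHS]mulr_natl exprMn ler_wpM2r ?sqr_ge0//.
by case: n {v vB} => [|n]; rewrite ?expr0n// expr2 ler_peMl// ler1n.
Qed.

Lemma lipschitz_abs_continuous n (z : R -> 'cV[R]_n) (M a b : R) : 0 <= M ->
  (forall j (s t : R), s <= t -> `|z t j 0 - z s j 0| <= M * (t - s)) ->
  abs_continuous a b z.
Proof.
move=> M0 zM e e0.
have nM : 0 < n%:R * M + 1 by rewrite ltr_wpDl// mulr_ge0.
exists (e / (n%:R * M + 1)); first by rewrite divr_gt0.
move=> m lo hi lohi _; rewrite ltr_pdivlMr// => hs.
apply: le_lt_trans hs; rewrite mulr_suml; apply: ler_sum => i _.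
have [_ h _] := lohi i.
have d0 : 0 <= hi i - lo i by rewrite subr_ge0.
apply: (@le_trans _ _ (n%:R * (M * (hi i - lo i)))).
  by apply: enorm_le; [exact: mulr_ge0|move=> j; rewrite !mxE; exact: zM].
by rewrite mulrA mulrC ler_wpM2l// lerDl.
Qed.

Lemma coord_lipschitz_continuous n (z : R -> 'cV[R]_n) (M : R) :
  (forall j (s t : R), s <= t -> `|z t j 0 - z s j 0| <= M * (t - s)) ->
  continuous z.
Proof.
move=> zM t; apply: cvg_coord => j.
exact: (@lipschitz_continuous R (fun s => z s j 0) M (zM j) t).
Qed.

Lemma measurable_enorm d (T : measurableType d) n (g : T -> 'cV[R]_n) :
  (forall j, measurable_fun setT (fun t => g t j 0)) ->
  measurable_fun setT (fun t => enorm (g t)).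
Proof.
move=> mg; apply: (@measurableT_comp _ _ _ _ _ _ (@Num.sqrt R)).
  by apply: continuous_measurable_fun; exact: sqrt_continuous.
by apply: measurable_sum => j; apply: measurable_funX; exact: mg.
Qed.

Lemma ae_is_derive_of_integral (y : R -> R) (g : lebR R -> R) (B : R) :
  measurable_fun setT g -> {ae lam, forall t : R, `|g t| <= B} ->
  (forall a b : R, a <= b -> y b - y a = \int[lam]_(t in `[a, b]) g t) ->
  {ae lam, forall t : R, is_derive t (1 : R) y (g t)}.
Proof.
move=> mg gB hy.
(* The bound on [g] holds almost everywhere, while the differentiation theorem asks for it at every
   time. *)
pose g' t := if `|g t| <= `|B| then g t else 0.
have gg' : {ae lam, forall t : R, g t = g' t}.
  by apply: (ae_leb_sub gB) => t h; rewrite /g' (le_trans h (ler_norm _)).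
have mg' : measurable_fun setT (g' : lebR R -> R).
  apply: (@ae_measurable_leb R _ (measurableTypeR R) setT g g' measurableT mg).
  by apply: (ae_leb_sub gg') => t ->.
have g'B t : `|g' t| <= `|B| by rewrite /g'; case: ifPn => //; rewrite normr0.
have int' (a b : R) : \int[lam]_(t in `[a, b]) g t = \int[lam]_(t in `[a, b]) g' t.
  rewrite [LHS]Rintegral_indicr [RHS]Rintegral_indicr; apply: ae_eq_Rintegral.
  - apply: measurable_funM; first exact: mg.
    by apply: measurable_indic; exact: leb_itv.
  - apply: measurable_funM; first exact: mg'.
    by apply: measurable_indic; exact: leb_itv.
  - by apply: (ae_leb_sub gg') => t ->.
(* The differentiation theorem reaches the times to the right of its base point; base points running
   to minus infinity cover the line at the cost of countably many null sets. *)
have h := ae_leb_all (fun m : nat => lebesgue_differentiation_leb (- m%:R) mg' g'B).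
apply: (ae_leb_sub (ae_leb_and gg' h)) => t [gt ht].
have [m hm] : exists m : nat, - m%:R < t.
  exists (Num.truncn `|t|).+1; rewrite ltrNl.
  apply: le_lt_trans (truncnS_gt _); by rewrite -normrN ler_norm.
have := ht m hm; rewrite -gt => dG.
pose F s := \int[lam]_(u in `[- m%:R, s]) g' u.
have dF : is_derive t (1 : R) (fun s => y (- m%:R) + F s) (g t).
  by rewrite -[g t]add0r; apply: is_deriveD.
apply: near_eq_is_derive dF => //.
near=> s; rewrite /F -int' -hy ?subrKC//.
apply: ltW; near: s; exact: lt_nbhsr.
Unshelve. all: by end_near. Qed.

End main_helpers.

Theorem mainTheorem1 (R : realType) (n N p : nat)
  (X : set 'cV[R]_n)
  (f fhat Df : R -> 'cV[R]_n -> 'I_N -> 'cV[R]_n)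
  (h : R -> 'cV[R]_n -> 'I_N -> 'cV[R]_p)
  (T : set (curve R n * (R -> 'I_N)))
  (chi : 'I_N -> set 'cV[R]_n)
  (X_open : open X) (X_origin : X 0)
  (f_caratheodory : forall i,
     caratheodory_conditions X (fun t xi => f t xi i))
  (h_standing : forall i,
     measurable_in_time (@nneg R) X (fun t xi => h t xi i) /\
     continuous_in_state (@nneg R) X (fun t xi => h t xi i))
  (f_bounded : forall i,
     uniformly_bounded (@nneg R) X (fun t xi => f t xi i))
  (h_regular : forall i,
     [/\ uniformly_bounded (@nneg R) X (fun t xi => h t xi i),
         measurable_in_time (@nneg R) X (fun t xi => h t xi i),
         continuous_in_state_uniformly (@nneg R) X (fun t xi => h t xi i) &
         precompact_in_time X (fun t xi => h t xi i)])
  (f_decomposition : forall i (t : R) xi, 0 <= t -> X xi ->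
     f t xi i = fhat t xi i + Df t xi i)
  (fhat_regular : forall i,
     [/\ uniformly_bounded (@nneg R) X (fun t xi => fhat t xi i),
         measurable_in_time (@nneg R) X (fun t xi => fhat t xi i),
         continuous_in_state_uniformly (@nneg R) X (fun t xi => fhat t xi i) &
         precompact_in_time X (fun t xi => fhat t xi i)])
  (zeroing : forall i,
     zeroing_pair X (fun t xi => h t xi i) (fun t xi => Df t xi i))
  (T_trajectories : forall z, T z -> is_trajectory X f z)
  (chi_covering : closed_covering chi)
  (T_invariant : invariant_wrt T chi)
  (limiting_wzsd : forall gamma, common_admissible X fhat h gamma ->
     reduced_limiting_system_wzsd X chi T fhat h gamma) :
  wzsd_pair X h T.
Proof.
(* Precompactness yields a subsequence of the shifting times admissible for all [fhat i] and [h i],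
   and the zeroing-output property passes to it. *)
have key (t_ : nat -> R) x_ sigma_ : zeroing_output_sequence X h T t_ x_ sigma_ ->
    common_admissible X fhat h t_ -> False; last first.
  move=> [t_ [x_ [sigma_ zos]]].
  have [too hT hdom _ _] := zos.
  (* Each window contains 0, so [t_ k] lies in the domain of [x_ k], which starts at a nonnegative
     time. *)
  have t0 k : 0 <= t_ k.
    have [_ [[x0 _ _ _ _] _]] := T_trajectories _ (hT k).
    have [] := hdom k 0; first by rewrite oppr_le0 ler0n.
    by rewrite addr0 => /(le_trans x0).
  have [s hs adm] := common_admissible_extraction
    (fun i => let: And4 _ _ _ h := fhat_regular i in h)
    (fun i => let: And4 _ _ _ h := h_regular i in h) t0 too.
  exact: key (zeroing_output_sequence_sub hs zos) adm.
move=> zos adm.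
have [too hT hdom [K [eps [cK KX eps0 hK]]] hz] := zos.
pose z_ k t := x_ k (t_ k + t).
pose v k t := sigma_ k (t_ k + t).
have sol k : is_solution X f (sigma_ k) (x_ k) by have [_ []] := T_trajectories _ (hT k).
have fM' i : exists JM : set R * R, completed_lebesgue_measure.-negligible (@nneg R `\` JM.1) /\
    forall t xi, JM.1 t -> K xi -> enorm (f t xi i) <= JM.2.
  have [J [_ nJ b]] := f_bounded i; have [M hM] := b K cK KX.
  by exists (J, M).
have [JM hJM] := choice fM'.
(* A sum of absolute values dominates each of its terms, giving one constant for all indices; [BF]
   and [BH] are formed in the same way. *)
pose M := \sum_i `|(JM i).2|.
have M0 : 0 <= M by apply: sumr_ge0.
have fM i t xi : (JM i).1 t -> K xi -> enorm (f t xi i) <= M.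
  move=> Jt Kxi; have [_ /(_ t xi Jt Kxi) h1] := hJM i.
  apply: le_trans h1 _; rewrite /M (bigD1 i)//= (le_trans (ler_norm _))// lerDl.
  exact: sumr_ge0.
have dom k (a b t : R) : - k%:R <= a -> b <= k%:R -> a <= t <= b ->
    cdom (x_ k) (t_ k + t) /\ K (x_ k (t_ k + t)).
  move=> ka bk /andP[at_ tb]; have kt : - k%:R <= t <= k%:R by rewrite (le_trans ka at_) (le_trans tb bk).
  by split; [exact: hdom|have [] := hK k t kt].
have solS k j (a b : R) : - k%:R <= a -> a <= b -> b <= k%:R ->
   abs_cont a b (fun t => z_ k t j 0) /\
   {ae completed_lebesgue_measure, forall t : R, a <= t <= b ->
     is_derive t (1 : R) (fun r => z_ k r j 0)
      (f (t_ k + t) (z_ k t) (v k t) j 0) /\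
     `|f (t_ k + t) (z_ k t) (v k t) j 0| <= M}.
  move=> ka ab bk.
  exact: (solution_shift (J := fun i => (JM i).1) j (sol k) ab
    (fun t => dom k a b t ka bk) (fun i => (hJM i).1) fM).
have zlip k j (a b : R) : - k%:R <= a -> a <= b -> b <= k%:R ->
    `|z_ k b j 0 - z_ k a j 0| <= M * (b - a).
  move=> ka ab bk; have [h1 h2] := solS k j a b ka ab bk.
  apply: (abs_cont_derive_bound (x := fun t => z_ k t j 0) ab M0 h1).
  by apply: (ae_leb_sub h2) => t ht /ht[h3 h4]; eexists; [exact: h3|exact: h4].
have mv k i : measurable_fun setT ((fun t => (v k t == i)%:R) : lebR R -> R).
  have [ss _] := T_trajectories _ (hT k).
  exact: measurableT_comp (switching_signal_measurable i ss) (measurable_shift_leb (t_ k)).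
have [s [z [u [hs hzz zl uc vu]]]] := trajectory_compactness cK M0
  (fun k t kt => (hK k t kt).1) zlip mv.
have zK t : K (z t) := (hzz t).1.
have zX t : X (z t) := KX _ (zK t).
have zcvg t : z_ (s k) t @[k --> \oo] --> z t := (hzz t).2.
have zc : continuous z := coord_lipschitz_continuous zl.
pose gamma := t_ \o s.
have gammaoo : gamma @ \oo --> +oo by exact: cvg_comp _ _ (increasing_cvg hs) too.
have near_dom (t : R) : \forall k \near \oo, - (s k)%:R <= t <= (s k)%:R.
  have : \forall k \near \oo, `|t| <= k%:R by exact: nbhs_infty_ger.
  apply: filterS => k kt; rewrite -ler_norml (le_trans kt)// ler_nat.
  exact: increasing_geq.
have gadm : common_admissible X fhat h gamma.
  by move=> i; have [a1 a2] := adm i; split; exact: admissible_sub.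
have exf i : exists g, limiting_function X (fun t xi => fhat t xi i) gamma g.
  by have [[_ _ hg] _] := gadm i.
have exh i : exists g, limiting_function X (fun t xi => h t xi i) gamma g.
  by have [_ [_ _ hg]] := gadm i.
have [flim' hflim] := choice exf.
have [hlim' hhlim] := choice exh.
pose flim t xi i := flim' i t xi.
pose hlim t xi i := hlim' i t xi.
have regf i : exists Mw : R * (R -> R), modulus Mw.2 /\ {ae completed_lebesgue_measure,
    forall t : R, regular_time (fun t xi => fhat t xi i) (flim' i) gamma K Mw.1 Mw.2 t}.
  have [b _ c _] := fhat_regular i.
  have [M1 [w1 [wm reg]]] := regular_time_ae b c (hflim i) cK KX.
  by exists (M1, w1).
have regh i : exists Mw : R * (R -> R), modulus Mw.2 /\ {ae completed_lebesgue_measure,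
    forall t : R, regular_time (fun t xi => h t xi i) (hlim' i) gamma K Mw.1 Mw.2 t}.
  have [b _ c _] := h_regular i.
  have [M1 [w1 [wm reg]]] := regular_time_ae b c (hhlim i) cK KX.
  by exists (M1, w1).
have [MF rf] := choice regf; have [MH rh] := choice regh.
pose BF := \sum_i `|(MF i).1|; pose BH := \sum_i `|(MH i).1|.
have leB (b : 'I_N -> R) i (r : R) : r <= b i -> r <= \sum_i `|b i|.
  move=> ri; apply: le_trans ri _; rewrite (bigD1 i)//= (le_trans (ler_norm _))// lerDl.
  exact: sumr_ge0.
have regF : {ae completed_lebesgue_measure, forall t : R, forall i,
    regular_time (fun t xi => fhat t xi i) (flim' i) gamma K (MF i).1 (MF i).2 t}.
  by apply: ae_leb_fin => i; have [] := rf i.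
have regH : {ae completed_lebesgue_measure, forall t : R, forall i,
    regular_time (fun t xi => h t xi i) (hlim' i) gamma K (MH i).1 (MH i).2 t}.
  by apply: ae_leb_fin => i; have [] := rh i.
have Knear t : \forall k \near \oo, K (z_ (s k) t) /\ eps <= enorm (z_ (s k) t).
  by apply: filterS (near_dom t) => k; exact: hK.
have Knear1 t : \forall k \near \oo, K (z_ (s k) t) by apply: filterS (Knear t) => k [].
(* The active index need not converge at a fixed time, so both statements evaluate the limiting
   functions at the index active at stage [k]. The first compares the vanishing output with its
   limiting function; the second does the same for [fhat], the perturbation vanishing by
   [zeroing_pair_along]. *)
have hzero : {ae completed_lebesgue_measure, forall t : R,
    hlim t (z t) (v (s k) t) @[k --> \oo] --> (0 : 'cV[R]_p) /\
    (f (gamma k + t) (z_ (s k) t) (v (s k) t) - flim t (z t) (v (s k) t))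
      @[k --> \oo] --> (0 : 'cV[R]_n)}.
  apply: (ae_leb_sub (ae_leb_and hz (ae_leb_and regF regH))) => t [hzt [rF rH]].
  have h0 : h (gamma k + t) (z_ (s k) t) (v (s k) t) @[k --> \oo] --> (0 : 'cV[R]_p).
    exact: cvg_comp _ _ (increasing_cvg hs) hzt.
  have tgamma : (fun k => gamma k + t) @ \oo --> +oo.
    apply/cvgryPge => A; move/cvgryPge : gammaoo => /(_ (A - t)).
    by apply: filterS => k; rewrite lerBlDr.
  have D0 : Df (gamma k + t) (z_ (s k) t) (v (s k) t) @[k --> \oo] --> (0 : 'cV[R]_n).
    exact: (zeroing_pair_along zeroing cK KX eps0 tgamma (Knear t) h0).
  split.
    have h1 := finite_index_cvg (fun k => v (s k) t) (fun i =>
      @regular_time_cvg R n p _ _ gamma K _ _ gammaoo (rh i).1 t (fun k => z_ (s k) t) (z t)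
      (rH i) (Knear1 t) (zK t) (zcvg t)).
    have h2 := cvgB h0 h1; rewrite subr0 in h2.
    by apply: cvg_trans (h2 _); apply: near_eq_cvg; apply: nearW => k /=; rewrite subKr.
  have h1 := finite_index_cvg (fun k => v (s k) t) (fun i =>
      @regular_time_cvg R n n _ _ gamma K _ _ gammaoo (rf i).1 t (fun k => z_ (s k) t) (z t)
      (rF i) (Knear1 t) (zK t) (zcvg t)).
  have h2 := cvgD h1 D0; rewrite addr0 in h2.
  apply: cvg_trans (h2 _); apply: near_eq_cvg.
  near=> k => /=.
  rewrite f_decomposition//; first by rewrite addrAC.
    by near: k; exact: near_nonneg.
  by apply: KX; near: k; exact: Knear1.
have [w [wc w0 iw]] := integrable_weight_exists R.
have mflim i j : measurable_fun setT ((fun t => flim t (z t) i j 0) : lebR R -> R).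
  have [_ mf _ _] := fhat_regular i.
  apply: (limiting_function_comp_measurable (phi := fun xi : 'cV[R]_n => xi j 0)
    gammaoo (rf i).1 KX (rf i).2 zK zc).
    exact: coord_continuous.
  by move=> xi Xxi; exact: (limiting_function_measurable j gammaoo mf (hflim i) Xxi).
have mhlim i : measurable_fun setT ((fun t => enorm (hlim t (z t) i)) : lebR R -> R).
  have [_ mf _ _] := h_regular i.
  apply: (limiting_function_comp_measurable (phi := @enorm R p)
    gammaoo (rh i).1 KX (rh i).2 zK zc).
    exact: enorm_continuous.
  move=> xi Xxi; apply: measurable_enorm => j.
  exact: (limiting_function_measurable j gammaoo mf (hhlim i) Xxi).
have flimB : {ae completed_lebesgue_measure, forall t : R, forall i,
    enorm (flim t (z t) i) <= BF}.
  apply: (ae_leb_sub regF) => t rF i; apply: (leB (fun i => (MF i).1) i).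
  exact: (regular_time_bound gammaoo (rF i) (zK t)).
have hlimB : {ae completed_lebesgue_measure, forall t : R, forall i,
    0 <= enorm (hlim t (z t) i) <= BH}.
  apply: (ae_leb_sub regH) => t rH i; rewrite enorm_ge0/=.
  apply: (leB (fun i => (MH i).1) i).
  exact: (regular_time_bound gammaoo (rH i) (zK t)).
have mv' k i := mv (s k) i.
have u01 t i : 0 <= u t i 0 <= 1 by have [_] := control_unit_valued uc i.
have outputs : {ae completed_lebesgue_measure, forall t : R,
    \sum_i enorm (hlim t (z t) i) * u t i 0 = 0}.
  apply: (weak_limit_zero mv' uc vu iw w0 mhlim hlimB).
  apply: (ae_leb_sub hzero) => t [h1 _].
  by have := cvg_comp _ _ h1 (@enorm_continuous R p 0); rewrite enorm0.
(* If [z t] lies outside the closed set [chi i], so do the states [z_ (s k) t] for large [k], and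
   invariance forbids [i] as active index. The indicator taken at the active index is therefore
   eventually zero. *)
have supports : {ae completed_lebesgue_measure, forall t : R,
    \sum_i \1_(z @^-1` (~` chi i)) t * u t i 0 = 0}.
  have oO i : open (z @^-1` (~` chi i)).
    by apply: open_comp => //; apply: closed_openC; have [] := chi_covering.
  apply: (@weak_limit_zero R N (fun k => v (s k)) u mv' uc vu w
    (fun i => \1_(z @^-1` (~` chi i))) 1 iw w0).
  - move=> i; apply: measurable_indic; apply: borel_measurable_leb.
    exact: open_measurable.
  - exists set0; split => // t /= []; move=> i; rewrite indicE.
    by case: (_ \in _); rewrite ?lexx ?ler01.
  - exists set0; split => // t /= []; apply: cvg_near_cst.
    have : \forall k \near \oo, forall i, ~ chi i (z t) -> ~ chi i (z_ (s k) t).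
      apply: filter_forall => i; have [ci|nci] := pselect (chi i (z t)); first exact: nearW.
      have oi : open (~` chi i) by apply: closed_openC; have [] := chi_covering.
      have hk : \forall k \near \oo, (~` chi i) (z_ (s k) t).
        exact: (zcvg t _ (open_nbhs_nbhs (conj oi nci))).
      by apply: filterS hk => k nck _.
    apply: filterS2 (near_dom t) => k kt hk.
    rewrite indicE memNset//= => nchi; apply: (hk _ nchi).
    by apply: T_invariant (hT (s k)) _ _; exact: hdom.
have ode j : {ae completed_lebesgue_measure, forall t : R,
    is_derive t (1 : R) (fun t => z t j 0) (\sum_i flim t (z t) i j 0 * u t i 0)}.
  apply: (@ae_is_derive_of_integral R _ _ (N%:R * BF)).
  - apply: measurable_sum => i; apply: measurable_funM; first exact: mflim.
    by case: uc => mu _; exact: mu.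
  - apply: (ae_leb_sub flimB) => t hB; rewrite (le_trans (ler_norm_sum _ _ _))//.
    rewrite -[X in X%:R * _]card_ord mulr_natl -sumr_const; apply: ler_sum => i _.
    have /andP[u0 u1] := u01 t i.
    rewrite normrM (ger0_norm u0) (le_trans _ (hB i))// (le_trans _ (coord_le_enorm _ j))//.
    by rewrite ler_piMr.
  - move=> a b ab.
    (* From [k0] on, the window of the shifted curve contains the interval of integration. *)
    have [k0 _ hk0] : \forall k \near \oo, - (s k)%:R <= a /\ b <= (s k)%:R.
      by apply: filterS2 (near_dom a) (near_dom b) => k /andP[h1 _] /andP[_ h2].
    apply: (@weak_limit_integral R N (fun k => v (s k)) u mv' uc vu a b M BF _
      (fun i t => flim t (z t) i j 0)
      (fun k t => f (gamma k + t) (z_ (s k) t) (v (s k) t) j 0)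
      (fun k => z_ (s k) b j 0 - z_ (s k) a j 0) k0).
    + by move=> i; exact: mflim.
    + by apply: (ae_leb_sub flimB) => t hB i; exact: le_trans (coord_le_enorm _ _) (hB i).
    + move=> k /hk0[h1 h2]; have [acz dz] := solS (s k) j a b h1 ab h2.
      have [m1 m2] := abs_cont_FTC ab M0 acz dz; split => //.
      by apply: (ae_leb_sub dz) => t ht /ht[].
    + apply: (ae_leb_sub hzero) => t [_ h1] _.
      have := cvg_comp _ _ h1 (@coord_continuous R n 1 j 0 0); rewrite mxE.
      by apply: cvg_trans; apply: near_eq_cvg; apply: nearW => k /=; rewrite !mxE.
    + by apply: cvgB; exact: cvg_comp _ _ (zcvg _) (@coord_continuous R n 1 j 0 _).
have lim_controls : limiting_controls T u.
  split => //; exists gamma, (sigma_ \o s); split => //.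
    by move=> k; exists (x_ (s k)); exact: hT.
  move=> phi iphi.
  have := weak_limit_sum mv' uc vu (phi := fun i t => phi t i 0) iphi.
  have E (b : R -> 'cV[R]_N) (t : R) : ((phi t)^T *m b t) 0 0 = \sum_i phi t i 0 * b t i 0.
    by rewrite mxE; apply: eq_bigr => i _; rewrite mxE.
  have -> : (fun k => \int[completed_lebesgue_measure]_t (\sum_i phi t i 0 * (v (s k) t == i)%:R)) =
    (fun k => \int[completed_lebesgue_measure]_t
      ((phi t)^T *m @signal_control R N ((sigma_ \o s) k) (gamma k + t)) 0 0).
    apply/funext => k; apply: eq_Rintegral => t _.
    rewrite (E (fun t => @signal_control R N ((sigma_ \o s) k) (gamma k + t))).
    by apply: eq_bigr => i _; rewrite mxE andbT eq_sym.
  by under [X in _ --> X -> _]eq_Rintegral do rewrite -E.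
have ct : complete_trajectory X chi T flim hlim z u.
  split => //; first by move=> a b _; exact: lipschitz_abs_continuous M0 zl.
  apply: (ae_leb_sub (ae_leb_and (ae_leb_fin ode) (ae_leb_and outputs supports))).
  move=> t [ht [ot st]]; split.
  - apply: state_controls_of_support; first by case: uc => _; exact.
    move=> i nchi.
    (* A zero sum of nonnegative terms has zero terms, so each weight [u t i 0] with [z t] outside
       [chi i] vanishes. *)
    have /psumr_eq0P : forall i, true -> 0 <= (\1_(z @^-1` (~` chi i)) t : R) * u t i 0.
      by move=> i' _; rewrite mulr_ge0//; have /andP[] := u01 t i'.
    move=> /(_ st i isT); rewrite indicE mem_set// mul1r; exact.
  - apply: is_derive_of_coord => j.
    have -> : (Fhat_mx flim t (z t) *m u t) j 0 = \sum_i flim t (z t) i j 0 * u t i 0.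
      by rewrite mxE; apply: eq_bigr => i _; rewrite mxE.
    exact: ht.
  - apply/matrixP => a b; rewrite !ord1 !mxE -[RHS]ot.
    by apply: eq_bigr => i _; rewrite mxE.
have := limiting_wzsd gamma gadm flim hlim hflim hhlim z u ct.
move=> /(_ (ex_intro _ K (And3 cK KX _))) inf0.
have zeps t : eps <= enorm (z t).
  have h1 := cvg_comp _ _ (zcvg t) (@enorm_continuous R n (z t)).
  by apply: (ler_cvg_to (cvg_cst _) h1); apply: filterS (Knear t) => k [].
have : eps <= 0.
  rewrite -inf0; last by move=> _ [t _ <-].
  apply: lb_le_inf; first by exists (enorm (z 0)); exists 0.
  by move=> _ [t _ <-].
by rewrite leNgt eps0.
Unshelve. all: by end_near. Qed.
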